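(* Let $T$ be a real-valued, zero mean, $2$-weakly isotropic Gaussian random field on the unit sphere $\mathbb{S}^2\subset\mathbb{R}^3$ whose angular power spectrum $(C_\ell,\ell\in\mathbb{N}_0)$ is of the form $C_\ell=\prod_{i=1}^M(\kappa_i+\ell(\ell+1))^{-1}$ for all $\ell\in\mathbb{N}_0$, with $M\in\mathbb{N}$ and $\kappa_1,\dots,\kappa_M\in\mathbb{C}$. For $m\in\mathbb{Z}$ and $z=\cos\theta\in[-1,1]$ with $\theta\in[0,\pi]$, set $$g_m(z):=\frac{1}{2\pi}\int_0^{2\pi}T(\theta,\phi)\,e^{-im\phi}\,\mathrm{d}\phi .$$ Then the sequence $(g_m,\,m\in\mathbb{N}_0)$ consists of pairwise independent centred Gaussian random fields on $[-1,1]$ with covariance given, for $z_1,z_2\in[-1,1]$, by $$C_{g_m}(z_1,z_2):=\mathbb{E}\big(\overline{g_m(z_1)}\,g_m(z_2)\big)=\sum_{\ell\ge|m|}C_\ell\,L_{\ell m}(z_1)\,L_{\ell m}(z_2),$$ while the functions $(g_m,\,m<0)$ with negative index are determined by the relation $g_m=\overline{g_{-m}}$.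
   Context: Points of $\mathbb{S}^2$ are written in spherical coordinates $(\theta,\phi)\in[0,\pi]\times[0,2\pi)$ (inclination and azimuth). Legendre polynomials: $P_\ell(\mu)=2^{-\ell}\frac{1}{\ell!}\frac{\partial^\ell}{\partial\mu^\ell}(\mu^2-1)^\ell$ for $\ell\in\mathbb{N}_0$. Associated Legendre polynomials: $P_{\ell m}(\mu)=(-1)^m(1-\mu^2)^{m/2}\frac{\partial^m}{\partial\mu^m}P_\ell(\mu)$ for $m=0,\dots,\ell$, $\mu\in[-1,1]$, and $P_{\ell m}=(-1)^{|m|}\frac{(\ell-|m|)!}{(\ell+|m|)!}P_{\ell,-m}$ for $m=-\ell,\dots,-1$. Define $$L_{\ell m}(z):=\sqrt{\frac{2\ell+1}{4\pi}\frac{(\ell-m)!}{(\ell+m)!}}\,P_{\ell m}(z).$$ Spherical harmonics: $Y_{\ell m}(\theta,\phi)=L_{\ell m}(\cos\theta)e^{im\phi}$ for $m=0,\dots,\ell$, and $Y_{\ell m}=(-1)^m\overline{Y_{\ell,-m}}$ for $m=-\ell,\dots,-1$. The field $T$ is taken with its known expansion $T=\sum_{\ell=0}^\infty\sum_{m=-\ell}^{\ell}a_{\ell m}Y_{\ell m}$, where the $a_{\ell m}$ are complex-valued centred Gaussian random variables such that: (1) $(a_{\ell m},\ \ell\in\mathbb{N}_0,\ m=0,\dots,\ell)$ are independent; (2) for $m>0$, $\operatorname{Re}a_{\ell m}$ and $\operatorname{Im}a_{\ell m}$ are independent and $\mathcal{N}(0,C_\ell/2)$ distributed; (3) for $m=0$,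 $a_{\ell 0}$ is real-valued and $\mathcal{N}(0,C_\ell)$ distributed; (4) for $m<0$, $a_{\ell m}=(-1)^m\,\overline{a_{\ell,-m}}$. The sequence $(C_\ell)$ (nonnegative reals) is called the angular power spectrum of $T$. The expansion converges in $L^2(\Omega\times\mathbb{S}^2)$ and, for each fixed point of $\mathbb{S}^2$, in $L^2(\Omega)$; $T$ having finite variance means $\sum_\ell(2\ell+1)C_\ell<\infty$. For $m\neq0$ the fields $g_m$ are complex-valued. *)

(* Defs.v *)
From HB Require Import structures.
From mathcomp Require Import all_boot all_order all_algebra.
From mathcomp Require Import all_classical all_reals all_analysis.
From mathcomp Require Import complex.

Set Implicit Arguments.
Unset Strict Implicit.
Unset Printing Implicit Defensive.

Import Order.TTheory GRing.Theory Num.Theory.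
Import numFieldNormedType.Exports.

Local Open Scope classical_set_scope.
Local Open Scope ring_scope.
Local Open Scope complex_scope.

Local Notation Re := complex.Re.
Local Notation Im := complex.Im.

Section SphericalHarmonics.
Variable R : realType.

Definition legendre (l : nat) : {poly R} :=
  (2 ^- l / (l`!)%:R) *: (('X ^+ 2 - 1) ^+ l)^`(l).

Definition legendre_nat (l m : nat) (mu : R) : R :=
  (-1) ^+ m * (1 - mu ^+ 2) `^ (m%:R / 2) * ((legendre l)^`(m)).[mu].

Definition assoc_legendre (l : nat) (m : int) (mu : R) : R :=
  match m with
  | Posz k => legendre_nat l k mu
  | Negz k => (-1) ^+ k.+1 * ((l - k.+1)`!)%:R / ((l + k.+1)`!)%:R
              * legendre_nat l k.+1 mu
  end.

(* Only meant for - l <= m <= l, where l - m and l + m are nonnegative and the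
   absolute values are immaterial. *)
Definition Llm (l : nat) (m : int) (z : R) : R :=
  Num.sqrt ((2 * l + 1)%:R / (4 * pi)
            * ((absz (l%:Z - m))`!)%:R / ((absz (l%:Z + m))`!)%:R)
  * assoc_legendre l m z.

Definition expi (x : R) : R[i] := cos x +i* sin x.

Definition Ynat (l m : nat) (theta phi : R) : R[i] :=
  (Llm l m (cos theta))%:C * expi (m%:R * phi).

Definition Ylm (l : nat) (m : int) (theta phi : R) : R[i] :=
  match m with
  | Posz k => Ynat l k theta phi
  | Negz k => (-1) ^+ k.+1 * conjc (Ynat l k.+1 theta phi)
  end.

End SphericalHarmonics.

Section Sphere.
Variable R : realType.

(* R^3 is the iterated product, which carries the product (= Borel)
   sigma-algebra. *)
Definition sphere : set (R * R * R) :=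
  [set x | x.1.1 ^+ 2 + x.1.2 ^+ 2 + x.2 ^+ 2 = 1].

Definition spoint (theta phi : R) : R * R * R :=
  (sin theta * cos phi, sin theta * sin phi, cos theta).

Definition SO3 : set 'M[R]_3 := [set Q | Q *m Q^T = 1%:M /\ \det Q = 1].

Definition rotate (Q : 'M[R]_3) (x : R * R * R) : R * R * R :=
  let y := Q *m (\col_(i < 3) [:: x.1.1; x.1.2; x.2]`_i) in
  (y 0 0, y 1 0, y 2 0).

End Sphere.

Definition segment11 (R : realType) : set R := [set z | -1 <= z <= 1].

Section Probability.
Variables (R : realType) (d : measure_display) (Omega : measurableType d).
Variable P : probability Omega R.

Definition cpair (z : R[i]) : R * R := (Re z, Im z).

(* The case v = 0 is the Dirac mass at m: the library's normal_prob takes the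
   standard deviation and is the uniform law on [0, 1] when this is 0. *)
Definition normal_law (m v : R) (A : set R) : \bar R :=
  if v == 0 then \d_m A else normal_prob m (Num.sqrt v) A.

Definition has_normal_law (X : Omega -> R) (m v : R) : Prop :=
  measurable_fun setT X /\
  forall A : set R, measurable A -> P (X @^-1` A) = normal_law m v A.

Definition gaussian_rv (X : Omega -> R) : Prop :=
  exists m v : R, 0 <= v /\ has_normal_law X m v.

Definition independent_rv (X Y : Omega -> R) : Prop :=
  forall A B : set R, measurable A -> measurable B ->
    P (X @^-1` A `&` Y @^-1` B) = (P (X @^-1` A) * P (Y @^-1` B))%E.

Definition mutually_independent (I : eqType) (D : set I)
    (X : I -> Omega -> R[i]) : Prop :=
  forall (s : seq I) (B : I -> set (R * R)),
    uniq s -> (forall i, i \in s -> D i) -> (forall i, measurable (B i)) ->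
    P [set w | forall i, i \in s -> B i (cpair (X i w))] =
    (\prod_(i <- s) P [set w | B i (cpair (X i w))])%E.

Definition cexpectation (X : Omega -> R[i]) : R[i] :=
  fine ('E_P[fun w => Re (X w)])%E +i* fine ('E_P[fun w => Im (X w)])%E.

Definition cintegrable (X : Omega -> R[i]) : Prop :=
  P.-integrable setT (fun w => (Re (X w))%:E) /\
  P.-integrable setT (fun w => (Im (X w))%:E).

Section Fields.
Variables (dS : measure_display) (S : measurableType dS) (D : set S).

Definition random_field (X : S -> Omega -> R[i]) : Prop :=
  measurable_fun (D `*` [set: Omega])
    (fun p : S * Omega => cpair (X p.1 p.2)).

(* Every finite family of real and imaginary parts is jointly Gaussian, i.e.
   all its real linear combinations are Gaussian. *)
Definition gaussian_field (X : S -> Omega -> R[i]) : Prop :=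
  random_field X /\
  forall (k : nat) (x : 'I_k -> S) (b c : 'I_k -> R),
    (forall j, D (x j)) ->
    gaussian_rv (fun w =>
      \sum_(j < k) (b j * Re (X (x j) w) + c j * Im (X (x j) w))).

Definition centred_field (X : S -> Omega -> R[i]) : Prop :=
  forall x, D x ->
    ('E_P[fun w => Re (X x w)] = 0 /\ 'E_P[fun w => Im (X x w)] = 0)%E.

Definition field_events (X : S -> Omega -> R[i]) : set (set Omega) :=
  <<s [set A | exists x (B : set (R * R)),
        [/\ D x, measurable B & A = [set w | B (cpair (X x w))]] ] >>.

Definition independent_fields (X Y : S -> Omega -> R[i]) : Prop :=
  forall A B, field_events X A -> field_events Y B ->
    P (A `&` B) = (P A * P B)%E.

End Fields.

Definition weakly_isotropic (n : nat) (T : R * R * R -> Omega -> R) : Prop :=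
  (forall x, sphere x -> (\int[P]_w (`|T x w| ^+ n)%:E < +oo)%E) /\
  forall (k : nat) (x : 'I_k -> R * R * R) (Q : 'M[R]_3),
    (1 <= k <= n)%N -> (forall j, sphere (x j)) -> SO3 Q ->
    ('E_P[fun w => (\prod_(j < k) T (x j) w)%R] =
     'E_P[fun w => (\prod_(j < k) T (rotate Q (x j)) w)%R])%E.

Definition partial_sum (a : nat -> int -> Omega -> R[i]) (n : nat)
    (theta phi : R) (w : Omega) : R[i] :=
  \sum_(l < n) \sum_(j < (2 * l).+1)
    a l (j%:Z - l%:Z) w * Ylm l (j%:Z - l%:Z) theta phi.

Definition sq_error (T : R * R * R -> Omega -> R)
    (a : nat -> int -> Omega -> R[i]) (n : nat) (theta phi : R) : \bar R :=
  (\int[P]_w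
     (Normc.normc ((T (spoint theta phi) w)%:C
                   - partial_sum a n theta phi w) ^+ 2)%:E)%E.

Record harmonic_coefficients (C : nat -> R)
    (a : nat -> int -> Omega -> R[i]) : Prop := {
  coef_measurable : forall (l : nat) (m : int), `|m| <= l%:Z ->
    measurable_fun setT (fun w => cpair (a l m w)) ;
  coef_independent :
    mutually_independent [set lm : nat * nat | (lm.2 <= lm.1)%N]
      (fun lm => a lm.1 lm.2%:Z) ;
  coef_pos : forall l m : nat, (0 < m <= l)%N ->
    [/\ independent_rv (fun w => Re (a l m w)) (fun w => Im (a l m w)),
        has_normal_law (fun w => Re (a l m w)) 0 (C l / 2) &
        has_normal_law (fun w => Im (a l m w)) 0 (C l / 2)] ;
  coef_zero : forall l : nat,
    {ae P, forall w, Im (a l 0 w) = 0} /\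
    has_normal_law (fun w => Re (a l 0 w)) 0 (C l) ;
  coef_neg : forall l m : nat, (0 < m <= l)%N ->
    {ae P, forall w, a l (- m%:Z) w = (-1) ^+ m * conjc (a l m%:Z w)}
}.

(* The surface measure of the sphere is sin theta dtheta dphi. *)
Definition harmonic_expansion (T : R * R * R -> Omega -> R)
    (a : nat -> int -> Omega -> R[i]) : Prop :=
  ((\int[lebesgue_measure]_(theta in `[0%R, pi])
      \int[lebesgue_measure]_(phi in `[0%R, (2 * pi)%R])
        (sq_error T a n theta phi * (sin theta)%:E))%E
     @[n --> \oo] --> 0%E) /\
  (forall theta phi : R, 0 <= theta <= pi -> 0 <= phi < 2 * pi ->
     sq_error T a n theta phi @[n --> \oo] --> 0%E).

Definition angular_power_spectrum (T : R * R * R -> Omega -> R)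
    (C : nat -> R) : Prop :=
  [/\ forall l, 0 <= C l,
      cvgn (series (fun l => (2 * l + 1)%:R * C l)) &
      exists a : nat -> int -> Omega -> R[i],
        harmonic_coefficients C a /\ harmonic_expansion T a].

(* acos z is the unique theta in [0, pi] with cos theta = z. *)
Definition gfield (T : R * R * R -> Omega -> R) (m : int) (z : R) (w : Omega)
    : R[i] :=
  let f (phi : R) := (T (spoint (acos z) phi) w)%:C * expi (- (m%:~R * phi)) in
  ((2 * pi)^-1)%:C *
  ((\int[lebesgue_measure]_(phi in `[0, 2 * pi]) Re (f phi))%R +i*
   (\int[lebesgue_measure]_(phi in `[0, 2 * pi]) Im (f phi))%R).

End Probability.

(* Main.v *)
(* For fixed z = cos theta, the second moments of the increments of the partial
   sums S_n of the expansion do not depend on phi, so S_n converges to T in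
   L2(Omega) uniformly on the circle of latitude theta. Hence g_m(z), as well as
   the N-point discrete Fourier coefficient of T on this circle with N > n + m,
   lies within the L2-distance 2 |T(theta, 0) - S_n(theta, 0)| of the m-th Fourier
   coefficient h_n = sum_(m <= l < n) a_lm L_lm(z) of S_n.
   - The discrete coefficients are linear combinations of values of T, so g_m is
     an L2-limit of centred Gaussian variables, hence centred Gaussian.
   - The covariance of g_m is the limit of the covariances of the h_n.
   - g_m(z) is almost surely a function of the (a_lm, l >= m), and these families
     are independent for distinct m. *)
Require Import Defs.
From HB Require Import structures.
From mathcomp Require Import all_boot all_order all_algebra.
From mathcomp Require Import all_classical all_reals all_analysis.
From mathcomp Require Import measurable_realfun complex ring lra.

Set Implicit Arguments.
Unset Strict Implicit.
Unset Printing Implicit Defensive.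

Import Order.TTheory GRing.Theory Num.Theory.
Import numFieldNormedType.Exports.

Local Open Scope classical_set_scope.
Local Open Scope ring_scope.
Local Open Scope complex_scope.

(** Gaussianity of [T] concerns finite linear combinations of its values, while [gfield] integrates
    each path. The discrete coefficients bridge this gap: they stay in the span of the values, and
    they agree with the integral on S_n because N equally spaced nodes separate frequencies k < n
    from m as long as k + m < N. Norms are kept squared, as [ip X X], with (x + y)^2 <= 2 x^2 + 2
    y^2 as triangle inequality. Comparing T - S_n at phi and at 0 through S_k with k large uses it
    twice; hence the factor 2 (4 after squaring). [Rintegral] is total and gives 0 on a path that is
    not integrable. Subtracting S_n under the integral is thus justified only for almost every path,
    and Tonelli supplies this together with the norm bound. For independence, events of [gfield] are
    matched with events of the coefficients up to null sets. Limits of Gaussian variables are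
    treated by rescaling the approximants to the variance of the limit, so that a single normal law
    is compared. *)

Lemma cvg_to_eq {R : realType} (a b : R) (u : nat -> R) :
  a = b -> u @ \oo --> a -> u @ \oo --> b.
Proof. by move->. Qed.

(** * Square-integrable random variables and convergence in mean square *)

Section SquareIntegrable.
Context {R : realType} {d : measure_display} {Omega : measurableType d}.
Variable P : probability Omega R.
Implicit Types X Y Z : Omega -> R.

Definition sqint X :=
  measurable_fun setT X /\ P.-integrable setT (fun w => (X w ^+ 2)%:E).

(** The L2 inner product. [Rintegral] makes it a real number for all arguments, but its algebra is
    valid under [sqint], hence the side conditions carried along below. *)
Definition ip X Y : R := \int[P]_w (X w * Y w).

Lemma sqint_integrableM X Y : sqint X -> sqint Y ->
  P.-integrable setT (fun w => (X w * Y w)%:E).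
Proof.
move=> [mX iX] [mY iY].
apply: (le_integrable measurableT _ _ (integrableD measurableT iX iY)).
  exact/measurable_EFinP/measurable_funM.
move=> w _ /=; rewrite lee_fin [leRHS]ger0_norm ?addr_ge0 ?sqr_ge0//.
by rewrite ler_norml; apply/andP; split; nra.
Qed.

Lemma sqint_measurable X : sqint X -> measurable_fun setT X.
Proof. by case. Qed.

Lemma sqint_cst (c : R) : sqint (cst c).
Proof.
by split=> //; apply: (finite_measure_integrable_cst P (c ^+ 2) measurableT).
Qed.

Lemma sqint_integrable X : sqint X -> P.-integrable setT (fun w => (X w)%:E).
Proof.
move=> sX; have := sqint_integrableM sX (sqint_cst 1).
by under eq_fun do rewrite /= mulr1.
Qed.

Lemma sqintZ (c : R) X : sqint X -> sqint (fun w => c * X w).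
Proof.
move=> [mX iX]; split; first exact: measurable_funM.
under eq_fun do rewrite exprMn EFinM.
exact: integrableZl.
Qed.

Lemma sqintD X Y : sqint X -> sqint Y -> sqint (fun w => X w + Y w).
Proof.
move=> sX sY; split; first by apply: measurable_funD; case: sX sY => ? _ [].
have -> : (fun w => ((X w + Y w) ^+ 2)%:E) =
    (fun w => ((X w ^+ 2)%:E + (Y w ^+ 2)%:E) + 2%:E * (X w * Y w)%:E)%E.
  by apply/funext => w; rewrite -!EFinM -!EFinD; congr _%:E; ring.
apply: integrableD => //; first by apply: integrableD => //; case: sX sY => _ ? [].
by apply: integrableZl => //; exact: sqint_integrableM.
Qed.

Lemma sqintB X Y : sqint X -> sqint Y -> sqint (fun w => X w - Y w).
Proof.
move=> sX sY; have := sqintD sX (sqintZ (-1) sY).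
by under eq_fun do rewrite mulN1r.
Qed.

Lemma sqint_sum I (r : seq I) (Q : pred I) (F : I -> Omega -> R) :
  (forall i, Q i -> sqint (F i)) ->
  sqint (fun w => \sum_(i <- r | Q i) F i w).
Proof.
move=> sF; elim: r => [|i r IH].
  by under eq_fun do rewrite big_nil; exact: sqint_cst.
have [Qi|Qi] := boolP (Q i).
  under eq_fun do rewrite big_cons Qi; apply: sqintD => //; exact: sF.
by under eq_fun do rewrite big_cons (negbTE Qi).
Qed.

Lemma Rintegral_probability_cst (c : R) : \int[P]_w (cst c w) = c.
Proof.
transitivity (c * fine (P setT)); first exact: Rintegral_cst.
by rewrite probability_setT mulr1.
Qed.

Lemma ae_eq_Rintegral (f g : Omega -> R) :
  measurable_fun setT f -> measurable_fun setT g ->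
  {ae P, forall w, f w = g w} -> \int[P]_w f w = \int[P]_w g w.
Proof.
move=> mf mg fg; congr fine; apply: ae_eq_integral => //; try exact/measurable_EFinP.
by move: fg; apply: filterS => w -> _.
Qed.

Lemma ae_eq_sqint X Y : sqint X -> measurable_fun setT Y ->
  {ae P, forall w, X w = Y w} -> sqint Y.
Proof.
move=> [mX iX] mY XY; split=> //.
have m2 Z : measurable_fun setT Z -> measurable_fun setT (fun w => (Z w ^+ 2)%:E).
  by move=> mZ; apply/measurable_EFinP; exact: measurable_funX.
apply/integrableP; split; first exact: m2.
move/integrableP : iX => [_]; congr (_ < _)%E; apply: ae_eq_integral => //.
- by apply: measurableT_comp => //; exact: m2.
- by apply: measurableT_comp => //; exact: m2.
- by move: XY; apply: filterS => w -> _.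
Qed.

Lemma ipC X Y : ip X Y = ip Y X.
Proof. by apply: eq_Rintegral => w _; rewrite mulrC. Qed.

Lemma ipDl X Y Z : sqint X -> sqint Y -> sqint Z ->
  ip (fun w => X w + Y w) Z = ip X Z + ip Y Z.
Proof.
move=> sX sY sZ; rewrite /ip -RintegralD//; try exact: sqint_integrableM.
by apply: eq_Rintegral => w _; rewrite mulrDl.
Qed.

Lemma ipZl (c : R) X Z : sqint X -> sqint Z ->
  ip (fun w => c * X w) Z = c * ip X Z.
Proof.
move=> sX sZ; rewrite /ip -RintegralZl//; try exact: sqint_integrableM.
by apply: eq_Rintegral => w _; rewrite mulrA.
Qed.

Lemma ipBl X Y Z : sqint X -> sqint Y -> sqint Z ->
  ip (fun w => X w - Y w) Z = ip X Z - ip Y Z.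
Proof.
move=> sX sY sZ; rewrite /ip -RintegralB//; try exact: sqint_integrableM.
by apply: eq_Rintegral => w _; rewrite mulrBl.
Qed.

Lemma ip0l Z : ip (cst 0) Z = 0.
Proof.
rewrite /ip -[RHS](_ : \int[P]_w (cst 0 w) = 0).
  by apply: eq_Rintegral => w _ /=; rewrite mul0r.
by rewrite Rintegral_cst// mul0r.
Qed.

Lemma ip_suml I (r : seq I) (Q : pred I) (F : I -> Omega -> R) Z :
  (forall i, Q i -> sqint (F i)) -> sqint Z ->
  ip (fun w => \sum_(i <- r | Q i) F i w) Z = \sum_(i <- r | Q i) ip (F i) Z.
Proof.
move=> sF sZ; elim: r => [|i r IH].
  by under eq_fun do rewrite big_nil; rewrite big_nil; exact: ip0l.
rewrite big_cons; case: ifPn => [Qi|/negbTE Qi].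
  under eq_fun do rewrite big_cons Qi.
  by rewrite (ipDl (sF _ Qi))// ?IH//; exact: sqint_sum.
by under eq_fun do rewrite big_cons Qi.
Qed.

Lemma ip_ge0 X : 0 <= ip X X.
Proof. by apply: Rintegral_ge0 => w _; rewrite -expr2 sqr_ge0. Qed.

Lemma EFin_ip X : sqint X -> (ip X X)%:E = (\int[P]_w (X w ^+ 2)%:E)%E.
Proof.
move=> [mX iX]; rewrite /ip /Rintegral fineK.
  by apply: eq_integral => w _; rewrite expr2.
have := integrable_fin_num measurableT iX.
by under eq_integral do rewrite expr2.
Qed.

(** Pointwise this is (x - y)^2 >= 0. It serves as the triangle inequality for squared norms. *)
Lemma ipD_le X Y : sqint X -> sqint Y ->
  ip (fun w => X w + Y w) (fun w => X w + Y w) <= 2 * ip X X + 2 * ip Y Y.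
Proof.
move=> sX sY; rewrite -lee_fin EFin_ip; last exact: sqintD.
rewrite EFinD !EFinM !EFin_ip// -!integralZl//; [|by case: sY|by case: sX].
rewrite -integralD//; [|by apply: integrableZl => //; case: sX|
  by apply: integrableZl => //; case: sY].
apply: le_integral => //; first by case: (sqintD sX sY).
  by apply: integrableD => //; apply: integrableZl => //; [case: sX|case: sY].
move=> w _; rewrite -!EFinM -EFinD lee_fin.
by have := sqr_ge0 (X w - Y w); nra.
Qed.

(** The squared norm of X + t Y is a nonnegative polynomial in t ([H]), of degree at most 2. *)
Lemma ip_cauchy_schwarz X Y : sqint X -> sqint Y ->
  ip X Y ^+ 2 <= ip X X * ip Y Y.
Proof.
move=> sX sY.
have H (t : R) : 0 <= ip X X + 2 * t * ip X Y + t ^+ 2 * ip Y Y.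
  have sZ := sqintD sX (sqintZ t sY).
  have := ip_ge0 (fun w => X w + t * Y w).
  rewrite (ipDl sX (sqintZ t sY) sZ) (ipZl _ sY sZ).
  rewrite [ip X _]ipC [ip Y _]ipC (ipDl sX (sqintZ t sY) sX).
  rewrite (ipDl sX (sqintZ t sY) sY) !ipZl// [ip Y X]ipC.
  by congr (_ <= _); ring.
have [Y0|Y0] := eqVneq (ip Y Y) 0.
  suff -> : ip X Y = 0 by rewrite expr0n/= Y0 mulr0.
  apply/eqP; apply: contraT => XY0.
  (* For [ip Y Y = 0] the polynomial is affine in t, and at this t it would equal -1. *)
  have := H (- (ip X X + 1) / (2 * ip X Y)).
  rewrite Y0 mulr0 addr0.
  have -> : 2 * (- (ip X X + 1) / (2 * ip X Y)) * ip X Y = - (ip X X + 1).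
    by field.
  by rewrite opprD addrA subrr sub0r ler0N1.
have Ygt0 : 0 < ip Y Y by rewrite lt_def Y0 ip_ge0.
(* The minimiser of the quadratic polynomial. *)
have := H (- ip X Y / ip Y Y).
rewrite -(pmulr_lge0 _ Ygt0).
have -> : (ip X X + 2 * (- ip X Y / ip Y Y) * ip X Y +
  (- ip X Y / ip Y Y) ^+ 2 * ip Y Y) * ip Y Y = ip X X * ip Y Y - ip X Y ^+ 2.
  by field.
by rewrite subr_ge0.
Qed.

Definition l2cvg (X_ : nat -> Omega -> R) X :=
  (fun n => ip (fun w => X_ n w - X w) (fun w => X_ n w - X w)) @ \oo --> (0 : R).

(** The shape matches Cauchy-Schwarz, which bounds the square of an inner product. *)
Lemma cvg0_sqr (u v : nat -> R) : (forall n, u n ^+ 2 <= v n) ->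
  v @ \oo --> (0 : R) -> u @ \oo --> (0 : R).
Proof.
move=> uv v0; apply/cvgrPdist_lt => e e0.
have e2 : 0 < e ^+ 2 by rewrite exprn_gt0.
move/cvgrPdist_lt : v0 => /(_ _ e2).
apply: filterS => n; rewrite !sub0r !normrN => ve.
rewrite -(@ltr_pXn2r _ 2)// ?nnegrE// ?ltW//.
rewrite real_normK ?num_real//; apply: le_lt_trans ve.
exact: le_trans (uv n) (ler_norm _).
Qed.

Lemma l2cvg_ip (X_ Y_ : nat -> Omega -> R) X Y :
  (forall n, sqint (X_ n)) -> (forall n, sqint (Y_ n)) -> sqint X -> sqint Y ->
  l2cvg X_ X -> l2cvg Y_ Y ->
  (fun n => ip (X_ n) (Y_ n)) @ \oo --> ip X Y.
Proof.
move=> sX_ sY_ sX sY cX cY.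
pose DX n w := X_ n w - X w; pose DY n w := Y_ n w - Y w.
have sDX n : sqint (DX n) by exact: sqintB.
have sDY n : sqint (DY n) by exact: sqintB.
(* Expansion of (X + DX)(Y + DY). Each of the three terms with an increment tends to 0 by
   Cauchy-Schwarz. *)
have E n : ip (X_ n) (Y_ n) =
    ip X Y + (ip (DX n) Y + ip (DY n) X + ip (DX n) (DY n)).
  rewrite (ipBl (sX_ n) sX sY) (ipBl (sY_ n) sY sX) (ipBl (sX_ n) sX (sDY n)).
  rewrite [ip (X_ n) (DY n)]ipC [ip X (DY n)]ipC.
  rewrite (ipBl (sY_ n) sY (sX_ n)) (ipBl (sY_ n) sY sX).
  rewrite [ip (Y_ n) (X_ n)]ipC [ip Y (X_ n)]ipC [ip Y X]ipC; ring.
under eq_fun do rewrite E.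
apply: (cvg_to_eq (addr0 _)); apply: cvgD; first exact: cvg_cst.
apply: (@cvg_to_eq _ (0 + 0 + 0)); first by rewrite !addr0.
apply: cvgD; [apply: cvgD|].
- apply: (cvg0_sqr (fun n => ip_cauchy_schwarz (sDX n) sY)).
  by apply: (cvg_to_eq (mul0r (ip Y Y))); apply: cvgM => //; exact: cvg_cst.
- apply: (cvg0_sqr (fun n => ip_cauchy_schwarz (sDY n) sX)).
  by apply: (cvg_to_eq (mul0r (ip X X))); apply: cvgM => //; exact: cvg_cst.
- apply: (cvg0_sqr (fun n => ip_cauchy_schwarz (sDX n) (sDY n))).
  by apply: (cvg_to_eq (mul0r (0:R))); apply: cvgM.
Qed.

Lemma l2cvgD (X_ Y_ : nat -> Omega -> R) X Y :
  (forall n, sqint (X_ n)) -> (forall n, sqint (Y_ n)) -> sqint X -> sqint Y ->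
  l2cvg X_ X -> l2cvg Y_ Y ->
  l2cvg (fun n w => X_ n w + Y_ n w) (fun w => X w + Y w).
Proof.
move=> sX_ sY_ sX sY cX cY.
have c0 : (fun n => 2 * ip (fun w => X_ n w - X w) (fun w => X_ n w - X w) +
    2 * ip (fun w => Y_ n w - Y w) (fun w => Y_ n w - Y w)) @ \oo --> (0 : R).
  apply: (@cvg_to_eq _ (2 * 0 + 2 * 0)); first by rewrite !mulr0 addr0.
  by apply: cvgD; apply: cvgM => //; exact: cvg_cst.
apply: (squeeze_cvgr _ (cvg_cst (0:R)) c0); apply: nearW => n.
rewrite ip_ge0/=.
have := ipD_le (sqintB (sX_ n) sX) (sqintB (sY_ n) sY).
congr (_ <= _); congr ip; apply/funext => w; ring.
Qed.

Lemma l2cvgZ (c : R) (X_ : nat -> Omega -> R) X :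
  (forall n, sqint (X_ n)) -> sqint X ->
  l2cvg X_ X -> l2cvg (fun n w => c * X_ n w) (fun w => c * X w).
Proof.
move=> sX_ sX cX; rewrite /l2cvg.
have E n : ip (fun w => c * X_ n w - c * X w) (fun w => c * X_ n w - c * X w) =
   c ^+ 2 * ip (fun w => X_ n w - X w) (fun w => X_ n w - X w).
  have sD := sqintB (sX_ n) sX.
  under eq_fun do rewrite -mulrBr.
  rewrite (ipZl c sD (sqintZ c sD)) ipC (ipZl c sD sD).
  by rewrite mulrA expr2.
under eq_fun do rewrite E.
by apply: (cvg_to_eq (mulr0 (c ^+ 2))); apply: cvgM => //; exact: cvg_cst.
Qed.

Lemma l2cvg_sum I (r : seq I) (F_ : I -> nat -> Omega -> R) (F : I -> Omega -> R) :
  (forall i n, sqint (F_ i n)) -> (forall i, sqint (F i)) ->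
  (forall i, l2cvg (F_ i) (F i)) ->
  l2cvg (fun n w => \sum_(i <- r) F_ i n w) (fun w => \sum_(i <- r) F i w).
Proof.
move=> sF_ sF cF; elim: r => [|i r IH].
  rewrite /l2cvg.
  have E n : ip (fun w => \sum_(i <- [::]) F_ i n w - \sum_(i <- [::]) F i w)
      (fun w => \sum_(i <- [::]) F_ i n w - \sum_(i <- [::]) F i w) = 0.
    by under eq_fun do rewrite !big_nil subrr; exact: ip0l.
  by under eq_fun do rewrite E; exact: cvg_cst.
rewrite (_ : (fun n w => _) =
  (fun n w => F_ i n w + \sum_(j <- r) F_ j n w)); last first.
  by apply/funext => n; apply/funext => w; rewrite big_cons.
rewrite (_ : (fun w => _) = (fun w => F i w + \sum_(j <- r) F j w)); last first.
  by apply/funext => w; rewrite big_cons.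
by apply: l2cvgD => //; [move=> n; exact: sqint_sum|exact: sqint_sum].
Qed.

Lemma l2cvg_cst X : l2cvg (fun=> X) X.
Proof.
rewrite /l2cvg; under eq_fun do under eq_fun do rewrite subrr.
by under eq_fun do rewrite ip0l; exact: cvg_cst.
Qed.

Lemma l2cvg_Rintegral (X_ : nat -> Omega -> R) X :
  (forall n, sqint (X_ n)) -> sqint X -> l2cvg X_ X ->
  (fun n => \int[P]_w X_ n w) @ \oo --> \int[P]_w X w.
Proof.
move=> sX_ sX cX.
have := l2cvg_ip sX_ (fun=> sqint_cst 1) sX (sqint_cst 1) cX (l2cvg_cst _).
rewrite /ip; under eq_fun do under eq_Rintegral do rewrite /= mulr1.
by under eq_Rintegral do rewrite /= mulr1.
Qed.

End SquareIntegrable.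

(** * Integrals against the normal density *)

Section NormalMoments.
Context {R : realType}.
Local Notation mu := (@lebesgue_measure R).
Implicit Types m s x : R.

(** The Radon-Nikodym derivative of [normal_prob] and [normal_pdf] have the same integral over every
    measurable set, hence agree almost everywhere. *)
Lemma ge0_integral_normal_prob m s (f : R -> \bar R) :
  measurable_fun setT f -> (forall x, 0 <= f x)%E ->
  (\int[normal_prob m s]_x f x = \int[mu]_x (f x * (normal_pdf m s x)%:E))%E.
Proof.
move=> mf f0; pose nu : probability _ R := normal_prob m s.
have dom : nu `<< mu := normal_prob_dominates m s.
rewrite -(Radon_Nikodym_SigmaFinite.change_of_variables dom)//.
have mp : measurable_fun setT (EFin \o normal_pdf m s).
  by apply/measurable_EFinP; exact: measurable_normal_pdf.
have iRN := Radon_Nikodym_SigmaFinite.f_integrable dom.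
apply: ae_eq_integral => //.
- by apply: emeasurable_funM => //; exact: (measurable_int mu).
- exact: emeasurable_funM.
- apply: ae_eqe_mul2l; apply: integral_ae_eq => //= E _ mE.
  by rewrite -Radon_Nikodym_SigmaFinite.f_integral.
Qed.

Section Gauss.
Variables (c a : R).
Hypotheses (c0 : 0 <= c) (a0 : 0 < a).
Let G x := c * expR (- (a * x ^+ 2)).

Let G_ge0 x : 0 <= G x. Proof. by rewrite mulr_ge0 ?expR_ge0. Qed.

Let is_derive_G x : is_derive x 1 G (- (2 * a * x) * G x).
Proof.
rewrite /G; apply: is_derive_eq.
by rewrite /GRing.scale /=; ring.
Qed.

Let cG : continuous G.
Proof.
move=> x; apply: differentiable_continuous; apply/derivable1_diffP.
exact: (@ex_derive _ _ _ _ _ _ _ (is_derive_G x)).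
Qed.

Let f x := (2 * a * x ^+ 2 - 1) * G x.

Let X2G_ge0 x : 0 <= 2 * a * x ^+ 2 * G x.
Proof.
apply: mulr_ge0 => //; apply: mulr_ge0 (sqr_ge0 x).
by apply: mulr_ge0 => //; exact: ltW.
Qed.

Let cX2G : continuous (fun x => 2 * a * x ^+ 2 * G x).
Proof.
move=> x; apply: cvgM; last exact: cG.
by apply: cvgM; [exact: cvg_cst|exact: exprn_continuous].
Qed.

Let cf : continuous f.
Proof.
move=> x; have -> : f = (fun x => 2 * a * x ^+ 2 * G x) \- G.
  by apply/funext => y; rewrite /f /=; ring.
by apply: cvgB; [exact: cX2G|exact: cG].
Qed.

Let is_derive_F x : is_derive x 1 (fun x => - (x * G x)) (f x).
Proof.
apply: is_derive_eq.
by rewrite /GRing.scale /f /G /=; ring.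
Qed.

Let integrable_itv (h : R -> R) (b : R) : continuous h ->
  mu.-integrable `[0, b] (EFin \o h).
Proof.
move=> ch; apply: continuous_compact_integrable; first exact: segment_compact.
exact: continuous_subspaceT.
Qed.

(** Integration by parts, with [- (x * G x)] as primitive of [f]. The successor keeps the interval
    nondegenerate for the fundamental theorem. *)
Let int_f (n : nat) :
  (\int[mu]_(x in `[0%R, n.+1%:R]) (2 * a * x ^+ 2 * G x)%:E =
   \int[mu]_(x in `[0%R, n.+1%:R]) (G x)%:E - (n.+1%:R * G n.+1%:R)%:E)%E.
Proof.
have n0 : (0 : R) < n.+1%:R by rewrite ltr0n.
have cF x : {for x, continuous (fun x => - (x * G x))}.
  apply: differentiable_continuous; apply/derivable1_diffP.
  exact: (@ex_derive _ _ _ _ _ _ _ (is_derive_F x)).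
have := @continuous_FTC2 _ f (fun x => - (x * G x)) _ _ n0.
have -> : (\int[mu]_(x in `[0%R, n.+1%:R]) (f x)%:E =
   \int[mu]_(x in `[0%R, n.+1%:R]) (2 * a * x ^+ 2 * G x)%:E -
   \int[mu]_(x in `[0%R, n.+1%:R]) (G x)%:E)%E.
  rewrite -integralB_EFin//; [|exact: (integrable_itv _ cX2G)|
    exact: (integrable_itv _ cG)].
  by apply: eq_integral => x _; rewrite -EFinB /f; congr _%:E; ring.
have fG : (\int[mu]_(x in `[0%R, n.+1%:R]) (G x)%:E)%E \is a fin_num.
  by apply: integrable_fin_num => //; exact: integrable_itv.
move=> E; rewrite -[LHS](subeK _ fG) E; first last.
- by move=> x _; rewrite derive1E; exact: derive_val.
- split.
  + by move=> x _; exact: (@ex_derive _ _ _ _ _ _ _ (is_derive_F x)).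
  + exact/cvg_at_right_filter/cF.
  + exact/cvg_at_left_filter/cF.
- exact: continuous_subspaceT.
by rewrite mul0r oppr0 sube0 EFinN addeC.
Qed.

Let cvg_nG : (fun n => n.+1%:R * G n.+1%:R) @ \oo --> (0 : R).
Proof.
have H (n : nat) : 0 <= n.+1%:R * G n.+1%:R <= (c / a) * n.+1%:R^-1.
  have : (0 : R) < n.+1%:R by rewrite ltr0n.
  move: (n.+1%:R : R) => N N0; rewrite mulr_ge0 ?(ltW N0)//=.
  rewrite /G mulrCA -[leRHS]mulrA ler_wpM2l// expRN ler_pdivrMr ?expR_gt0//.
  (* From 1 + t <= exp t; it bounds N G(N) by c / (a N). *)
  have h : a * N ^+ 2 <= expR (a * N ^+ 2).
    by apply: le_trans (expR_ge1Dx _); rewrite lerDr.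
  apply: (@le_trans _ _ (a^-1 / N * (a * N ^+ 2))).
    rewrite le_eqVlt; apply/orP; left; apply/eqP; field.
    by rewrite (gt_eqF a0) (gt_eqF N0).
  by rewrite ler_wpM2l// mulr_ge0// invr_ge0 ltW.
apply: (@squeeze_cvgr _ _ _ _ (cst 0) (fun n => (c / a) * n.+1%:R^-1)).
- by apply: nearW => n; exact: H.
- exact: cvg_cst.
- apply: (cvg_to_eq (mulr0 (c / a))).
  by apply: cvgM; [exact: cvg_cst|exact: cvg_harmonic].
Qed.

(** The integrands differ by [f], the derivative of [- (x * G x)], whose boundary term vanishes at
    infinity. Evenness reduces both sides to the half line, which is exhausted by the intervals
    [0, n + 1] of [int_f]. *)
Lemma integral_sqr_gauss :
  (\int[mu]_x (2 * a * x ^+ 2 * G x)%:E = \int[mu]_x (G x)%:E)%E.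
Proof.
rewrite (ge0_symfun_integralT (f := fun x => 2 * a * x ^+ 2 * G x))//; last first.
  by move=> x; rewrite /comp /G !sqrrN.
rewrite (ge0_symfun_integralT (f := G))//; last first.
  by move=> x; rewrite /comp /G !sqrrN.
congr (_ * _)%E.
pose A (n : nat) := [set` `[0 : R, n.+1%:R]].
have UA : \bigcup_n A n = [set x | 0 <= x].
  apply/seteqP; split => [x [n _]|x /= x0]; first by rewrite /A /= in_itv/= => /andP[].
  exists (Num.truncn x) => //; rewrite /A /= in_itv/= x0/= ltW//.
  exact: truncnS_gt.
have ndA : nondecreasing_seq A.
  move=> i j ij; rewrite /A; apply/subsetPset => x; rewrite /= !in_itv/= => /andP[-> h]/=.
  by apply: le_trans h _; rewrite ler_nat.
have K (h : R -> R) : continuous h -> (forall x, 0 <= h x) ->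
  (fun n => (\int[mu]_(x in A n) (h x)%:E)%E) @ \oo -->
  (\int[mu]_(x in [set x | 0 <= x]%R) (h x)%:E)%E.
  move=> ch h0; rewrite -UA; apply: ge0_nondecreasing_set_cvg_integral => //.
  - by move=> i; exact: measurable_itv.
  - move=> i; apply/measurable_EFinP/measurable_funTS; exact: continuous_measurable_fun.
  - by move=> i x _; rewrite lee_fin.
have K1 := K _ cX2G X2G_ge0.
have K2 := K _ cG G_ge0.
move: K1; under eq_fun do rewrite /A int_f.
move=> K1; apply: (cvg_unique _ K1) => //.
have K3 : (fun n => (n.+1%:R * G n.+1%:R)%:E) @ \oo --> 0%E.
  by apply: cvg_EFin; [exact: nearW|exact: cvg_nG].
have := cvgeB _ K2 K3; rewrite sube0; apply.
by rewrite fin_num_adde_defl.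
Qed.

End Gauss.

Lemma integral_sqr_normal_pdf s : s != 0 ->
  (\int[mu]_x (x ^+ 2 * normal_pdf 0 s x)%:E = (s ^+ 2)%:E)%E.
Proof.
(* The rate in the exponent of the density: 2 a s^2 = 1, so that [integral_sqr_gauss] multiplied by
   s^2 is the claim. *)
move=> s0; pose a := (s ^+ 2 *+ 2)^-1.
have s2 : 0 < s ^+ 2 by rewrite exprn_even_gt0.
have a0 : 0 < a by rewrite invr_gt0 pmulrn_lgt0.
have pE : normal_pdf 0 s = fun x => normal_peak s * expR (- (a * x ^+ 2)).
  rewrite normal_pdfE//; apply/funext => x; rewrite /normal_fun subr0 /a.
  by rewrite mulrC mulrC [X in expR (- X)]mulrC mulNr.
have E : (\int[mu]_x (2 * a * x ^+ 2 * normal_pdf 0 s x)%:E = 1)%E.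
  rewrite -(integral_normal_pdf 0 s) pE.
  exact: integral_sqr_gauss (normal_peak_ge0 s) a0.
transitivity ((s ^+ 2)%:E * (\int[mu]_x
  (2 * a * x ^+ 2 * normal_pdf 0 s x)%:E))%E; last by rewrite E mule1.
rewrite -ge0_integralZl//=; first last.
- by rewrite lee_fin ltW.
- move=> x _; rewrite lee_fin; apply: mulr_ge0; last exact: normal_pdf_ge0.
  by apply: mulr_ge0 (sqr_ge0 x); rewrite mulr_ge0// ltW.
- apply/measurable_EFinP; apply: continuous_measurable_fun => x.
  apply: cvgM.
    by apply: cvgM; [exact: cvg_cst|exact: exprn_continuous].
  exact: continuous_normal_pdf.
apply: eq_integral => x _; rewrite -EFinM; congr _%:E.
rewrite /a; field.
by rewrite s0.
Qed.

Lemma ge0_integral_shift (G : R -> R) m : continuous G -> (forall x, 0 <= G x) ->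
  (\int[mu]_x (G x)%:E = \int[mu]_x (G (x - m))%:E)%E.
Proof.
move=> cG G0; pose F := fun x : R => x - m.
have F'E : (F^`())%classic = cst 1.
  apply/funext => x; rewrite derive1E /cst.
  have H : is_derive x (1 : R) F 1 by apply: is_derive_eq; rewrite ?subr0 ?addr0.
  exact: (@derive_val _ _ _ _ _ _ _ H).
rewrite (increasing_ge0_integration_by_substitutionT (F := F))//.
- by apply: eq_integral => x _; rewrite F'E /= mulr1.
- by move=> x y xy; rewrite ltrD2r.
- by rewrite F'E => x; exact: cvg_cst.
- by rewrite F'E; exact: is_cvg_cst.
- by rewrite F'E; exact: is_cvg_cst.
- exact: cvg_addrr_Ny.
- exact: cvg_addrr.
Qed.

(** The substitution exchanges the two half lines, and the vanishing of g on the negative one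
    restricts both integrals to a half line. It is meant for the positive part of x times an even
    density. *)
Lemma ge0_integral_reflect (g : R -> R) : continuous g -> (forall x, 0 <= g x) ->
  (forall x, x <= 0 -> g x = 0) ->
  (\int[mu]_x (g x)%:E = \int[mu]_x (g (- x))%:E)%E.
Proof.
move=> cg g0 gN.
transitivity (\int[mu]_(x in `[0%R, +oo[) (g x)%:E)%E.
  rewrite [RHS]integral_mkcond; apply: eq_integral => x _; rewrite patchE.
  case: ifPn => //; rewrite notin_setE /= in_itv/= andbT => /negP; rewrite -ltNge => x0.
  by rewrite gN// ltW.
transitivity (\int[mu]_(x in `]-oo, 0%R]) (g (- x))%:E)%E; last first.
  rewrite [LHS]integral_mkcond; apply: eq_integral => x _; rewrite patchE.
  case: ifPn => //; rewrite notin_setE /= in_itv/= => /negP; rewrite -ltNge => x0.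
  by rewrite gN// oppr_le0 ltW.
have := @ge0_integration_by_substitutionNy R (fun x => g (- x)) 0.
rewrite oppr0 => ->.
- by apply: eq_integral => x _ /=; rewrite opprK.
- apply: continuous_subspaceT => x; apply: (@continuous_comp _ _ _ -%R g).
    exact: opp_continuous.
  exact: cg.
- by move=> x _.
Qed.

End NormalMoments.

(** * Mean and variance of a normal random variable *)

Section NormalLaw.
Context {R : realType} {d : measure_display} {Omega : measurableType d}.
Variable P : probability Omega R.
Local Notation mu := (@lebesgue_measure R).

Lemma normal_law_integral (X : Omega -> R) (m v : R) (f : R -> R) :
  0 < v -> has_normal_law P X m v ->
  measurable_fun setT f -> (forall x, 0 <= f x) ->
  (\int[P]_w (f (X w))%:E =
   \int[mu]_x (f x * normal_pdf m (Num.sqrt v) x)%:E)%E.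
Proof.
move=> v0 [mX lX] mf f0.
pose X' : {mfun Omega >-> measurableTypeR R} :=
  HB.pack X (isMeasurableFun.Build _ _ _ (measurableTypeR R) _ mX).
transitivity (\int[distribution P X']_x (f x)%:E)%E.
  rewrite ge0_integral_distribution//; exact/measurable_EFinP.
transitivity (\int[normal_prob m (Num.sqrt v)]_x (f x)%:E)%E.
  apply: eq_measure_integral => A mA _.
  by rewrite /= /distribution /pushforward /= lX// /normal_law gt_eqF.
rewrite ge0_integral_normal_prob//; exact/measurable_EFinP.
Qed.

Lemma normal_law_shift (X : Omega -> R) (m v : R) (f : R -> R) :
  0 < v -> has_normal_law P X m v ->
  continuous f -> (forall x, 0 <= f x) ->
  (\int[P]_w (f (X w - m))%:E =
   \int[mu]_x (f x * normal_pdf 0 (Num.sqrt v) x)%:E)%E.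
Proof.
move=> v0 nX cf f0.
have s0 : Num.sqrt v != 0 by rewrite gt_eqF// sqrtr_gt0.
rewrite (ge0_integral_shift m (G := fun x => f x * normal_pdf 0 (Num.sqrt v) x)).
- rewrite (normal_law_integral (f := fun x => f (x - m)) v0 nX)//.
    apply: eq_integral => x _; congr (_ * _)%:E.
    by rewrite !normal_pdfE// normal_fun_center.
  apply: measurableT_comp; first exact: continuous_measurable_fun.
  exact: measurable_funB.
- move=> x; apply: cvgM; first exact: cf.
  exact: continuous_normal_pdf.
- by move=> x; rewrite mulr_ge0// normal_pdf_ge0.
Qed.

Lemma normal_law_sqr (X : Omega -> R) (m v : R) :
  0 < v -> has_normal_law P X m v -> (\int[P]_w ((X w - m) ^+ 2)%:E = v%:E)%E.
Proof.
move=> v0 nX; rewrite (normal_law_shift (f := fun x => x ^+ 2) v0 nX)//.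
- rewrite integral_sqr_normal_pdf ?sqr_sqrtr// ?ltW//.
  by rewrite gt_eqF// sqrtr_gt0.
- exact: exprn_continuous.
- by move=> x; rewrite sqr_ge0.
Qed.

Lemma ae_iff_measure (A B : set Omega) : measurable A -> measurable B ->
  {ae P, forall w, A w <-> B w} -> P A = P B.
Proof.
move=> mA mB [N [mN N0 AB]].
have H (C D : set Omega) : measurable C -> measurable D ->
    (forall w, ~ N w -> C w -> D w) -> (P C <= P D)%E.
  move=> mC mD CD; rewrite -[leRHS]adde0 -N0.
  apply: le_trans (measureU2 _ mD mN); apply: le_measure; rewrite ?inE//.
    exact: measurableU.
  by move=> w Cw; have [Nw|Nw] := pselect (N w); [right|left; exact: CD].
have K w : ~ N w -> (A w <-> B w) by move=> Nw; apply: contrapT => /AB.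
by apply/eqP; rewrite eq_le !H// => w /K [].
Qed.

Lemma has_normal_law0 (X : Omega -> R) (m : R) :
  has_normal_law P X m 0 <-> measurable_fun setT X /\ {ae P, forall w, X w = m}.
Proof.
split=> [[mX lX]|[mX aeX]].
  split=> //; exists (X @^-1` [set~ m]); split.
  - rewrite -[A in measurable A]setTI; apply: mX => //.
    exact: measurableC.
  - rewrite lX; last exact: measurableC.
    by rewrite /normal_law eqxx diracE memNset//; apply.
  - by move=> w.
split=> // A mA; rewrite /normal_law eqxx.
have mXA : measurable (X @^-1` A) by rewrite -[B in measurable B]setTI; exact: mX.
rewrite diracE; have [Am|Am] := pselect (A m).
  rewrite (mem_set Am) -(probability_setT P); apply: ae_iff_measure => //.
  by move: aeX; apply: filterS => w /= ->.
transitivity (P set0); last by rewrite measure0 (memNset Am).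
apply: ae_iff_measure => //.
by move: aeX; apply: filterS => w /= ->.
Qed.

Lemma normal_law_moments (X : Omega -> R) (m v : R) :
  0 <= v -> has_normal_law P X m v ->
  [/\ sqint P X, \int[P]_w X w = m & ip P (fun w => X w - m) (fun w => X w - m) = v].
Proof.
rewrite le_eqVlt => /predU1P[<- /has_normal_law0[mX aeX]|v0 nX].
  have aeX' : {ae P, forall w, m = X w} by move: aeX; apply: filterS.
  split.
  - exact: (ae_eq_sqint (sqint_cst P m) mX aeX').
  - by rewrite (ae_eq_Rintegral mX (measurable_cst m) aeX) Rintegral_probability_cst.
  - rewrite /ip (@ae_eq_Rintegral _ _ _ _ _ (cst 0)).
    + exact: Rintegral_probability_cst.
    + by apply: measurable_funM; exact: measurable_funB.
    + by [].
    + by move: aeX; apply: filterS => w -> /=; rewrite subrr mulr0.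
have mX : measurable_fun setT X by case: nX.
have sXm : sqint P (fun w => X w - m).
  split; first exact: measurable_funB.
  apply/integrableP; split.
    by apply/measurable_EFinP/measurable_funX; exact: measurable_funB.
  under eq_integral do rewrite gee0_abs ?lee_fin ?sqr_ge0//.
  by rewrite (normal_law_sqr v0 nX) ltry.
have sX : sqint P X.
  have := sqintD sXm (sqint_cst P m); congr sqint.
  by apply/funext => w /=; rewrite subrK.
split=> //; last by apply: EFin_inj; rewrite EFin_ip// (normal_law_sqr v0 nX).
(* Reflection of the centred density identifies the integrals of the positive and the negative part
   of X - m. *)
have c0 : \int[P]_w (X w - m) = 0.
  rewrite /Rintegral integralE.
  have cmax : continuous (fun x : R => Num.max x 0).
    move=> x; apply: continuous_max; [exact: cvg_id|exact: cvg_cst].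
  have cmaxN : continuous (fun x : R => Num.max (- x) 0).
    by move=> x; apply: continuous_max; [exact: opp_continuous|exact: cvg_cst].
  have -> : (\int[P]_w ((fun w => (X w - m)%:E)^\+ w) =
      \int[mu]_x (Num.max x 0 * normal_pdf 0 (Num.sqrt v) x)%:E)%E.
    rewrite -(normal_law_shift v0 nX cmax); last by move=> x; rewrite le_max lexx orbT.
    by apply: eq_integral => w _; rewrite funeposE -EFin_max.
  have -> : (\int[P]_w ((fun w => (X w - m)%:E)^\- w) =
      \int[mu]_x (Num.max (- x) 0 * normal_pdf 0 (Num.sqrt v) x)%:E)%E.
    rewrite -(normal_law_shift v0 nX cmaxN); last by move=> x; rewrite le_max lexx orbT.
    by apply: eq_integral => w _; rewrite funenegE -EFinN -EFin_max.
  have s0 : Num.sqrt v != 0 by rewrite gt_eqF// sqrtr_gt0.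
  rewrite (ge0_integral_reflect (g := fun x => Num.max x 0 *
    normal_pdf 0 (Num.sqrt v) x)); first last.
  - by move=> x x0; rewrite max_r// mul0r.
  - by move=> x; rewrite mulr_ge0 ?normal_pdf_ge0// le_max lexx orbT.
  - by move=> x; apply: cvgM; [exact: cmax|exact: continuous_normal_pdf].
  have -> : (fun x => (Num.max (- x) 0 * normal_pdf 0 (Num.sqrt v) (- x))%:E) =
      (fun x => (Num.max (- x) 0 * normal_pdf 0 (Num.sqrt v) x)%:E).
    apply/funext => x; congr (_ * _)%:E; rewrite normal_pdfE//.
    by rewrite /normal_fun !subr0 sqrrN.
  set I := (\int[mu]_x _)%E.
  (* For infinite [I] the difference is infinite and [fine] sends it to 0 as well. *)
  by case: I => [r| |] //=; rewrite subrr.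
transitivity (\int[P]_w (X w - m) + \int[P]_w (cst m w)); last first.
  by rewrite c0 add0r Rintegral_probability_cst.
rewrite -(RintegralD measurableT (sqint_integrable sXm)
  (sqint_integrable (sqint_cst P m))).
by apply: eq_Rintegral => w _ /=; rewrite subrK.
Qed.

End NormalLaw.

(** * Limits of Gaussian random variables *)

Lemma right_limit_le {R : realType} (f : R -> R) (x K : R) :
  f @ x^'+ --> f x -> (forall e, 0 < e -> f (x + e) <= K + e) -> f x <= K.
Proof.
move=> fx fK; apply/ler_addgt0Pr => e e0.
have e2 : 0 < e / 2 by rewrite divr_gt0.
have [y [fy xy yx]] : exists y, [/\ `|f x - f y| < e / 2, x < y & y < x + e / 2].
  apply: (@filter_ex _ x^'+); near=> y; split.
  - near: y; by move/cvgrPdist_lt : fx; apply.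
  - by near: y; exact: nbhs_right_gt.
  - by near: y; apply: nbhs_right_lt; rewrite ltrDl.
have := fK (y - x); rewrite subr_gt0 => /(_ xy); rewrite addrC subrK => h.
move: fy; rewrite ltr_norml => /andP[_]; lra.
Unshelve. all: end_near. Qed.

Section GaussianLimit.
Context {R : realType} {d : measure_display} {Omega : measurableType d}.
Variable P : probability Omega R.
Implicit Types X Y Z : Omega -> R.

Lemma sqint_chebyshev Z (e : R) : 0 < e -> sqint P Z ->
  (P [set w | e <= `|Z w|]%R <= (ip P Z Z / e ^+ 2)%:E)%E.
Proof.
move=> e0 sZ; have mZ := sqint_measurable sZ.
have e2 : 0 < e ^+ 2 by rewrite exprn_gt0.
set A := [set w | _].
have mA : measurable A.
  have -> : A = setT `&` ((fun x : R => `|x|) \o Z) @^-1` `[e, +oo[.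
    by rewrite setTI; apply/seteqP; split=> w; rewrite /A /= in_itv/= andbT.
  by apply: (measurableT_comp _ mZ) => //; exact: normr_measurable.
rewrite EFinM -lee_pdivrMr ?invr_gt0// invrK EFin_ip//.
rewrite muleC -integral_cst//.
apply: (@le_trans _ _ (\int[P]_(w in A) (Z w ^+ 2)%:E)%E).
  apply: ge0_le_integral => //.
  - by move=> w _; rewrite lee_fin ltW.
  - by apply/measurable_EFinP/measurable_funTS/measurable_funX.
  - move=> w; rewrite /A /= lee_fin => h.
    by rewrite -[leRHS]real_normK ?num_real// ler_pXn2r// nnegrE ltW.
apply: ge0_subset_integral => //.
- by apply/measurable_EFinP/measurable_funX.
- by move=> w _; rewrite lee_fin sqr_ge0.
Qed.

(** Every Y has the same law, so the tail P(X > r) can be compared with a fixed tail at r shifted by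
    e, up to an error e. Right continuity of the tail removes e, and the open upper half lines are
    stable under intersection and generate the Borel sets. *)
Lemma normal_law_closed X (m v : R) : measurable_fun setT X ->
  (forall e, 0 < e -> exists2 Y, has_normal_law P Y m v &
    (P [set w | e <= `|Y w - X w|]%R <= e%:E)%E) ->
  has_normal_law P X m v.
Proof.
(* [Y0] is just a reference variable carrying the law; the tolerance 1 is arbitrary. *)
move=> mX H; have [Y0 nY0 _] := H 1 ltr01.
split=> // A mA; have [mY0 lY0] := nY0; rewrite -lY0//.
pose X' : {mfun Omega >-> measurableTypeR R} :=
  HB.pack X (isMeasurableFun.Build _ _ _ (measurableTypeR R) _ mX).
pose Y' : {mfun Omega >-> measurableTypeR R} :=
  HB.pack Y0 (isMeasurableFun.Build _ _ _ (measurableTypeR R) _ mY0).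
have tail Y (r : R) : measurable_fun setT Y -> measurable (Y @^-1` `]r, +oo[).
  by move=> mY; rewrite -[B in measurable B]setTI; exact: mY.
(* If Y exceeds r + e while Z does not exceed r, then Y and Z are at least e apart. *)
have cmp Y Z (e r : R) : measurable_fun setT Y -> measurable_fun setT Z ->
    (P [set w | e <= `|Y w - Z w|]%R <= e%:E)%E ->
    (P (Y @^-1` `](r + e)%R, +oo[) <= P (Z @^-1` `]r, +oo[) + e%:E)%E.
  move=> mY mZ YZ; apply: le_trans (leeD2l _ YZ).
  have mD : measurable [set w | e <= `|Y w - Z w|].
    have -> : [set w | e <= `|Y w - Z w|] =
        setT `&` ((fun x : R => `|x|) \o (fun w => Y w - Z w)) @^-1` `[e, +oo[.
      by rewrite setTI; apply/seteqP; split=> w; rewrite /= in_itv/= andbT.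
    apply: (measurableT_comp (@normr_measurable _ _)) => //.
    exact: measurable_funB.
  apply: le_trans (measureU2 _ (tail _ _ mZ) mD).
  apply: le_measure; rewrite ?inE//; [exact: tail|by apply: measurableU => //; exact: tail|].
  move=> w; rewrite /= !in_itv/= !andbT => rY.
  have [rZ|Zr] := ltP r (Z w); [by left|right].
  apply: le_trans (ler_norm _); lra.
have eqtail (r : R) : P (X @^-1` `]r, +oo[) = P (Y0 @^-1` `]r, +oo[).
  have fin Z t : measurable_fun setT Z -> P (Z @^-1` `]t, +oo[) \is a fin_num.
    by move=> mZ; apply: fin_num_measure; exact: tail.
  have rc Z : measurable_fun setT Z ->
      (fun r => fine (P (Z @^-1` `]r, +oo[))) @ r^'+ --> fine (P (Z @^-1` `]r, +oo[)).
    move=> mZ; pose Z' : {mfun Omega >-> R} :=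
      HB.pack Z (isMeasurableFun.Build _ _ _ R _ mZ).
    apply: fine_cvg; rewrite fineK; last exact: fin.
    exact: (@ccdf_right_continuous _ _ _ P Z' r).
  apply/eqP; rewrite eq_le; apply/andP; split.
    rewrite -(fineK (fin _ _ mX)) -(fineK (fin _ _ mY0)) lee_fin.
    apply: (right_limit_le (rc _ mX)) => e e0.
    have [Y [mY lY] YX] := H _ e0.
    rewrite -lee_fin EFinD !fineK ?fin// lY0// -lY//.
    apply: cmp => //; move: YX; congr (P _ <= _)%E.
    by apply/seteqP; split=> w /=; rewrite distrC.
  rewrite -(fineK (fin _ _ mX)) -(fineK (fin _ _ mY0)) lee_fin.
  apply: (right_limit_le (rc _ mY0)) => e e0.
  have [Y [mY lY] YX] := H _ e0.
  rewrite -lee_fin EFinD !fineK ?fin// lY0// -lY//.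
  exact: cmp.
refine (@measure_unique _ R (measurableTypeR R) (@RGenOInfty.G R)
  (fun k : nat => `](- k%:R), +oo[%classic) _ _ _ _
  (distribution P X') (distribution P Y') _ _ A mA).
- exact: RGenOInfty.measurableE.
- move=> _ _ [x ->] [y ->]; exists (Num.max x y).
  apply/seteqP; split=> z /=; rewrite !in_itv/= !andbT gt_max.
    by case=> -> ->.
  by move=> /andP[-> ->].
- by move=> i; exists (- i%:R).
- apply/seteqP; split=> // x _; exists (Num.truncn `|x|).+1 => //=.
  rewrite in_itv/= andbT ltrNl; apply: le_lt_trans (truncnS_gt _).
  by rewrite -normrN ler_norm.
- by move=> _ [x ->]; exact: eqtail.
- move=> k; apply: le_lt_trans (probability_le1 _ _) _ => //; exact: ltry.
Qed.

(** Rescaled to the variance of the limit, the approximants all have exactly the law that X should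
    have, and still approach X; [normal_law_closed] concludes. A limit of variance 0 vanishes almost
    surely and is treated apart. *)
Lemma gaussian_l2_limit (X_ : nat -> Omega -> R) X :
  (forall n, sqint P (X_ n)) -> (forall n, \int[P]_w X_ n w = 0) ->
  (forall n c, gaussian_rv P (fun w => c * X_ n w)) ->
  sqint P X -> l2cvg P X_ X -> gaussian_rv P X.
Proof.
move=> sX_ X_0 gX_ sX cX; exists 0, (ip P X X); split; first exact: ip_ge0.
have [v0|vN0] := eqVneq (ip P X X) 0.
  rewrite v0; apply/has_normal_law0; split; first exact: (sqint_measurable sX).
  have : (\int[P]_w `|(X w ^+ 2)%:E| = 0)%E.
    under eq_integral do rewrite gee0_abs ?lee_fin ?sqr_ge0//.
    by rewrite -EFin_ip// v0.
  move/ae_eq_integral_abs => /(_ measurableT).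
  have m2 : measurable_fun setT (fun w => (X w ^+ 2)%:E).
    by apply/measurable_EFinP/measurable_funX; exact: (sqint_measurable sX).
  move=> /(_ m2); apply: filterS => w /(_ I) /= [] /eqP.
  by rewrite sqrf_eq0 => /eqP.
have v0 : 0 < ip P X X by rewrite lt_def vN0 ip_ge0.
pose v := ip P X X; pose v_ n := ip P (X_ n) (X_ n).
have cv : v_ @ \oo --> v by exact: l2cvg_ip.
(* With this factor [c n * X_ n] has variance v as soon as [v_ n] is positive. *)
pose c n := Num.sqrt (v / v_ n).
have cc : c @ \oo --> (1 : R).
  apply: (@cvg_to_eq _ (Num.sqrt (v / v))); first by rewrite divff// sqrtr1.
  apply: continuous_cvg; first exact: sqrt_continuous.
  by apply: cvgM; [exact: cvg_cst|exact: cvgV].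
pose D n := ip P (fun w => X_ n w - X w) (fun w => X_ n w - X w).
(* The bound from [ipD_le] for c_n X_n - X = (c_n - 1) X_n + (X_n - X). *)
have c0 : (fun n => 2 * ((c n - 1) ^+ 2 * v_ n) + 2 * D n) @ \oo --> (0 : R).
  apply: (@cvg_to_eq _ (2 * ((1 - 1) ^+ 2 * v) + 2 * 0)).
    by rewrite subrr expr0n/= mul0r !mulr0 addr0.
  apply: cvgD; last by apply: cvgM; [exact: cvg_cst|exact: cX].
  apply: cvgM; first exact: cvg_cst.
  apply: cvgM => //.
  rewrite expr2; under eq_fun do rewrite expr2.
  by apply: cvgM; apply: cvgB => //; exact: cvg_cst.
apply: normal_law_closed; first exact: (sqint_measurable sX).
move=> e e0.
(* Chebyshev divides the squared distance by e^2 and the quotient must be at most e. *)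
have e3 : 0 < e ^+ 3 by rewrite exprn_gt0.
have [n [vn0 dn]] : exists n, 0 < v_ n /\ 2 * ((c n - 1) ^+ 2 * v_ n) + 2 * D n < e ^+ 3.
  apply: (@filter_ex _ \oo); near=> n; split.
    near: n; move/cvgrPdist_lt : cv => /(_ _ v0); apply: filterS => n.
    by rewrite ltr_norml => /andP[_]; rewrite /v; lra.
  near: n; move/cvgrPdist_lt : c0 => /(_ _ e3); apply: filterS => n.
  by rewrite sub0r normrN; apply: le_lt_trans; exact: ler_norm.
have sc : sqint P (fun w => c n * X_ n w) by exact: sqintZ.
exists (fun w => c n * X_ n w).
  have [m [u [u0 nu]]] := gX_ n (c n).
  have [_ Em Vu] := normal_law_moments u0 nu.
  have m0 : m = 0.
    rewrite -Em; transitivity (c n * \int[P]_w X_ n w); last by rewrite X_0 mulr0.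
    by rewrite -RintegralZl//; exact: sqint_integrable.
  suff <- : u = ip P X X by rewrite -[0]m0.
  rewrite -Vu m0; under eq_fun do rewrite subr0.
  rewrite (ipZl _ (sX_ n) sc) ipC (ipZl _ (sX_ n) (sX_ n)) mulrA -expr2.
  rewrite /c sqr_sqrtr; last by rewrite divr_ge0 ?ip_ge0// ltW.
  by rewrite divfK// gt_eqF.
have sZ : sqint P (fun w => c n * X_ n w - X w) by exact: sqintB.
apply: le_trans (sqint_chebyshev e0 sZ) _; rewrite lee_fin.
rewrite ler_pdivrMr ?exprn_gt0// -exprS; apply: le_trans (ltW dn).
have sA : sqint P (fun w => (c n - 1) * X_ n w) by exact: sqintZ.
have sB : sqint P (fun w => X_ n w - X w) by exact: sqintB.
have EA : ip P (fun w => (c n - 1) * X_ n w) (fun w => (c n - 1) * X_ n w) =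
    (c n - 1) ^+ 2 * v_ n.
  by rewrite (ipZl _ (sX_ n) sA) ipC (ipZl _ (sX_ n) (sX_ n)) mulrA expr2.
have := ipD_le sA sB; rewrite EA.
congr (_ <= _); congr ip; apply/funext => w; ring.
Unshelve. all: end_near. Qed.

End GaussianLimit.

(** * Independent variables: expectation of a product *)

Section IndependentProduct.
Context {R : realType} {d : measure_display} {Omega : measurableType d}.
Variable P : probability Omega R.
Implicit Types X Y Z : Omega -> R.

(** Independence says that the joint law agrees with the product of the marginal laws on rectangles,
    hence everywhere; Fubini then splits the integral. *)
Lemma independent_ip X Y : independent_rv P X Y -> sqint P X -> sqint P Y ->
  ip P X Y = (\int[P]_w X w) * (\int[P]_w Y w).
Proof.
move=> iXY sX sY.
have mX := sqint_measurable sX; have mY := sqint_measurable sY.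
pose X' : {mfun Omega >-> R} := HB.pack X (isMeasurableFun.Build _ _ _ R _ mX).
pose Y' : {mfun Omega >-> R} := HB.pack Y (isMeasurableFun.Build _ _ _ R _ mY).
have mZ : measurable_fun setT (fun w => (X w, Y w)) by exact: measurable_fun_pair.
pose Z' : {mfun Omega >-> (R * R)%type} :=
  HB.pack (fun w => (X w, Y w)) (isMeasurableFun.Build _ _ _ (R * R)%type _ mZ).
pose m1 : probability R R := distribution P X'.
pose m2 : probability R R := distribution P Y'.
have prodE (A : set (R * R)) : measurable A -> (m1 \x m2)%E A = distribution P Z' A.
  apply: product_measure_unique => B C mB mC.
  by rewrite /distribution /pushforward -iXY.
have mf : measurable_fun setT (fun z : R * R => (z.1 * z.2)%:E).
  by apply/measurable_EFinP; apply: measurable_funM;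
    [exact: measurable_fst|exact: measurable_snd].
have iP : (m1 \x m2)%E.-integrable setT (fun z : R * R => (z.1 * z.2)%:E).
  apply/integrableP; split=> //.
  rewrite (@eq_measure_integral _ _ _ setT (distribution P Z')); last first.
    by move=> A mA _; exact: prodE.
  rewrite ge0_integral_distribution//; last exact: measurableT_comp.
  by have /integrableP[] := sqint_integrableM sX sY.
have -> : ip P X Y = fine (\int[(m1 \x m2)%E]_z (z.1 * z.2)%:E)%E.
  congr fine; rewrite (@eq_measure_integral _ _ _ setT (distribution P Z')); last first.
    by move=> A mA _; exact: prodE.
  rewrite integral_distribution//; exact: sqint_integrableM.
have EX : (\int[m1]_x x%:E = (\int[P]_w X w)%:E)%E.
  rewrite integral_distribution//; last exact: sqint_integrable.
  by rewrite /Rintegral fineK//; exact/integrable_fin_num/sqint_integrable.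
have EY : (\int[m2]_x x%:E = (\int[P]_w Y w)%:E)%E.
  rewrite integral_distribution//; last exact: sqint_integrable.
  by rewrite /Rintegral fineK//; exact/integrable_fin_num/sqint_integrable.
have i2 : m2.-integrable setT (fun x : R => x%:E).
  apply/integrableP; split; first exact/measurable_EFinP/measurable_id.
  rewrite (_ : (\int[m2]_x `|x%:E|)%E = (\int[P]_w `|(Y w)%:E|)%E).
    by have /integrableP[] := sqint_integrable sY.
  apply: (@ge0_integral_distribution _ _ _ _ _ P Y' (fun x => `|x%:E|%E)) => //.
  exact: measurableT_comp.
have i1 : m1.-integrable setT (fun x : R => x%:E).
  apply/integrableP; split; first exact/measurable_EFinP/measurable_id.
  rewrite (_ : (\int[m1]_x `|x%:E|)%E = (\int[P]_w `|(X w)%:E|)%E).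
    by have /integrableP[] := sqint_integrable sX.
  apply: (@ge0_integral_distribution _ _ _ _ _ P X' (fun x => `|x%:E|%E)) => //.
  exact: measurableT_comp.
rewrite -integral12_prod_meas1// /fubini_F /=.
under eq_integral do [under eq_integral do rewrite EFinM; rewrite integralZl// EY].
by rewrite integralZr// EX.
Qed.

End IndependentProduct.

(** * Independence of generated sigma-algebras *)

Section IndependentSigma.
Context {R : realType} {d : measure_display} {Omega : measurableType d}.
Variable P : probability Omega R.
Implicit Types (G H : set (set Omega)) (A B : set Omega).

(** For fixed B, the finite measures P(A and B) and P(A) P(B) in A agree on the intersection-stable
    family G, hence on what it generates. The second one is written as [mscale] of P. *)
Lemma independent_g_sigma_algebra G B : setI_closed G -> G setT ->
  G `<=` measurable -> measurable B ->
  (forall A, G A -> P (A `&` B) = P A * P B)%E ->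
  forall A, <<s G >> A -> (P (A `&` B) = P A * P B)%E.
Proof.
move=> GI GT Gm mB GB A sA.
have rB : (0 <= fine (P B))%R by exact: fine_ge0.
have cT : \bigcup_(k : nat) (fun=> [set: Omega]) k = setT.
  by rewrite bigcup_const//; exists 0%N.
have mE C : mscale (NngNum rB) P C = (P C * P B)%E.
  transitivity ((fine (P B))%:E * P C)%E; first by [].
  by rewrite fineK ?fin_num_measure// muleC.
rewrite -mE; apply: (@g_sigma_algebra_measure_unique _ R Omega G Gm (fun=> setT)
  (fun=> GT) cT (mrestr P mB) (mscale (NngNum rB) P) GI) => //.
- by move=> C GC; rewrite [RHS]mE -GB.
- by move=> _; apply: le_lt_trans (ltry 1); apply: probability_le1; exact: measurableI.
Qed.

Lemma independent_g_sigma_algebras G H : setI_closed G -> setI_closed H ->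
  G setT -> H setT -> G `<=` measurable -> H `<=` measurable ->
  (forall A B, G A -> H B -> P (A `&` B) = P A * P B)%E ->
  forall A B, <<s G >> A -> <<s H >> B -> (P (A `&` B) = P A * P B)%E.
Proof.
move=> GI HI GT HT Gm Hm GH A B sA sB.
have mB : measurable B.
  move: sB; have := smallest_sub (@sigma_algebra_measurable _ Omega) Hm; apply.
apply: (independent_g_sigma_algebra GI GT Gm mB _ sA) => C GC.
rewrite setIC muleC.
apply: (independent_g_sigma_algebra HI HT Hm (Gm _ GC) _ sB) => D HD.
by rewrite setIC muleC; exact: GH.
Qed.

Section Families.
Context {I : eqType} (D : set I) (X : I -> Omega -> R[i]).
Hypothesis mX : forall i, D i -> measurable_fun setT (fun w => cpair (X i w)).
Hypothesis iX : mutually_independent P D X.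

Definition family_events (J : set I) : set (set Omega) :=
  [set A | exists i (B : set (R * R)),
    [/\ J i, measurable B & A = [set w | B (cpair (X i w))]]].

(** Finite intersections of members of [family_events J]: they generate the same sigma-algebra and
    are stable under intersection. *)
Let cylinders (J : set I) : set (set Omega) :=
  [set A | exists (s : seq I) (B : I -> set (R * R)),
    [/\ uniq s, forall i, i \in s -> J i, forall i, measurable (B i) &
        A = [set w | forall i, i \in s -> B i (cpair (X i w))]]].

Let cylindersI J : setI_closed (cylinders J).
Proof.
move=> _ _ [s [B [us sJ mB ->]]] [t [C [ut tJ mC ->]]].
(* An index constrained by only one of the two cylinders gets the full set from the other. *)
exists (undup (s ++ t)), (fun i => (if i \in s then B i else setT) `&`
  (if i \in t then C i else setT)); split.
- exact: undup_uniq.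
- by move=> i; rewrite mem_undup mem_cat => /orP[/sJ|/tJ].
- by move=> i; apply: measurableI; case: ifP.
- apply/seteqP; split=> w /=.
    move=> [sB tC] i; rewrite mem_undup mem_cat => _.
    by split; case: ifPn => //; [exact: sB|exact: tC].
  move=> h; split=> i si; have := h i; rewrite mem_undup mem_cat si ?orbT /=.
    by case/(_ isT).
  by case/(_ isT).
Qed.

Let cylindersT J : cylinders J setT.
Proof.
exists [::], (fun=> setT); split=> //.
by apply/seteqP; split.
Qed.

Let cylinders_measurable J : J `<=` D -> cylinders J `<=` measurable.
Proof.
move=> JD _ [s [B [us sJ mB ->]]].
elim: s us sJ => [_ _|i s IH /= /andP[_ us] sJ].
  rewrite (_ : mkset _ = setT)//; first by apply/seteqP; split.
rewrite (_ : mkset _ = (fun w => cpair (X i w)) @^-1` (B i) `&`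
    [set w | forall j, j \in s -> B j (cpair (X j w))]).
  apply: measurableI.
    rewrite -[S in measurable S]setTI; apply: mX => //.
    by apply: JD; apply: sJ; rewrite mem_head.
  by apply: IH => // j js; apply: sJ; rewrite in_cons js orbT.
apply/seteqP; split=> w /=.
  by move=> h; split=> [|j js]; apply: h; rewrite ?mem_head// in_cons js orbT.
by move=> [h1 h2] j; rewrite in_cons => /predU1P[->|/h2].
Qed.

Lemma independent_family_events (J K : set I) : J `<=` D -> K `<=` D ->
  J `&` K = set0 -> forall A B, <<s family_events J >> A ->
  <<s family_events K >> B -> (P (A `&` B) = P A * P B)%E.
Proof.
move=> JD KD JK A B sA sB.
have sub L : family_events L `<=` cylinders L.
  move=> _ [i [C [Li mC ->]]]; exists [:: i], (fun=> C); split=> //.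
    by move=> j; rewrite inE => /eqP ->.
  apply/seteqP; split=> w /=; last by apply; rewrite inE.
  by move=> h j; rewrite inE => /eqP ->.
apply: (@independent_g_sigma_algebras (cylinders J) (cylinders K)) => //.
- exact: cylinders_measurable.
- exact: cylinders_measurable.
- move=> _ _ [s [C [us sJ mC ->]]] [t [E [ut tK mE ->]]].
  (* As J and K are disjoint, s and t share no index, so one application of mutual independence to
     [s ++ t] covers both cylinders. *)
  pose F i := if i \in s then C i else E i.
  have nst i : i \in t -> i \notin s.
    move=> it; apply/negP => si.
    have : (J `&` K) i by split; [exact: sJ|exact: tK].
    by rewrite JK.
  have ust : uniq (s ++ t).
    rewrite cat_uniq us ut andbT /=; apply/hasPn => i; exact: nst.
  have mF i : measurable (F i) by rewrite /F; case: ifP.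
  have := iX ust _ mF.
  have -> : [set w | forall i, i \in s ++ t -> F i (cpair (X i w))] =
      [set w | forall i, i \in s -> C i (cpair (X i w))] `&`
      [set w | forall i, i \in t -> E i (cpair (X i w))].
    apply/seteqP; split=> w /=.
      move=> h; split=> i it; have := h i; rewrite mem_cat it ?orbT /F => /(_ isT).
        by rewrite it.
      by rewrite (negbTE (nst _ it)).
    move=> [h1 h2] i; rewrite mem_cat /F => /orP[it|it]; first by rewrite it; exact: h1.
    by rewrite (negbTE (nst _ it)); exact: h2.
  move=> ->; last by move=> i; rewrite mem_cat => /orP[/sJ/JD|/tK/KD].
  rewrite big_cat /= (iX us _ mC); last by move=> i /sJ/JD.
  rewrite (iX ut _ mE); last by move=> i /tK/KD.
  congr (_ * _)%E; apply: eq_big_seq => i it; rewrite /F ?it//.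
  by rewrite (negbTE (nst _ it)).
- exact: sub_sigma_algebra2 sA.
- exact: sub_sigma_algebra2 sB.
Qed.

End Families.

(** Along a subsequence with summable squared errors the convergence holds almost everywhere, so g
    agrees almost everywhere with a limes superior of variables measurable for the sigma-algebra
    generated by G. *)
Lemma l2cvg_ae_limit G (f_ : nat -> Omega -> R) (g : Omega -> R) :
  (forall n, @measurable_fun _ _ (g_sigma_algebraType G) R setT (f_ n)) ->
  (forall n, sqint P (f_ n)) -> sqint P g -> l2cvg P f_ g ->
  exists2 f : Omega -> R,
    @measurable_fun _ _ (g_sigma_algebraType G) R setT f &
    {ae P, forall w, g w = f w}.
Proof.
move=> mf sf sg cf.
pose D n := ip P (fun w => f_ n w - g w) (fun w => f_ n w - g w).
(* Geometric errors make the expected sum of the squared deviations [h] finite. *)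
have /choice[k kP] : forall j : nat, exists n, D n < 1 / (2 ^ (j + 1))%:R.
  move=> j; have e0 : 0 < 1 / (2 ^ (j + 1))%:R :> R.
    by rewrite divr_gt0// ltr0n expn_gt0.
  move/cvgrPdist_lt : cf => /(_ _ e0) [n _ /(_ n (leqnn n))].
  by rewrite sub0r normrN => h; exists n; apply: le_lt_trans h; exact: ler_norm.
pose h j w := (((f_ (k j) w - g w) ^+ 2)%:E : \bar R).
have h0 j w : (0 <= h j w)%E by rewrite lee_fin sqr_ge0.
have sD j : sqint P (fun w => f_ (k j) w - g w) by exact: sqintB.
have mh j : measurable_fun setT (h j).
  by apply/measurable_EFinP/measurable_funX; case: (sD j).
have fin : (\int[P]_w (\sum_(j <oo) h j w) < +oo)%E.
  rewrite integral_nneseries//.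
  apply: (@le_lt_trans _ _ (\sum_(j <oo) (1 / (2 ^ (j + 1))%:R : R)%:E)%E).
    apply: lee_nneseries => [j _ _|j _]; first exact: integral_ge0.
    by rewrite /h -(EFin_ip (sD j)) lee_fin; exact: ltW (kP j).
  have /cvg_lim -> // := @cvg_geometric_eseries_half R 1 0.
  exact: ltry.
have iS : P.-integrable setT (fun w => \sum_(j <oo) h j w)%E.
  apply/integrableP; split; first exact: ge0_emeasurable_sum.
  by under eq_integral do rewrite gee0_abs ?nneseries_ge0//.
(* The upper limit is defined on all of [Omega], also where the subsequence diverges, and so stays
   measurable without completing the sigma-algebra. *)
exists (fun w => fine (limn_esup (fun j => (f_ (k j) w)%:E))).
  apply: measurableT_comp => //.
  apply: (@measurable_fun_limn_esup _ (g_sigma_algebraType G) R setT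
    (fun j w => (f_ (k j) w)%:E)) => j.
  exact/measurable_EFinP.
have := integrable_ae measurableT iS; apply: filterS => w /(_ I) finw.
have tail0 : (\sum_(N <= j <oo) h j w @[N --> \oo] --> 0)%E.
  apply: nneseries_tail_cvg => //.
  by rewrite -ge0_fin_numE//; exact: nneseries_ge0.
have hw0 : (h j w @[j --> \oo] --> 0)%E.
  apply: (squeeze_cvge _ (cvg_cst 0%E) tail0).
  apply: nearW => j; rewrite h0/=.
  have := @nneseries_lim_ge _ (h ^~ w) xpredT j j.+1 (fun n _ _ => h0 n w).
  by rewrite big_nat1.
have fw : (fun j => f_ (k j) w) @ \oo --> g w.
  have sq0 : (fun j => (f_ (k j) w - g w) ^+ 2) @ \oo --> (0 : R) by exact: fine_cvg hw0.
  have d0 : (fun j => f_ (k j) w - g w) @ \oo --> (0 : R) by exact: (cvg0_sqr _ sq0).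
  have -> : (fun j => f_ (k j) w) = (fun j => (f_ (k j) w - g w) + g w).
    by apply/funext => j; rewrite subrK.
  by apply: (cvg_to_eq (add0r _)); apply: cvgD => //; exact: cvg_cst.
have fwE : (fun j => (f_ (k j) w)%:E) @ \oo --> (g w)%:E.
  by apply: cvg_EFin => //; exact: nearW.
rewrite limn_esup_lim.
by have /cvg_lim -> := cvg_esups fwE.
Qed.

(** The measurable events that agree almost everywhere with an event generated by G form a
    sigma-algebra, so the generators F suffice. *)
Lemma ae_sigma_approx G F : G `<=` measurable -> F `<=` measurable ->
  (forall A, F A -> exists2 A', <<s G >> A' & {ae P, forall w, A w <-> A' w}) ->
  forall A, <<s F >> A ->
    measurable A /\ exists2 A', <<s G >> A' & {ae P, forall w, A w <-> A' w}.
Proof.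
move=> Gm Fm FG.
apply: smallest_sub; last by move=> A FA; split; [exact: Fm|exact: FG].
split.
- split=> //; exists set0; first exact: sigma_algebra0.
  exact: aeW.
- move=> A [mA [A' sA AA']]; split; first exact: measurableD.
  exists (~` A'); first exact: sigma_algebraC.
  move: AA'; apply: filterS => w [h1 h2]; rewrite setTD /setC /=.
  by split=> h ?; apply: h; [exact: h2|exact: h1].
- move=> A h; split; first by apply: bigcupT_measurable => n; have [] := h n.
  have /choice[A' A'P] : forall n, exists A', <<s G >> A' /\
      {ae P, forall w, A n w <-> A' w}.
    by move=> n; have [_ [A' ? ?]] := h n; exists A'.
  exists (\bigcup_n A' n).
    by apply: sigma_algebra_bigcup => n; have [] := A'P n.
  have : {ae P, forall w, forall n, A n w <-> A' n w}.
    by apply: ae_foralln => n; have [] := A'P n.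
  apply: filterS => w hw; split=> -[n _ hn]; exists n => //; exact/hw.
Qed.

(** The null set in the last two hypotheses depends on the point x, of which there may be
    uncountably many. [ae_sigma_approx] works event by event, and each event of a field is moved by
    a null set only, which leaves all three probabilities unchanged. *)
Lemma independent_fields_approx (dS : measure_display) (S : measurableType dS)
    (E : set S) (X Y : S -> Omega -> R[i]) G H :
  G `<=` measurable -> H `<=` measurable ->
  (forall A B, <<s G >> A -> <<s H >> B -> P (A `&` B) = P A * P B)%E ->
  (forall x, E x -> measurable_fun setT (fun w => cpair (X x w))) ->
  (forall x, E x -> measurable_fun setT (fun w => cpair (Y x w))) ->
  (forall x, E x -> exists2 f : Omega -> R * R,
    @measurable_fun _ _ (g_sigma_algebraType G) _ setT f &
    {ae P, forall w, cpair (X x w) = f w}) ->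
  (forall x, E x -> exists2 f : Omega -> R * R,
    @measurable_fun _ _ (g_sigma_algebraType H) _ setT f &
    {ae P, forall w, cpair (Y x w) = f w}) ->
  independent_fields P E X Y.
Proof.
move=> Gm Hm GH mX mY aX aY A B sA sB.
have sub G' : G' `<=` measurable -> <<s G' >> `<=` (measurable : set (set Omega)).
  by move=> G'm; exact: smallest_sub (@sigma_algebra_measurable _ Omega) G'm.
have approx G' (Z : S -> Omega -> R[i]) C : G' `<=` measurable ->
    (forall x, E x -> measurable_fun setT (fun w => cpair (Z x w))) ->
    (forall x, E x -> exists2 f : Omega -> R * R,
      @measurable_fun _ _ (g_sigma_algebraType G') _ setT f &
      {ae P, forall w, cpair (Z x w) = f w}) ->
    field_events E Z C ->
    measurable C /\ exists2 C', <<s G' >> C' & {ae P, forall w, C w <-> C' w}.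
  move=> G'm mZ aZ; apply: ae_sigma_approx => //.
    move=> _ [x [F [Ex mF ->]]].
    by rewrite -[U in measurable U]setTI; exact: mZ.
  move=> _ [x [F [Ex mF ->]]].
  have [f mf fZ] := aZ x Ex.
  exists (f @^-1` F).
    by have := mf measurableT F mF; rewrite setTI.
  by move: fZ; apply: filterS => w /= ->.
have [mA [A' sA' AA']] := approx _ _ _ Gm mX aX sA.
have [mB [B' sB' BB']] := approx _ _ _ Hm mY aY sB.
have mA' := sub _ Gm _ sA'; have mB' := sub _ Hm _ sB'.
rewrite (ae_iff_measure mA mA' AA') (ae_iff_measure mB mB' BB') -GH//.
apply: ae_iff_measure; [exact: measurableI..|].
move: BB'; apply: filterS2 AA' => w [a1 a2] [b1 b2].
by split=> -[hA hB]; split; [exact: a1|exact: b1|exact: a2|exact: b2].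
Qed.

End IndependentSigma.

(* The terms of orders m and - m of the expansion are conjugate, so for m > 0 they
   add up to twice a real part. *)
Definition harm_weight {R : realType} (m : nat) : R := if m == 0%N then 1 else 2.

Lemma big_ord_pick {R : realType} (n m : nat) (F : nat -> R) :
  \sum_(k < n) F k * (k == m :> nat)%:R = (m < n)%:R * F m.
Proof.
have [mn|mn] := ltnP m n; last first.
  rewrite mul0r big1// => k _; rewrite ltn_eqF ?mulr0//.
  exact: leq_trans (ltn_ord k) mn.
rewrite (bigD1 (Ordinal mn))//= eqxx mulr1 mul1r big1 ?addr0// => k.
by rewrite -val_eqE /= => /negbTE ->; rewrite mulr0.
Qed.

Lemma big_ord_nat_cond {R : realType} (n m : nat) (F : nat -> R) :
  \sum_(l < n) (m <= l)%:R * F l = \sum_(m <= l < n) F l.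
Proof.
rewrite (big_nat_widenl m 0)//= -(big_mkord xpredT (fun l => (m <= l)%:R * F l)).
rewrite [RHS]big_mkcond; apply: eq_bigr => l _ /=.
by case: leqP; rewrite ?mul1r ?mul0r.
Qed.

(** * Real trigonometric sums *)

Section TrigContinuity.
Context {R : realType}.

Lemma continuous_cosM (c : R) : continuous (fun x : R => cos (c * x)).
Proof.
move=> x; apply: continuous_comp; last exact: continuous_cos.
exact: mulrl_continuous.
Qed.

Lemma continuous_sinM (c : R) : continuous (fun x : R => sin (c * x)).
Proof.
move=> x; apply: continuous_comp; last exact: continuous_sin.
exact: mulrl_continuous.
Qed.

Let cZ (c : R) (f : R -> R) : continuous f -> continuous (fun x => c * f x).
Proof. by move=> cf x; apply: cvgM; [exact: cvg_cst|exact: cf]. Qed.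

Let cM (f g : R -> R) : continuous f -> continuous g ->
  continuous (fun x => f x * g x).
Proof. by move=> cf cg x; apply: cvgM; [exact: cf|exact: cg]. Qed.

Lemma continuous_bigsum (I : Type) (r : seq I) (F : I -> R -> R) :
  (forall i, continuous (F i)) -> continuous (fun x => \sum_(i <- r) F i x).
Proof.
move=> cF; elim: r => [|i r IH].
  by under eq_fun do rewrite big_nil; move=> x; exact: cvg_cst.
under eq_fun do rewrite big_cons.
by move=> x; apply: cvgD; [exact: cF|exact: IH].
Qed.

(** The real part of [(a +i* b) * expi (k%:R * x)], times c and the weight: with c a value of [Llm],
    the joint contribution of the orders k and -k. *)
Definition harm_term (c a b : R) (k : nat) (x : R) : R :=
  harm_weight k * c * (a * cos (k%:R * x) - b * sin (k%:R * x)).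

Definition harm_sum (L A B : nat -> nat -> R) (n : nat) (x : R) : R :=
  \sum_(l < n) \sum_(k < l.+1) harm_term (L l k) (A l k) (B l k) k x.

Lemma continuous_harm_term (c a b : R) (k : nat) : continuous (harm_term c a b k).
Proof.
apply: cZ => x; apply: cvgB; apply: cvgM; try exact: cvg_cst.
  exact: continuous_cosM.
exact: continuous_sinM.
Qed.

Lemma continuous_harm_sum (L A B : nat -> nat -> R) n : continuous (harm_sum L A B n).
Proof.
apply: continuous_bigsum => l.
by apply: continuous_bigsum => k; exact: continuous_harm_term.
Qed.

End TrigContinuity.

(** * Fourier coefficients for a mean that is exact on low frequencies *)

Section TrigMean.
Context {R : realType}.
(** The common core of the integral mean, which satisfies the hypotheses for every N, and of the
    mean over N nodes, which is exact on frequencies below N. *)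
Variables (Lam : (R -> R) -> R) (N : nat).
Hypothesis LamD : forall f g : R -> R, continuous f -> continuous g ->
  Lam (fun x => f x + g x) = Lam f + Lam g.
Hypothesis LamZ : forall (c : R) (f : R -> R), continuous f ->
  Lam (fun x => c * f x) = c * Lam f.
Hypothesis Lam_cos : forall j : nat, (j < N)%N ->
  Lam (fun x => cos (j%:R * x)) = (j == 0%N)%:R.
Hypothesis Lam_sin : forall j : nat, (j < N)%N -> Lam (fun x => sin (j%:R * x)) = 0.

Let ccos (c : R) : continuous (fun x : R => cos (c * x)).
Proof. exact: continuous_cosM. Qed.

Let csin (c : R) : continuous (fun x : R => sin (c * x)).
Proof. exact: continuous_sinM. Qed.

Let cZ (c : R) (f : R -> R) : continuous f -> continuous (fun x => c * f x).
Proof. by move=> cf x; apply: cvgM; [exact: cvg_cst|exact: cf]. Qed.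

Let cM (f g : R -> R) : continuous f -> continuous g ->
  continuous (fun x => f x * g x).
Proof. by move=> cf cg x; apply: cvgM; [exact: cf|exact: cg]. Qed.

Let LamB (f g : R -> R) : continuous f -> continuous g ->
  Lam (fun x => f x - g x) = Lam f - Lam g.
Proof.
move=> cf cg; rewrite -[- Lam g]mulN1r -LamZ// -LamD//; last exact: cZ.
by congr Lam; apply/funext => x; rewrite mulN1r.
Qed.

Let Lam_cosB (k m : nat) : (k < N)%N -> (m < N)%N ->
  Lam (fun x => cos ((k%:R - m%:R) * x)) = (k == m)%:R.
Proof.
wlog km : k m / (m <= k)%N => [H kN mN|kN mN].
  have [mk|km] := leqP m k; first exact: H.
  rewrite eq_sym -(H m k (ltnW km))//; congr Lam; apply/funext => x.
  by rewrite -cosN -mulNr opprB.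
rewrite -natrB// Lam_cos; last exact: leq_ltn_trans (leq_subr _ _) kN.
by rewrite subn_eq0 eqn_leq km andbT.
Qed.

Let Lam_sinB (k m : nat) : (k < N)%N -> (m < N)%N ->
  Lam (fun x => sin ((k%:R - m%:R) * x)) = 0.
Proof.
wlog km : k m / (m <= k)%N => [H kN mN|kN mN].
  have [mk|km] := leqP m k; first exact: H.
  have := H m k (ltnW km) mN kN => h.
  rewrite (_ : (fun x => _) = (fun x => -1 * sin ((m%:R - k%:R) * x))).
    by rewrite LamZ// h mulr0.
  by apply/funext => x; rewrite mulN1r -sinN -mulNr opprB.
by rewrite -natrB// Lam_sin//; exact: leq_ltn_trans (leq_subr _ _) kN.
Qed.

Let half (f g : R -> R) : continuous f -> continuous g ->
  Lam (fun x => 2^-1 * (f x + g x)) = 2^-1 * (Lam f + Lam g).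
Proof.
move=> cf cg; rewrite LamZ ?LamD// => x.
by apply: cvgD; [exact: cf|exact: cg].
Qed.

Let halfB (f g : R -> R) : continuous f -> continuous g ->
  Lam (fun x => 2^-1 * (f x - g x)) = 2^-1 * (Lam f - Lam g).
Proof.
move=> cf cg; rewrite LamZ ?LamB// => x.
by apply: cvgB; [exact: cf|exact: cg].
Qed.

Section Products.
Variables k m : nat.
Hypothesis kmN : (k + m < N)%N.
Let kN : (k < N)%N. Proof. exact: leq_ltn_trans (leq_addr _ _) kmN. Qed.
Let mN : (m < N)%N. Proof. exact: leq_ltn_trans (leq_addl _ _) kmN. Qed.

Let Lam_coscos : Lam (fun x => cos (k%:R * x) * cos (m%:R * x)) =
  (k == m)%:R / harm_weight m.
Proof.
rewrite (_ : (fun x => _) = (fun x => 2^-1 * (cos ((k%:R - m%:R) * x) +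
    cos ((k + m)%:R * x)))); last first.
  by apply/funext => x; rewrite natrD mulrBl mulrDl cosB cosD; field.
rewrite half// Lam_cosB// Lam_cos// /harm_weight.
have [->|km] := eqVneq k m; last first.
  rewrite (_ : (k + m == 0)%N = false) ?addr0 ?mulr0 ?mul0r//.
  by apply/negbTE; move: km; case: (k) (m) => [|k'] [|m'].
by rewrite addn_eq0 andbb; case: eqP => _ /=; field.
Qed.

Let Lam_sinsin : Lam (fun x => sin (k%:R * x) * sin (m%:R * x)) =
  (k == m)%:R * (m != 0%N)%:R / 2.
Proof.
rewrite (_ : (fun x => _) = (fun x => 2^-1 * (cos ((k%:R - m%:R) * x) -
    cos ((k + m)%:R * x)))); last first.
  by apply/funext => x; rewrite natrD mulrBl mulrDl cosB cosD; field.
rewrite halfB// Lam_cosB// Lam_cos//.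
have [->|km] := eqVneq k m; last first.
  rewrite (_ : (k + m == 0)%N = false) ?subr0 ?mulr0 ?mul0r//.
  by apply/negbTE; move: km; case: (k) (m) => [|k'] [|m'].
by rewrite addn_eq0 andbb; case: eqP => _ /=; field.
Qed.

Let Lam_sincos : Lam (fun x => sin (k%:R * x) * cos (m%:R * x)) = 0.
Proof.
rewrite (_ : (fun x => _) = (fun x => 2^-1 * (sin ((k%:R - m%:R) * x) +
    sin ((k + m)%:R * x)))); last first.
  by apply/funext => x; rewrite natrD mulrBl mulrDl sinB sinD; field.
by rewrite half// Lam_sinB// Lam_sin// addr0 mulr0.
Qed.

Let Lam_cossin : Lam (fun x => cos (k%:R * x) * sin (m%:R * x)) = 0.
Proof.
rewrite (_ : (fun x => _) = (fun x => 2^-1 * (sin ((k + m)%:R * x) -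
    sin ((k%:R - m%:R) * x)))); last first.
  by apply/funext => x; rewrite natrD mulrBl mulrDl sinB sinD; field.
by rewrite halfB// Lam_sinB// Lam_sin// subr0 mulr0.
Qed.

(** The square of cos (m x) has mean 1 for m = 0 and 1/2 otherwise, which cancels the weight. *)
Lemma Lam_harm_cos (c a b : R) :
  Lam (fun x => harm_weight k * c * (a * cos (k%:R * x) - b * sin (k%:R * x)) *
    cos (m%:R * x)) = c * a * (k == m)%:R.
Proof.
rewrite (_ : (fun x => _) = (fun x =>
    harm_weight k * c * a * (cos (k%:R * x) * cos (m%:R * x)) -
    harm_weight k * c * b * (sin (k%:R * x) * cos (m%:R * x)))); last first.
  by apply/funext => x; ring.
rewrite LamB; [|by apply: cZ; exact: cM|by apply: cZ; exact: cM].
rewrite !LamZ; [|exact: cM|exact: cM].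
rewrite Lam_coscos Lam_sincos mulr0 subr0.
have [->|_] := eqVneq k m; last by rewrite mul0r !mulr0.
by rewrite /harm_weight; case: ifP => _; field.
Qed.

(** The minus signs in front of b and inside the sine cancel. For m = 0 the sine vanishes
    identically, whence the indicator at b. *)
Lemma Lam_harm_sin (c a b : R) :
  Lam (fun x => harm_weight k * c * (a * cos (k%:R * x) - b * sin (k%:R * x)) *
    sin (- (m%:R * x))) = c * ((m != 0%N)%:R * b) * (k == m)%:R.
Proof.
rewrite (_ : (fun x => _) = (fun x =>
    harm_weight k * c * b * (sin (k%:R * x) * sin (m%:R * x)) -
    harm_weight k * c * a * (cos (k%:R * x) * sin (m%:R * x)))); last first.
  by apply/funext => x; rewrite sinN; ring.
rewrite LamB; [|by apply: cZ; exact: cM|by apply: cZ; exact: cM].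
rewrite !LamZ; [|exact: cM|exact: cM].
rewrite Lam_cossin Lam_sinsin mulr0 subr0.
have [->|_] := eqVneq k m; last by rewrite !mul0r !mulr0.
by rewrite /harm_weight; case: eqP => _ /=; field.
Qed.

End Products.

Let Lam_sum (I : Type) (r : seq I) (F : I -> R -> R) :
  (forall i, continuous (F i)) ->
  Lam (fun x => \sum_(i <- r) F i x) = \sum_(i <- r) Lam (F i).
Proof.
move=> cF; elim: r => [|i r IH].
  (* The empty sum is written as 0 times a continuous function, so that homogeneity of [Lam]
     evaluates it. *)
  rewrite big_nil (_ : (fun x => _) = (fun x => 0 * cos (0 * x))).
    by rewrite LamZ ?mul0r.
  by apply/funext => x; rewrite big_nil mul0r.
under eq_fun do rewrite big_cons.
by rewrite LamD// ?IH ?big_cons//; exact: continuous_bigsum.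
Qed.

Let Lam_harm_sum (L A B : nat -> nat -> R) n (f : R -> R) : continuous f ->
  Lam (fun x => harm_sum L A B n x * f x) =
  \sum_(l < n) \sum_(k < l.+1)
    Lam (fun x => harm_term (L l k) (A l k) (B l k) k x * f x).
Proof.
move=> cf; rewrite /harm_sum.
have c1 (l : 'I_n) (k : 'I_l.+1) :
    continuous (fun x => harm_term (L l k) (A l k) (B l k) k x * f x).
  by apply: cM => //; exact: continuous_harm_term.
under eq_fun do rewrite mulr_suml.
under eq_fun do under eq_bigr do rewrite mulr_suml.
rewrite Lam_sum; last by move=> l; apply: continuous_bigsum.
by apply: eq_bigr => l _; rewrite Lam_sum.
Qed.

Lemma Lam_harm_sum_cos (L A B : nat -> nat -> R) (n m : nat) : (n + m <= N)%N ->
  Lam (fun x => harm_sum L A B n x * cos (m%:R * x)) =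
  \sum_(m <= l < n) L l m * A l m.
Proof.
move=> nmN; rewrite Lam_harm_sum//.
rewrite -(big_ord_nat_cond n m (fun l => L l m * A l m)).
apply: eq_bigr => l _; rewrite -ltnS -(big_ord_pick l.+1 m (fun k => L l k * A l k)).
apply: eq_bigr => k _; apply: Lam_harm_cos.
(* The orders satisfy k <= l < n, so that k + m < n + m <= N. *)
apply: leq_trans nmN; rewrite ltn_add2r; exact: leq_trans (ltn_ord k) (ltn_ord l).
Qed.

Lemma Lam_harm_sum_sin (L A B : nat -> nat -> R) (n m : nat) : (n + m <= N)%N ->
  Lam (fun x => harm_sum L A B n x * sin (- (m%:R * x))) =
  \sum_(m <= l < n) L l m * ((m != 0%N)%:R * B l m).
Proof.
move=> nmN; rewrite Lam_harm_sum//; last first.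
  by under eq_fun do rewrite -mulNr; exact: csin.
rewrite -(big_ord_nat_cond n m (fun l => L l m * ((m != 0%N)%:R * B l m))).
apply: eq_bigr => l _.
rewrite -ltnS -(big_ord_pick l.+1 m (fun k => L l k * ((m != 0%N)%:R * B l k))).
apply: eq_bigr => k _; rewrite Lam_harm_sin; last first.
  apply: leq_trans nmN; rewrite ltn_add2r; exact: leq_trans (ltn_ord k) (ltn_ord l).
by [].
Qed.

End TrigMean.

(** * Integral mean and mean over equally spaced nodes *)

Section Means.
Context {R : realType}.
Local Notation mu := (@lebesgue_measure R).

Definition imean (f : R -> R) : R :=
  (2 * pi)^-1 * \int[mu]_(x in `[0, 2 * pi]) f x.

Definition dpoint (N k : nat) : R := 2 * pi * k%:R / N%:R.

Definition dmean (N : nat) (f : R -> R) : R := N%:R^-1 * \sum_(k < N) f (dpoint N k).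

Let pi2 : 0 < 2 * pi :> R. Proof. by rewrite mulr_gt0 ?pi_gt0. Qed.

Let integrable_itv (h : R -> R) : continuous h ->
  mu.-integrable `[0, 2 * pi] (EFin \o h).
Proof.
move=> ch; apply: continuous_compact_integrable; first exact: segment_compact.
exact: continuous_subspaceT.
Qed.

Lemma imeanD (f g : R -> R) : continuous f -> continuous g ->
  imean (fun x => f x + g x) = imean f + imean g.
Proof.
move=> cf cg; rewrite /imean -mulrDr; congr (_ * _).
by apply: RintegralD => //; exact: integrable_itv.
Qed.

Lemma imeanZ (c : R) (f : R -> R) : continuous f ->
  imean (fun x => c * f x) = c * imean f.
Proof.
move=> cf; rewrite /imean mulrCA; congr (_ * _).
by apply: RintegralZl => //; exact: integrable_itv.
Qed.

Let FTC (f F : R -> R) : continuous f -> (forall x : R, is_derive x (1 : R) F (f x)) ->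
  imean f = (2 * pi)^-1 * (F (2 * pi) - F 0).
Proof.
move=> cf dF; congr (_ * _); rewrite /Rintegral.
have cF x : {for x, continuous F}.
  apply: differentiable_continuous; apply/derivable1_diffP.
  exact: (@ex_derive _ _ _ _ _ _ _ (dF x)).
rewrite (@continuous_FTC2 _ f F)//.
- exact: continuous_subspaceT.
- split.
  + by move=> x _; exact: (@ex_derive _ _ _ _ _ _ _ (dF x)).
  + exact/cvg_at_right_filter/cF.
  + exact/cvg_at_left_filter/cF.
- by move=> x _; rewrite derive1E; exact: (@derive_val _ _ _ _ _ _ _ (dF x)).
Qed.

Lemma sin_2pi_nat (j : nat) : sin (j%:R * (2 * pi)) = 0 :> R.
Proof.
by rewrite !mulr_natl -[_ *+ j]add0r (periodicn (@sinD2pi R)) sin0.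
Qed.

Lemma cos_2pi_nat (j : nat) : cos (j%:R * (2 * pi)) = 1 :> R.
Proof.
by rewrite !mulr_natl -[_ *+ j]add0r (periodicn (@cosD2pi R)) cos0.
Qed.

Lemma imean_cos (j : nat) : imean (fun x => cos (j%:R * x)) = (j == 0%N)%:R.
Proof.
case: j => [|j].
  transitivity ((2 * pi)^-1 * (2 * pi - 0 : R)); last first.
    by rewrite /= subr0 mulVf// gt_eqF.
  apply: (@FTC _ idfun); first exact: continuous_cosM.
  by move=> x; rewrite mul0r cos0; exact: is_derive_id.
pose F (x : R) := j.+1%:R^-1 * sin (j.+1%:R * x).
transitivity ((2 * pi)^-1 * (F (2 * pi) - F 0)); last first.
  by rewrite /F sin_2pi_nat !mulr0 sin0 mulr0 subrr mulr0.
apply: FTC; first exact: continuous_cosM.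
have : (j.+1%:R : R) != 0 by rewrite pnatr_eq0.
rewrite /F; move: (j.+1%:R : R) => c c0 x; apply: is_derive_eq.
by rewrite /GRing.scale /= mulr1; field.
Qed.

Lemma imean_sin (j : nat) : imean (fun x => sin (j%:R * x)) = 0.
Proof.
case: j => [|j].
  transitivity ((2 * pi)^-1 * (0 - 0 : R)); last by rewrite subrr mulr0.
  apply: (@FTC _ (cst 0)); first exact: continuous_sinM.
  by move=> x; rewrite mul0r sin0; exact: is_derive_cst.
pose F (x : R) := - (j.+1%:R^-1 * cos (j.+1%:R * x)).
transitivity ((2 * pi)^-1 * (F (2 * pi) - F 0)); last first.
  by rewrite /F cos_2pi_nat mulr0 cos0 subrr mulr0.
apply: FTC; first exact: continuous_sinM.
have : (j.+1%:R : R) != 0 by rewrite pnatr_eq0.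
rewrite /F; move: (j.+1%:R : R) => c c0 x; apply: is_derive_eq.
by rewrite /GRing.scale /= mulr1; field.
Qed.

(** Telescoping as for the Dirichlet kernel: 2 cos (k a) sin (a / 2) is sin (k a + a / 2) - sin (k a
    - a / 2). *)
Let sum_cos (a : R) (n : nat) : (\sum_(k < n) cos (k%:R * a)) * (2 * sin (a / 2)) =
  sin (n%:R * a - a / 2) + sin (a / 2).
Proof.
elim: n => [|n IH]; first by rewrite big_ord0 !mul0r sub0r sinN addNr.
rewrite big_ord_recr/= mulrDl IH -[n.+1%:R]natr1.
have -> : (n%:R + 1) * a - a / 2 = n%:R * a + a / 2 by field.
by rewrite sinB sinD; ring.
Qed.

Let sum_sin (a : R) (n : nat) : (\sum_(k < n) sin (k%:R * a)) * (2 * sin (a / 2)) =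
  cos (a / 2) - cos (n%:R * a - a / 2).
Proof.
elim: n => [|n IH]; first by rewrite big_ord0 !mul0r sub0r cosN subrr.
rewrite big_ord_recr/= mulrDl IH -[n.+1%:R]natr1.
have -> : (n%:R + 1) * a - a / 2 = n%:R * a + a / 2 by field.
by rewrite cosB cosD; ring.
Qed.

Let dangle (N j k : nat) : j%:R * dpoint N k = k%:R * (j%:R * (2 * pi) / N%:R) :> R.
Proof. by rewrite /dpoint; ring. Qed.

(** The angle is pi j / N, strictly between 0 and pi. This is where the frequency has to stay below
    the number of nodes. *)
Let sin_half_neq0 (N j : nat) : (0 < j < N)%N ->
  2 * sin (j%:R * (2 * pi) / N%:R / 2) != 0 :> R.
Proof.
move=> /andP[j0 jN]; rewrite mulf_neq0 ?pnatr_eq0// gt_eqF// sin_gt0_pi//.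
have N0 : (0 : R) < N%:R by rewrite ltr0n (ltn_trans j0).
have -> : j%:R * (2 * pi) / N%:R / 2 = pi * (j%:R / N%:R) :> R.
  by field; rewrite gt_eqF.
apply/andP; split; first by rewrite mulr_gt0 ?pi_gt0// divr_gt0// ltr0n.
by rewrite gtr_pMr ?pi_gt0// ltr_pdivrMr// mul1r ltr_nat.
Qed.

Lemma dmean_cos (N j : nat) : (j < N)%N ->
  dmean N (fun x => cos (j%:R * x)) = (j == 0%N)%:R.
Proof.
move=> jN; have N0 : (N%:R : R) != 0 by rewrite pnatr_eq0 -lt0n (leq_ltn_trans _ jN).
rewrite /dmean; under eq_bigr do rewrite dangle.
case: (posnP j) => [->|j0].
  under eq_bigr do rewrite !mul0r mulr0 cos0.
  by rewrite sumr_const card_ord mulVf.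
have h := @sin_half_neq0 N j; rewrite j0 jN in h; have {}h := h isT.
rewrite (_ : \sum_(k < N) _ = 0) ?mulr0//.
apply: (mulIf h); rewrite sum_cos mul0r.
(* After N nodes the angle has made j full turns, so the two ends of the telescoped sum cancel. *)
have -> : N%:R * (j%:R * (2 * pi) / N%:R) = j%:R * (2 * pi) :> R by field.
by rewrite sinB sin_2pi_nat cos_2pi_nat; ring.
Qed.

Lemma dmean_sin (N j : nat) : (j < N)%N -> dmean N (fun x => sin (j%:R * x)) = 0.
Proof.
move=> jN; have N0 : (N%:R : R) != 0 by rewrite pnatr_eq0 -lt0n (leq_ltn_trans _ jN).
rewrite /dmean; under eq_bigr do rewrite dangle.
case: (posnP j) => [->|j0].
  under eq_bigr do rewrite !mul0r mulr0 sin0.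
  by rewrite big1 ?mulr0.
have h := @sin_half_neq0 N j; rewrite j0 jN in h; have {}h := h isT.
rewrite (_ : \sum_(k < N) _ = 0) ?mulr0//.
apply: (mulIf h); rewrite sum_sin mul0r.
have -> : N%:R * (j%:R * (2 * pi) / N%:R) = j%:R * (2 * pi) :> R by field.
by rewrite cosB sin_2pi_nat cos_2pi_nat; ring.
Qed.

Lemma dmeanD (N : nat) (f g : R -> R) :
  dmean N (fun x => f x + g x) = dmean N f + dmean N g.
Proof. by rewrite /dmean big_split/= mulrDr. Qed.

Lemma dmeanZ (N : nat) (c : R) (f : R -> R) :
  dmean N (fun x => c * f x) = c * dmean N f.
Proof. by rewrite /dmean -mulr_sumr mulrCA. Qed.

(** The difference of the two sides is the variance of f over the nodes. *)
Lemma dmean_sqr_le (N : nat) (f : R -> R) :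
  dmean N f ^+ 2 <= dmean N (fun x => f x ^+ 2).
Proof.
case: N => [|N]; first by rewrite /dmean !big_ord0 !mulr0 expr0n.
have N0 : (N.+1%:R : R) != 0 by rewrite pnatr_eq0.
have H : 0 <= dmean N.+1 (fun x => (f x - dmean N.+1 f) ^+ 2).
  by rewrite mulr_ge0// sumr_ge0// => k _; rewrite sqr_ge0.
have := H; rewrite (_ : dmean _ _ = dmean N.+1 (fun x => f x ^+ 2) -
  dmean N.+1 f ^+ 2) ?subr_ge0//.
have cst_mean (c : R) : dmean N.+1 (fun=> c) = c.
  by rewrite /dmean sumr_const card_ord -[c *+ _]mulr_natl mulKf.
set M := dmean N.+1 f.
rewrite (_ : (fun x => _) = (fun x => (f x ^+ 2 + (- (2 * M)) * f x) + M ^+ 2)).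
  by rewrite !dmeanD dmeanZ -/M !cst_mean; ring.
by apply/funext => x; ring.
Qed.

Lemma dpoint_itv (N k : nat) : (k < N)%N ->
  0 <= (dpoint N k : R) <= 2 * pi.
Proof.
move=> kN; have N0 : (0 : R) < N%:R by rewrite ltr0n (leq_ltn_trans _ kN).
rewrite /dpoint -mulrA mulr_ge0 ?divr_ge0 ?(ltW pi2) ?ler0n//=.
by rewrite ler_piMr ?(ltW pi2)// ler_pdivrMr// mul1r ler_nat ltnW.
Qed.

End Means.

(** Positive and negative part are measurable in the parameter by Tonelli, and so are their
    difference and its [fine] part, whether finite or not. *)
Lemma measurable_Rintegral_param {R : realType} {d : measure_display}
    {S : measurableType d} (f : R * S -> R) : measurable_fun setT f ->
  measurable_fun setT (fun s => \int[@lebesgue_measure R]_x f (x, s)).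
Proof.
move=> mf; apply: measurableT_comp; first exact: fine_measurable.
have mfE : measurable_fun setT (EFin \o f) by exact/measurable_EFinP.
under eq_fun do rewrite integralE.
apply: emeasurable_funB.
- have := @measurable_fun_fubini_tonelli_G _ _ _ _ _ (@lebesgue_measure R)
    (EFin \o f)^\+%E (measurable_funepos mfE) (fun x => funepos_ge0 _ x).
  rewrite /fubini_G; congr measurable_fun; apply/funext => s.
  by apply: eq_integral => x _; rewrite !funeposE.
- have := @measurable_fun_fubini_tonelli_G _ _ _ _ _ (@lebesgue_measure R)
    (EFin \o f)^\-%E (measurable_funeneg mfE) (fun x => funeneg_ge0 _ x).
  rewrite /fubini_G; congr measurable_fun; apply/funext => s.
  by apply: eq_integral => x _; rewrite !funenegE.
Qed.

(** * Norm bounds for means of a random function on [0, 2 pi] *)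

Section MeanBounds.
Context {R : realType} {d : measure_display} {Omega : measurableType d}.
Variable P : probability Omega R.
Local Notation mu := (@lebesgue_measure R).

Lemma sqint_bound (X : Omega -> R) (K : R) : measurable_fun setT X ->
  (\int[P]_w (X w ^+ 2)%:E <= K%:E)%E -> sqint P X /\ ip P X X <= K.
Proof.
move=> mX XK.
have sX : sqint P X.
  split=> //; apply/integrableP; split.
    by apply/measurable_EFinP; exact: measurable_funX.
  under eq_integral do rewrite gee0_abs ?lee_fin ?sqr_ge0//.
  exact: le_lt_trans XK (ltry _).
by split=> //; rewrite -lee_fin EFin_ip.
Qed.

Variables (u : R -> Omega -> R) (c : R -> R) (K : R).
Hypothesis su : forall x, 0 <= x <= 2 * pi -> sqint P (u x).
Hypothesis uK : forall x, 0 <= x <= 2 * pi -> ip P (u x) (u x) <= K.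
Hypothesis c1 : forall x, `|c x| <= 1.

Let uc_le x w : (u x w * c x) ^+ 2 <= u x w ^+ 2.
Proof.
rewrite exprMn -[leRHS]mulr1; apply: ler_wpM2l; first exact: sqr_ge0.
by rewrite -real_normK ?num_real// exprn_ile1.
Qed.

Lemma dmean_bound (N : nat) : (0 < N)%N ->
  sqint P (fun w => dmean N (fun x => u x w * c x)) /\
  ip P (fun w => dmean N (fun x => u x w * c x))
       (fun w => dmean N (fun x => u x w * c x)) <= K.
Proof.
move=> N0; have N0' : (N%:R : R) != 0 by rewrite pnatr_eq0 -lt0n.
have sY (k : 'I_N) : sqint P (u (dpoint N k)) by apply: su; exact: dpoint_itv.
have sX : sqint P (fun w => dmean N (fun x => u x w * c x)).
  rewrite /dmean; apply: sqintZ; apply: sqint_sum => k _.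
  by under eq_fun do rewrite mulrC; apply: sqintZ.
split=> //; rewrite -lee_fin EFin_ip//.
have iY (k : 'I_N) : P.-integrable setT
    (fun w => (N%:R^-1)%:E * (u (dpoint N k) w ^+ 2)%:E)%E.
  by apply: integrableZl => //; case: (sY k).
apply: (@le_trans _ _ (\int[P]_w (\sum_(k < N)
    (N%:R^-1)%:E * (u (dpoint N k) w ^+ 2)%:E))%E).
  apply: ge0_le_integral => //.
  - by move=> w _; rewrite lee_fin sqr_ge0.
  - by apply/measurable_EFinP/measurable_funX; exact: (sqint_measurable sX).
  - by apply: emeasurable_sum => k _; exact: (measurable_int P (iY k)).
  - move=> w _; under eq_bigr do rewrite -EFinM.
    rewrite sumEFin lee_fin -mulr_sumr; apply: le_trans (dmean_sqr_le _ _) _.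
    by rewrite ler_wpM2l ?invr_ge0//; apply: ler_sum => k _.
rewrite integral_sum//.
have -> : (K%:E = \sum_(k < N) (N%:R^-1 * K)%:E)%E.
  by rewrite sumEFin sumr_const card_ord -[_ *+ N]mulr_natl mulVKf.
apply: lee_sum => k _; rewrite integralZl//; last by case: (sY k).
rewrite -EFin_ip// -EFinM lee_fin ler_wpM2l ?invr_ge0//.
by apply: uK; exact: dpoint_itv.
Qed.

Hypothesis mu2 : measurable_fun setT (fun p : R * Omega => u p.1 p.2).
Hypothesis mc : measurable_fun setT c.

Let I : set R := [set` `[0, 2 * pi]].
Let pi2 : 0 < 2 * pi :> R. Proof. by rewrite mulr_gt0 ?pi_gt0. Qed.
Let mI : measurable I. Proof. exact: measurable_itv. Qed.
Let muI : mu I = (2 * pi)%:E.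
Proof. by rewrite lebesgue_measure_itv/= lte_fin pi2 sube0. Qed.

(** The integrand cut off outside [0, 2 pi], so that Tonelli applies to a function on the full
    product space. *)
Let v (p : R * Omega) : R := u p.1 p.2 * c p.1 * \1_I p.1.

Let mv : measurable_fun setT v.
Proof.
apply: measurable_funM; first apply: measurable_funM => //.
- by apply: measurableT_comp => //; exact: measurable_fst.
- apply: (measurableT_comp (measurable_indic _)) => //; exact: measurable_fst.
Qed.

Let mv2 : measurable_fun setT (fun p => (v p ^+ 2)%:E).
Proof. by apply/measurable_EFinP; exact: measurable_funX. Qed.

Let int_v w : \int[mu]_x v (x, w) = \int[mu]_(x in I) (u x w * c x).
Proof.
rewrite [RHS]Rintegral_mkcond; apply: eq_Rintegral => x _.
by rewrite /v /= patchE indicE; case: ifP; rewrite ?mulr1 ?mulr0.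
Qed.

Let v2_int : (\int[P]_w \int[mu]_x (v (x, w) ^+ 2)%:E <= (2 * pi * K)%:E)%E.
Proof.
rewrite -(@fubini_tonelli _ _ _ _ _ mu P (fun p => (v p ^+ 2)%:E))//; last first.
  by move=> p; rewrite lee_fin sqr_ge0.
apply: (@le_trans _ _ (\int[mu]_(x in I) K%:E)%E); last first.
  by rewrite integral_cst//= muI -EFinM mulrC.
rewrite [leRHS]integral_mkcond; apply: ge0_le_integral => //.
- by move=> x _; apply: integral_ge0 => w _; rewrite lee_fin sqr_ge0.
- apply: (@measurable_fun_fubini_tonelli_F _ _ _ _ _ P (fun p => (v p ^+ 2)%:E)) => //.
  by move=> p; rewrite lee_fin sqr_ge0.
- apply: (iffLR (measurable_restrictT (fun=> K%:E) mI)).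
  exact: (@measurable_cst _ _ _ _ I K%:E).
move=> x _; rewrite patchE; case: ifPn => [/set_mem Ix|nIx]; last first.
  rewrite integral0_eq// => w _.
  by rewrite /v /= indicE (negbTE nIx) mulr0 expr0n.
have x02 : 0 <= x <= 2 * pi by move: Ix; rewrite /I /= in_itv.
apply: (@le_trans _ _ (ip P (u x) (u x))%:E); last by rewrite lee_fin uK.
rewrite EFin_ip; last exact: su.
apply: ge0_le_integral => //.
- by move=> w _; rewrite lee_fin sqr_ge0.
- exact: (measurableT_comp mv2 (pair1_measurable x)).
- by have [_ /(measurable_int P)] := su x02.
- move=> w _; rewrite lee_fin /v /= indicE (mem_set Ix) mulr1; exact: uc_le.
Qed.

Let v2_ge0 w : (0 <= \int[mu]_x (v (x, w) ^+ 2)%:E)%E.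
Proof. by apply: integral_ge0 => x _; rewrite lee_fin sqr_ge0. Qed.

Let v2_ae : {ae P, forall w, (\int[mu]_x (v (x, w) ^+ 2)%:E < +oo)%E}.
Proof.
have i : P.-integrable setT (fun w => \int[mu]_x (v (x, w) ^+ 2)%:E)%E.
  apply/integrableP; split.
    apply: (@measurable_fun_fubini_tonelli_G _ _ _ _ _ mu (fun p => (v p ^+ 2)%:E)) => //.
    by move=> p; rewrite lee_fin sqr_ge0.
  apply: le_lt_trans (ltry (2 * pi * K)); apply: le_trans v2_int.
  by under eq_integral do rewrite gee0_abs//.
have := integrable_ae measurableT i; apply: filterS => w /(_ Logic.I).
by rewrite ge0_fin_numE// integral_ge0// => x _; rewrite lee_fin sqr_ge0.
Qed.

(** Cauchy-Schwarz on a single path, available as soon as the square of the path is integrable,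
    which [v2_ae] provides almost surely. *)
Let v_sect w : (\int[mu]_x (v (x, w) ^+ 2)%:E < +oo)%E ->
  mu.-integrable setT (fun x => (v (x, w))%:E) /\
  ((((2 * pi)^-1 * \int[mu]_x v (x, w))%R ^+ 2)%:E <=
    ((2 * pi)^-1)%:E * \int[mu]_x (v (x, w) ^+ 2)%:E)%E.
Proof.
move=> vfin.
have mvw : measurable_fun setT (fun x => v (x, w)).
  exact: (measurableT_comp mv (pair2_measurable w)).
have i2 : mu.-integrable setT (fun x => (v (x, w) ^+ 2)%:E).
  apply/integrableP; split; first by apply/measurable_EFinP; exact: measurable_funX.
  by under eq_integral do rewrite gee0_abs ?lee_fin ?sqr_ge0//.
have iI : mu.-integrable setT (fun x => (\1_I x)%:E) by exact: integrable_indic_itv.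
have iv : mu.-integrable setT (fun x => (v (x, w))%:E).
  apply: (le_integrable measurableT _ _ (integrableD measurableT i2 iI)).
    exact/measurable_EFinP.
  move=> x _ /=; rewrite lee_fin [leRHS]ger0_norm ?addr_ge0 ?sqr_ge0//.
  rewrite indicE; have [xI|xI] := boolP (x \in I); last first.
    by rewrite /v /= indicE (negbTE xI) mulr0 normr0 addr_ge0 ?sqr_ge0.
  move: (v (x, w)) => r; rewrite (_ : true%:R = 1 :> R)// ler_norml.
  by apply/andP; split; nra.
split=> //.
pose a := \int[mu]_x v (x, w); pose b := \int[mu]_x (v (x, w) ^+ 2).
(* The mean of the path; the inequality comes from integrating the square of v - e over
   [0, 2 pi]. *)
pose e := a / (2 * pi).
have bE : (\int[mu]_x (v (x, w) ^+ 2)%:E = b%:E)%E.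
  by rewrite /b /Rintegral fineK//; exact: integrable_fin_num.
have IE : \int[mu]_x (\1_I x) = 2 * pi.
  by rewrite /Rintegral integral_indic//= setIT muI.
have i3 : mu.-integrable setT (fun x => (e ^+ 2 * \1_I x)%:E).
  by under eq_fun do rewrite EFinM; exact: integrableZl.
have i4 : mu.-integrable setT (fun x => (2 * e * v (x, w))%:E).
  by under eq_fun do rewrite EFinM; exact: integrableZl.
have i5 : mu.-integrable setT (fun x => (v (x, w) ^+ 2 + e ^+ 2 * \1_I x)%:E).
  by under eq_fun do rewrite EFinD; exact: integrableD.
have : 0 <= \int[mu]_x ((v (x, w) ^+ 2 + e ^+ 2 * \1_I x) - 2 * e * v (x, w)).
  apply: Rintegral_ge0 => x _.
  rewrite indicE; have [xI|xI] := boolP (x \in I); last first.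
    by rewrite /v /= indicE (negbTE xI) !mulr0 expr0n addr0 subr0.
  rewrite (_ : true%:R = 1 :> R)// mulr1.
  by have := sqr_ge0 (v (x, w) - e); nra.
rewrite (RintegralB measurableT i5 i4) (RintegralD measurableT i2 i3).
rewrite (RintegralZl _ measurableT iI) (RintegralZl _ measurableT iv) IE -/a -/b.
rewrite bE -EFinM lee_fin.
have -> : b + e ^+ 2 * (2 * pi) - 2 * e * a =
    (2 * pi) * ((2 * pi)^-1 * b - ((2 * pi)^-1 * a) ^+ 2).
  rewrite /e; have : 2 * pi != 0 :> R by rewrite gt_eqF.
  by move: (2 * pi : R) (a) (b) => q a' b' q0; field.
by rewrite pmulr_rge0// subr_ge0.
Qed.

(** The almost sure integrability of the paths is part of the conclusion because [imean] is additive
    only on integrable functions; [l2cvg_imean] relies on it. *)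
Lemma imean_bound :
  [/\ {ae P, forall w, mu.-integrable I (fun x => (u x w * c x)%:E)},
      sqint P (fun w => imean (fun x => u x w * c x)) &
      ip P (fun w => imean (fun x => u x w * c x))
           (fun w => imean (fun x => u x w * c x)) <= K].
Proof.
have mX : measurable_fun setT (fun w => imean (fun x => u x w * c x)).
  rewrite /imean; apply: measurable_funM => //.
  under eq_fun do rewrite -int_v; exact: measurable_Rintegral_param.
have ae1 : {ae P, forall w, mu.-integrable I (fun x => (u x w * c x)%:E)}.
  move: v2_ae; apply: filterS => w /v_sect[iv _].
  apply: (iffRL (@integrable_mkcond _ _ _ mu I (fun x => (u x w * c x)%:E) mI)).
  move: iv; congr (integrable mu setT _).
  apply/funext => x; rewrite patchE /v /= indicE.
  by case: ifP; rewrite ?mulr1 ?mulr0.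
have [sX XK] : sqint P (fun w => imean (fun x => u x w * c x)) /\
    ip P (fun w => imean (fun x => u x w * c x))
         (fun w => imean (fun x => u x w * c x)) <= K.
  apply: sqint_bound => //.
  have pi0 : (0 <= (2 * pi)^-1 :> R) by rewrite invr_ge0 ltW.
  have m2 : measurable_fun setT (fun w => \int[mu]_x (v (x, w) ^+ 2)%:E)%E.
    apply: (@measurable_fun_fubini_tonelli_G _ _ _ _ _ mu (fun p => (v p ^+ 2)%:E)) => //.
    by move=> p; rewrite lee_fin sqr_ge0.
  apply: (@le_trans _ _ (\int[P]_w (((2 * pi)^-1)%:E *
      \int[mu]_x (v (x, w) ^+ 2)%:E))%E).
    apply: ae_ge0_le_integral => //.
    - by move=> w _; rewrite lee_fin sqr_ge0.
    - by apply/measurable_EFinP; exact: measurable_funX.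
    - by move=> w _; rewrite mule_ge0.
    - exact: measurable_funeM.
    - move: v2_ae; apply: filterS => w /v_sect[_ h] _.
      by move: h; rewrite int_v.
  rewrite ge0_integralZl//.
  apply: le_trans (lee_wpmul2l _ v2_int) _; first by rewrite lee_fin.
  by rewrite -EFinM lee_fin mulKf// gt_eqF.
by split.
Qed.

End MeanBounds.

Lemma ip_orthogonal_sum {R : realType} {d : measure_display}
    {Omega : measurableType d} (P : probability Omega R) (I : eqType) (s : seq I)
    (F : I -> Omega -> R) :
  uniq s -> (forall i, i \in s -> sqint P (F i)) ->
  (forall i j, i \in s -> j \in s -> i != j -> ip P (F i) (F j) = 0) ->
  ip P (fun w => \sum_(i <- s) F i w) (fun w => \sum_(i <- s) F i w) =
  \sum_(i <- s) ip P (F i) (F i).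
Proof.
elim: s => [|i s IH] /=.
  by rewrite !big_nil; under eq_fun do rewrite big_nil; move=> *; exact: ip0l.
move=> /andP[iNs us] sF oF.
have sFi : sqint P (F i) by apply: sF; rewrite mem_head.
have sFs j : j \in s -> sqint P (F j) by move=> js; apply: sF; rewrite in_cons js orbT.
have sS : sqint P (fun w => \sum_(j <- s) F j w).
  under eq_fun do rewrite big_seq; exact: sqint_sum.
have X0 : ip P (fun w => \sum_(j <- s) F j w) (F i) = 0.
  under eq_fun do rewrite big_seq.
  rewrite (ip_suml _ sFs sFi) big1// => j js; apply: oF.
  - by rewrite in_cons js orbT.
  - exact: mem_head.
  - by apply: contraNneq iNs => <-.
under eq_fun do rewrite big_cons.
have sA := sqintD sFi sS.
have E1 : ip P (F i) (fun w => F i w + \sum_(j <- s) F j w) = ip P (F i) (F i).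
  by rewrite ipC (ipDl sFi sS sFi) X0 addr0.
have E2 : ip P (fun w => \sum_(j <- s) F j w) (fun w => F i w + \sum_(j <- s) F j w) =
    ip P (fun w => \sum_(j <- s) F j w) (fun w => \sum_(j <- s) F j w).
  by rewrite ipC (ipDl sFi sS sS) [ip P (F i) _]ipC X0 add0r.
rewrite (ipDl sFi sS sA) big_cons E1 E2 IH//.
by move=> j k js ks; apply: oF; rewrite in_cons ?js ?ks orbT.
Qed.

Lemma ip_bilinear {R : realType} {d : measure_display}
    {Omega : measurableType d} (P : probability Omega R)
    (X1 X2 Y1 Y2 : Omega -> R) (c c' x1 x2 y1 y2 : R) :
  sqint P X1 -> sqint P X2 -> sqint P Y1 -> sqint P Y2 ->
  ip P (fun w => c * (x1 * X1 w + x2 * X2 w))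
       (fun w => c' * (y1 * Y1 w + y2 * Y2 w)) =
  c * c' * (x1 * y1 * ip P X1 Y1 + x1 * y2 * ip P X1 Y2 +
            x2 * y1 * ip P X2 Y1 + x2 * y2 * ip P X2 Y2).
Proof.
move=> sX1 sX2 sY1 sY2.
have lin Z1 Z2 Z (z1 z2 : R) : sqint P Z1 -> sqint P Z2 -> sqint P Z ->
    ip P (fun w => z1 * Z1 w + z2 * Z2 w) Z = z1 * ip P Z1 Z + z2 * ip P Z2 Z.
  move=> s1 s2 sZ; rewrite (ipDl (sqintZ z1 s1) (sqintZ z2 s2) sZ).
  by rewrite (ipZl z1 s1 sZ) (ipZl z2 s2 sZ).
pose U w := x1 * X1 w + x2 * X2 w; pose V w := y1 * Y1 w + y2 * Y2 w.
have sU : sqint P U by apply: sqintD; exact: sqintZ.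
have sV : sqint P V by apply: sqintD; exact: sqintZ.
transitivity (c * c' * ip P U V).
  by rewrite (ipZl c sU (sqintZ c' sV)) ipC (ipZl c' sV sU) [ip P V U]ipC mulrA.
congr (_ * _); rewrite (lin _ _ _ _ _ sX1 sX2 sV).
rewrite [ip P X1 V]ipC [ip P X2 V]ipC (lin _ _ _ _ _ sY1 sY2 sX1).
rewrite (lin _ _ _ _ _ sY1 sY2 sX2) [ip P Y1 X1]ipC [ip P Y2 X1]ipC.
by rewrite [ip P Y1 X2]ipC [ip P Y2 X2]ipC; ring.
Qed.

Lemma big_int_symmetric {R : realType} (l : nat) (F : int -> R[i]) :
  \sum_(j < (2 * l).+1) F (j%:Z - l%:Z) =
  F 0 + \sum_(k < l) (F (Posz k.+1) + F (Negz k)).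
Proof.
have -> : (2 * l).+1 = (l + l.+1)%N by rewrite addnS mul2n addnn.
rewrite big_split_ord/= big_split/= addrA [RHS]addrC; congr (_ + _).
  (* Reversal matches the negative orders with -(k + 1), in the sequence of the positive ones. *)
  rewrite (reindex_inj rev_ord_inj)/=; apply: eq_bigr => k _; congr F.
  by rewrite NegzE -subzn ?ltn_ord// addrAC subrr add0r.
rewrite big_ord_recl/=; congr (_ + _); last apply: eq_bigr => k _; congr F.
  by rewrite addn0 subrr.
by rewrite /bump/= PoszD addrC addKr.
Qed.

(** * Second moments of the coefficients and of the partial sums *)

Section Coefficients.
Context {R : realType} {d : measure_display} {Omega : measurableType d}.
Variables (P : probability Omega R) (C : nat -> R).
Variable a : nat -> int -> Omega -> R[i].
Hypothesis C0 : forall l, 0 <= C l.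
Hypothesis coefP : harmonic_coefficients P C a.

Let A l m w : R := complex.Re (a l (Posz m) w).
Let B l m w : R := complex.Im (a l (Posz m) w).

Let measurable_coef l m : (m <= l)%N ->
  measurable_fun setT (fun w => cpair (a l (Posz m) w)).
Proof. by move=> ml; apply: (coef_measurable coefP); rewrite /= lez_nat. Qed.

Let mA l m : (m <= l)%N -> measurable_fun setT (A l m).
Proof. by move=> ml; exact: (measurableT_comp measurable_fst (measurable_coef ml)). Qed.

Let mB l m : (m <= l)%N -> measurable_fun setT (B l m).
Proof. by move=> ml; exact: (measurableT_comp measurable_snd (measurable_coef ml)). Qed.

(** Dividing by [harm_weight] covers both variances: C_l for order 0 and C_l / 2 for positive
    orders. *)
Lemma coef_re_moments l m : (m <= l)%N ->
  [/\ sqint P (A l m), \int[P]_w A l m w = 0 &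
      ip P (A l m) (A l m) = C l / harm_weight m].
Proof.
move=> ml.
have nA : has_normal_law P (A l m) 0 (C l / harm_weight m).
  rewrite /harm_weight; case: posnP => [m0|m0].
    by rewrite m0 divr1; have [_] := coef_zero coefP l.
  by have [] := coef_pos coefP (l := l) (m := m) (introT andP (conj m0 ml)).
have v0 : 0 <= C l / harm_weight m.
  by rewrite divr_ge0// /harm_weight; case: ifP.
have [sA EA VA] := normal_law_moments v0 nA; split=> //.
by move: VA; under eq_fun do rewrite subr0.
Qed.

Lemma coef_im_moments l m : (m <= l)%N ->
  [/\ sqint P (B l m), \int[P]_w B l m w = 0 &
      ip P (B l m) (B l m) = (m != 0%N)%:R * (C l / harm_weight m)].
Proof.
move=> ml; have [m0|m0] := posnP m.
  have [aeB _] := coef_zero coefP l.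
  have nB : has_normal_law P (B l m) 0 0.
    by apply/has_normal_law0; split; [exact: mB|rewrite /B m0].
  have [sB EB VB] := normal_law_moments (lexx 0) nB; split=> //.
  by rewrite m0 /= mul0r -VB m0; under [in RHS]eq_fun do rewrite subr0.
have [_ _ nB] := coef_pos coefP (l := l) (m := m) (introT andP (conj m0 ml)).
have v0 : 0 <= C l / 2 by rewrite divr_ge0.
have [sB EB VB] := normal_law_moments v0 nB; split=> //.
rewrite /= mul1r /harm_weight gtn_eqF// -VB.
by under [in RHS]eq_fun do rewrite subr0.
Qed.

Lemma coef_re_im l m : (m <= l)%N -> ip P (A l m) (B l m) = 0.
Proof.
move=> ml; have [sA EA _] := coef_re_moments ml; have [sB EB VB] := coef_im_moments ml.
have [m0|m0] := posnP m.
  (* For order 0 the imaginary part has norm 0, so Cauchy-Schwarz replaces independence. *)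
  have := ip_cauchy_schwarz sA sB; rewrite VB m0/= mul0r mulr0 => h.
  by apply/eqP; rewrite -sqrf_eq0 eq_le h sqr_ge0.
have [iAB _ _] := coef_pos coefP (l := l) (m := m) (introT andP (conj m0 ml)).
by rewrite (independent_ip iAB sA sB) EA mul0r.
Qed.

(** Mutual independence applied to a list of two indices. Taking the projections for p and q gives
    all pairs of real and imaginary parts. *)
Lemma coef_cross_independent (p q : R * R -> R) l m l' m' :
  measurable_fun setT p -> measurable_fun setT q ->
  (m <= l)%N -> (m' <= l')%N -> (l, m) != (l', m') ->
  independent_rv P (fun w => p (cpair (a l (Posz m) w)))
    (fun w => q (cpair (a l' (Posz m') w))).
Proof.
move=> mp mq ml ml' neq U V mU mV.
pose F (i : nat * nat) := if i == (l, m) then p @^-1` U else q @^-1` V.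
have mF i : measurable (F i).
  rewrite /F; case: ifP => _; rewrite -[S in measurable S]setTI.
    exact: mp.
  exact: mq.
have us : uniq [:: (l, m); (l', m')] by rewrite /= inE neq.
have := coef_independent coefP us _ mF.
rewrite !big_cons big_nil mule1 /F eqxx [_ == (l, m)]eq_sym (negbTE neq) => <-.
- congr (P _); apply/seteqP; split=> w /=.
    move=> [hU hV] i; rewrite !inE => /orP[/eqP ->|/eqP ->]; first by rewrite eqxx.
    by rewrite eq_sym (negbTE neq).
  move=> h; split.
    by have := h (l, m); rewrite mem_head eqxx; apply.
  by have := h (l', m'); rewrite !inE eqxx orbT eq_sym (negbTE neq); apply.
- by move=> i; rewrite !inE => /orP[/eqP ->|/eqP ->].
Qed.

Lemma coef_cross l m l' m' : (m <= l)%N -> (m' <= l')%N -> (l, m) != (l', m') ->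
  [/\ ip P (A l m) (A l' m') = 0, ip P (A l m) (B l' m') = 0,
      ip P (B l m) (A l' m') = 0 & ip P (B l m) (B l' m') = 0].
Proof.
move=> ml ml' neq.
have [sA EA _] := coef_re_moments ml; have [sB EB _] := coef_im_moments ml.
have [sA' EA' _] := coef_re_moments ml'; have [sB' EB' _] := coef_im_moments ml'.
have m1 : measurable_fun setT (@fst R R) by exact: measurable_fst.
have m2 : measurable_fun setT (@snd R R) by exact: measurable_snd.
split.
- by rewrite (independent_ip (coef_cross_independent m1 m1 ml ml' neq) sA sA') EA mul0r.
- by rewrite (independent_ip (coef_cross_independent m1 m2 ml ml' neq) sA sB') EA mul0r.
- by rewrite (independent_ip (coef_cross_independent m2 m1 ml ml' neq) sB sA') EB mul0r.
- by rewrite (independent_ip (coef_cross_independent m2 m2 ml ml' neq) sB sB') EB mul0r.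
Qed.

(** The real form of [partial_sum], in terms of nonnegative orders. The two agree only almost
    surely, as do the symmetry relations of the coefficients. *)
Definition coef_sum (theta : R) (n : nat) (phi : R) (w : Omega) : R :=
  harm_sum (fun l k => Llm l (Posz k) (cos theta)) (fun l k => A l k w)
    (fun l k => B l k w) n phi.

Let term (theta phi : R) (p : nat * nat) (w : Omega) : R :=
  harm_term (Llm p.1 (Posz p.2) (cos theta)) (A p.1 p.2 w) (B p.1 p.2 w) p.2 phi.

Let termE theta phi p : term theta phi p = fun w =>
  harm_weight p.2 * Llm p.1 (Posz p.2) (cos theta) *
  (cos (p.2%:R * phi) * A p.1 p.2 w + - sin (p.2%:R * phi) * B p.1 p.2 w).
Proof. by apply/funext => w; rewrite /term /harm_term; ring. Qed.

Let sqint_term theta phi p : (p.2 <= p.1)%N -> sqint P (term theta phi p).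
Proof.
move=> pp; have [sA _ _] := coef_re_moments pp; have [sB _ _] := coef_im_moments pp.
by rewrite termE; apply: sqintZ; apply: sqintD; exact: sqintZ.
Qed.

Let pairs (n k : nat) : seq (nat * nat) :=
  [seq (l, j) | l <- index_iota n k, j <- index_iota 0 l.+1].

Let mem_pairs n k p : p \in pairs n k -> (p.2 <= p.1)%N.
Proof.
by move=> /allpairsPdep[l [j [_ + ->]]]; rewrite mem_index_iota /= ltnS.
Qed.

Let pairs_uniq n k : uniq (pairs n k).
Proof.
apply: allpairs_uniq_dep; first exact: iota_uniq.
- by move=> l _; exact: iota_uniq.
- by move=> [l j] [l' j'] _ _ /= [-> ->].
Qed.

Let coef_sumE theta n k phi w :
  (n <= k)%N -> coef_sum theta k phi w - coef_sum theta n phi w =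
  \sum_(p <- pairs n k) term theta phi p w.
Proof.
move=> nk; rewrite /pairs big_allpairs_dep /coef_sum /harm_sum.
pose F l := \sum_(j <- index_iota 0 l.+1) term theta phi (l, j) w.
have E i : \sum_(l < i) \sum_(j < l.+1) harm_term (Llm l (Posz j) (cos theta))
    (A l j w) (B l j w) j phi = \sum_(0 <= l < i) F l.
  by rewrite big_mkord; apply: eq_bigr => l _; rewrite /F big_mkord.
rewrite !E (big_cat_nat (leq0n n) nk)/= addrAC subrr add0r.
by [].
Qed.

Lemma sqint_coef_sum theta n phi : sqint P (coef_sum theta n phi).
Proof.
have -> : coef_sum theta n phi = fun w => \sum_(p <- pairs 0 n) term theta phi p w.
  apply/funext => w; rewrite -coef_sumE//.
  by rewrite /coef_sum /harm_sum big_ord0 subr0.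
under eq_fun do rewrite big_seq.
by apply: sqint_sum => p /mem_pairs; exact: sqint_term.
Qed.

(** The terms are orthogonal. Within a term of positive order the real and imaginary part are
    uncorrelated with equal variance, so phi enters through cos^2 + sin^2 = 1; terms of order 0 do
    not depend on phi. *)
Lemma coef_sum_diff_norm theta n k phi : (n <= k)%N ->
  ip P (fun w => coef_sum theta k phi w - coef_sum theta n phi w)
       (fun w => coef_sum theta k phi w - coef_sum theta n phi w) =
  ip P (fun w => coef_sum theta k 0 w - coef_sum theta n 0 w)
       (fun w => coef_sum theta k 0 w - coef_sum theta n 0 w).
Proof.
move=> nk.
suff H x : ip P (fun w => coef_sum theta k x w - coef_sum theta n x w)
    (fun w => coef_sum theta k x w - coef_sum theta n x w) =
    \sum_(p <- pairs n k) (harm_weight p.2 * Llm p.1 (Posz p.2) (cos theta)) ^+ 2 *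
      (C p.1 / harm_weight p.2) by rewrite !H.
under eq_fun do rewrite coef_sumE//.
rewrite ip_orthogonal_sum//.
- rewrite !big_seq; apply: eq_bigr => p /mem_pairs pp.
  have [sA _ VA] := coef_re_moments pp; have [sB _ VB] := coef_im_moments pp.
  have AB := coef_re_im pp.
  rewrite termE ip_bilinear// -expr2; congr (_ * _).
  set al := cos _; set be := - sin _.
  rewrite [ip P (B _ _) (A _ _)]ipC AB VA VB.
  have : al ^+ 2 + be ^+ 2 = 1 by rewrite /al /be sqrrN cos2Dsin2.
  move: (C p.1 / harm_weight p.2) => Q al1.
  have [p0|p0] := posnP p.2 => /=.
    have be0 : be = 0 by rewrite /be p0 mul0r sin0 oppr0.
    move: al1; rewrite be0 expr0n/= addr0 => al1.
    by rewrite -expr2 al1; ring.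
  rewrite mul1r; transitivity ((al ^+ 2 + be ^+ 2) * Q); first by ring.
  by rewrite al1 mul1r.
- by move=> p /mem_pairs; exact: sqint_term.
- move=> p p' /mem_pairs pp /mem_pairs pp' neq.
  have [sA _ _] := coef_re_moments pp; have [sB _ _] := coef_im_moments pp.
  have [sA' _ _] := coef_re_moments pp'; have [sB' _ _] := coef_im_moments pp'.
  have neq' : (p.1, p.2) != (p'.1, p'.2) by rewrite -!surjective_pairing.
  have [AA AB BA BB] := coef_cross pp pp' neq'.
  by rewrite !termE ip_bilinear// AA AB BA BB !mulr0 !addr0 mulr0.
Qed.

(** The relations involve countably many coefficients, so one null set serves all n, theta and
    phi. *)
Lemma partial_sum_coef_sum : {ae P, forall w, forall n theta phi,
  partial_sum a n theta phi w = (coef_sum theta n phi w)%:C}.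
Proof.
have ae0 : {ae P, forall w, forall l, complex.Im (a l 0 w) = 0}.
  by apply: ae_foralln => l; have [] := coef_zero coefP l.
have aeN : {ae P, forall w, forall l m, (m < l)%N ->
    a l (Negz m) w = (-1) ^+ m.+1 * conjc (a l (Posz m.+1) w)}.
  apply: ae_foralln => l; apply: ae_foralln => m.
  have [ml|ml] := ltnP m l; last by apply: aeW => w.
  have := @coef_neg _ _ _ _ _ _ coefP l m.+1; rewrite /= ml => /(_ isT).
  by apply: filterS => w h _; rewrite -h.
move: aeN; apply: filterS2 ae0 => w h0 hN n theta phi.
rewrite /partial_sum /coef_sum /harm_sum rmorph_sum/=; apply: eq_bigr => l _.
rewrite (big_int_symmetric l (fun m => a l m w * Ylm l m theta phi)).
rewrite big_ord_recl/= rmorphD/= rmorph_sum/=; congr (_ + _).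
  rewrite /Ynat /harm_term /harm_weight /= /expi !mul0r cos0 sin0.
  move: (h0 l); rewrite /A; case: (a l 0 w) => x y /= ->.
  by apply/eqP; rewrite eq_complex /=; apply/andP; split; apply/eqP; ring.
apply: eq_bigr => k _; rewrite (hN _ _ (ltn_ord k)) /Ynat /harm_term /harm_weight /=.
(* The signs in the negative-order coefficient and in the harmonic cancel, leaving the conjugate of
   the term of order k + 1. *)
rewrite mulrACA -expr2 sqrr_sign mul1r /A /B /expi /bump /= add1n.
case: (a l (Posz k.+1) w) => x y /=.
by apply/eqP; rewrite eq_complex /=; apply/andP; split; apply/eqP; ring.
Qed.

End Coefficients.

(** * Measurability of complex-valued variables *)

Section ComplexMeasurable.
Context {R : realType} {d : measure_display} {Omega : measurableType d}.
Implicit Types f g : Omega -> R[i].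

Definition cmeasurable f :=
  measurable_fun setT (fun w => complex.Re (f w)) /\
  measurable_fun setT (fun w => complex.Im (f w)).

Lemma cmeasurable_sum (I : Type) (r : seq I) (F : I -> Omega -> R[i]) :
  (forall i, cmeasurable (F i)) -> cmeasurable (fun w => \sum_(i <- r) F i w).
Proof.
move=> mF; elim: r => [|i r [IH1 IH2]].
  by split; under eq_fun do rewrite big_nil; exact: measurable_cst.
have [m1 m2] := mF i; split; under eq_fun do rewrite big_cons.
  have -> : (fun w => complex.Re (F i w + \sum_(j <- r) F j w)) =
      (fun w => complex.Re (F i w) + complex.Re (\sum_(j <- r) F j w)).
    by apply/funext => w; case: (F i w) (\sum_(j <- r) F j w) => ? ? [].
  exact: measurable_funD.
have -> : (fun w => complex.Im (F i w + \sum_(j <- r) F j w)) =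
    (fun w => complex.Im (F i w) + complex.Im (\sum_(j <- r) F j w)).
  by apply/funext => w; case: (F i w) (\sum_(j <- r) F j w) => ? ? [].
exact: measurable_funD.
Qed.

Lemma cmeasurableZ f (z : R[i]) : cmeasurable f -> cmeasurable (fun w => f w * z).
Proof.
move=> [m1 m2]; case: z => x y; split.
  have -> : (fun w => complex.Re (f w * (x +i* y))) =
      (fun w => complex.Re (f w) * x - complex.Im (f w) * y).
    by apply/funext => w; case: (f w).
  by apply: measurable_funB; exact: measurable_funM.
have -> : (fun w => complex.Im (f w * (x +i* y))) =
    (fun w => complex.Re (f w) * y + complex.Im (f w) * x).
  by apply/funext => w; case: (f w).
by apply: measurable_funD; exact: measurable_funM.
Qed.

Lemma cpair_cmeasurable f : measurable_fun setT (fun w => cpair (f w)) ->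
  cmeasurable f.
Proof.
move=> mf; split.
  exact: (measurableT_comp measurable_fst mf).
exact: (measurableT_comp measurable_snd mf).
Qed.

End ComplexMeasurable.

(** * Measurability of the sphere and of its coordinates *)

Section Sphere.
Context {R : realType}.

Lemma sphere_spoint (theta phi : R) : sphere (spoint theta phi).
Proof.
rewrite /sphere /spoint /= !exprMn -mulrDr cos2Dsin2 mulr1 addrC.
exact: cos2Dsin2.
Qed.

Lemma measurable_sphere : measurable (@sphere R).
Proof.
have -> : @sphere R =
    setT `&` (fun x : R * R * R => x.1.1 ^+ 2 + x.1.2 ^+ 2 + x.2 ^+ 2) @^-1` [set 1].
  by rewrite setTI; apply/seteqP; split.
have m1 : measurable_fun setT (fun x : R * R * R => x.1.1).
  exact: (measurableT_comp measurable_fst measurable_fst).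
have m2 : measurable_fun setT (fun x : R * R * R => x.1.2).
  exact: (measurableT_comp measurable_snd measurable_fst).
have m3 : measurable_fun setT (fun x : R * R * R => x.2) by exact: measurable_snd.
suff : measurable_fun setT (fun x : R * R * R => x.1.1 ^+ 2 + x.1.2 ^+ 2 + x.2 ^+ 2).
  by apply.
by apply: measurable_funD; [apply: measurable_funD|]; exact: measurable_funX.
Qed.

Lemma measurable_spoint {d : measure_display} {S : measurableType d}
    (th ph : S -> R) : measurable_fun setT th -> measurable_fun setT ph ->
  measurable_fun setT (fun s => spoint (th s) (ph s)).
Proof.
move=> mth mph; rewrite /spoint.
have msin : measurable_fun setT (@sin R).
  exact: continuous_measurable_fun (@continuous_sin R).
have mcos : measurable_fun setT (@cos R).
  exact: continuous_measurable_fun (@continuous_cos R).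
apply: measurable_fun_pair; first apply: measurable_fun_pair.
- by apply: measurable_funM; exact: measurableT_comp.
- by apply: measurable_funM; exact: measurableT_comp.
- exact: measurableT_comp.
Qed.

(** Continuity is used on the open interval; the two end points are added as singletons. *)
Lemma measurable_acos : measurable_fun (@segment11 R) (@acos R).
Proof.
have -> : @segment11 R = `]-1, 1[ `|` ([set -1] `|` [set 1]).
  apply/seteqP; split=> x; rewrite /segment11 /= in_itv/=.
    move=> /andP[]; rewrite le_eqVlt => /predU1P[<- _|x1]; first by right; left.
    rewrite le_eqVlt => /predU1P[->|x2]; first by right; right.
    by left; rewrite x1.
  move=> [/andP[x1 x2]|[->|->]]; first by rewrite !ltW.
    by rewrite lexx/= (le_trans _ ler01)// lerN10.
  by rewrite lexx andbT (le_trans _ ler01)// lerN10.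
apply/measurable_funU => //; first by apply: measurableU.
split; last by apply/measurable_funU => //; split; exact: measurable_fun_set1.
apply: open_continuous_measurable_fun; first exact: interval_open.
by move=> x; rewrite inE /= in_itv/= => ?; exact: continuous_acos.
Qed.

End Sphere.

(** * Mean-square convergence on a circle of latitude *)

Section Expansion.
Context {R : realType} {d : measure_display} {Omega : measurableType d}.
Variables (P : probability Omega R) (T : R * R * R -> Omega -> R) (C : nat -> R).
Variable a : nat -> int -> Omega -> R[i].
Hypothesis T_gaussian : gaussian_field P (@sphere R) (fun x w => (T x w)%:C).
Hypothesis C0 : forall l, 0 <= C l.
Hypothesis coefP : harmonic_coefficients P C a.
Hypothesis expP : forall theta phi : R, 0 <= theta <= pi -> 0 <= phi < 2 * pi ->
  sq_error P T a n theta phi @[n --> \oo] --> 0%E.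

(** Lists in place of indexed families, so that combinations can later be concatenated and
    scaled. *)
Lemma gaussian_lincomb (s : seq (R * (R * R * R))) :
  (forall p, p \in s -> sphere p.2) ->
  gaussian_rv P (fun w => \sum_(p <- s) p.1 * T p.2 w).
Proof.
move=> ss; pose p0 : R * (R * R * R) := (0, (0, 0, 0)).
have [_ /(_ (size s) (fun j => (nth p0 s j).2) (fun j => (nth p0 s j).1) (fun=> 0))] :=
  T_gaussian.
have sz (j : 'I_(size s)) : sphere (nth p0 s j).2 by apply: ss; rewrite mem_nth.
move=> /(_ sz); congr (gaussian_rv P); apply/funext => w.
rewrite (big_nth p0) big_mkord; apply: eq_bigr => j _.
by rewrite /= mul0r addr0.
Qed.

Lemma sqint_T x : sphere x -> sqint P (T x).
Proof.
move=> sx; have [|m [v [v0 nv]]] := @gaussian_lincomb [:: (1, x)].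
  by move=> p; rewrite inE => /eqP ->.
have [] := normal_law_moments v0 nv.
by under eq_fun do rewrite big_seq1 mul1r.
Qed.

(** [T] is jointly measurable over the sphere only, and [spoint] never leaves it. The arbitrary
    parameter space S allows for further variables, such as the height z. *)
Lemma measurable_T_spoint {dS : measure_display} {S : measurableType dS}
    (th ph : S -> R) (om : S -> Omega) :
  measurable_fun setT th -> measurable_fun setT ph -> measurable_fun setT om ->
  measurable_fun setT (fun s => T (spoint (th s) (ph s)) (om s)).
Proof.
move=> mth mph mom; have [mT _] := T_gaussian.
have mT' : measurable_fun (@sphere R `*` [set: Omega])
    (fun p : (R * R * R) * Omega => T p.1 p.2).
  have := measurableT_comp (@measurable_fst _ _ R R) mT.
  exact.
have := @measurable_comp _ _ _ _ _ _ (@sphere R `*` [set: Omega])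
  (fun p : (R * R * R) * Omega => T p.1 p.2) setT
  (fun s => (spoint (th s) (ph s), om s)).
apply=> //.
- by apply: measurableX => //; exact: measurable_sphere.
- by move=> _ [s _ <-]; split=> //=; exact: sphere_spoint.
- by apply: measurable_fun_pair => //; exact: measurable_spoint.
Qed.

Let Y (theta : R) (n : nat) (phi : R) (w : Omega) : R :=
  T (spoint theta phi) w - coef_sum a theta n phi w.

Let sqint_Y theta n phi : sqint P (Y theta n phi).
Proof.
apply: sqintB; first by apply: sqint_T; exact: sphere_spoint.
exact: sqint_coef_sum C0 coefP _ _ _.
Qed.

Definition l2err (theta : R) (n : nat) (phi : R) : R :=
  ip P (Y theta n phi) (Y theta n phi).

Let cmeasurable_partial_sum n theta phi :
  cmeasurable (partial_sum a n theta phi).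
Proof.
apply: cmeasurable_sum => l; apply: cmeasurable_sum => j.
apply: cmeasurableZ; apply: cpair_cmeasurable.
apply: (coef_measurable coefP).
rewrite ler_norml; apply/andP; split.
  by rewrite lerBrDr addNr.
rewrite lerBlDr -PoszD lez_nat addnn -mul2n -ltnS; exact: ltn_ord.
Qed.

(** The partial sum is almost surely real, so the squared complex modulus reduces to a real
    square. *)
Let sq_errorE theta n phi : sq_error P T a n theta phi = (l2err theta n phi)%:E.
Proof.
rewrite /l2err EFin_ip//; have [mr mi] := cmeasurable_partial_sum n theta phi.
have mT : measurable_fun setT (T (spoint theta phi)).
  by apply: (sqint_measurable (sqint_T _)); exact: sphere_spoint.
have nE (z : R[i]) : Normc.normc z ^+ 2 = complex.Re z ^+ 2 + complex.Im z ^+ 2.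
  by case: z => x y /=; rewrite sqr_sqrtr// addr_ge0// sqr_ge0.
rewrite /sq_error; under eq_integral do rewrite nE.
have E w : complex.Re ((T (spoint theta phi) w)%:C - partial_sum a n theta phi w) ^+ 2 +
    complex.Im ((T (spoint theta phi) w)%:C - partial_sum a n theta phi w) ^+ 2 =
    (T (spoint theta phi) w - complex.Re (partial_sum a n theta phi w)) ^+ 2 +
    complex.Im (partial_sum a n theta phi w) ^+ 2.
  by case: (partial_sum a n theta phi w) => x y /=; ring.
under eq_integral do rewrite E.
apply: ae_eq_integral => //.
- apply/measurable_EFinP; apply: measurable_funD; apply: measurable_funX => //.
  exact: measurable_funB.
- by apply/measurable_EFinP/measurable_funX; exact: (sqint_measurable (sqint_Y _ _ _)).
- have := partial_sum_coef_sum coefP; apply: filterS => w h _.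
  by rewrite h /= expr0n addr0.
Qed.

(** Convergence is assumed for phi < 2 pi, whereas [gfield] integrates over the closed interval;
    periodicity covers the end point. *)
Let Y_2pi theta n : Y theta n (2 * pi) = Y theta n 0.
Proof.
apply/funext => w; rewrite /Y; congr (T _ w - _).
  rewrite /spoint cos0 sin0.
  have := @sin_2pi_nat R 1; have := @cos_2pi_nat R 1.
  by rewrite !mul1r => -> ->.
rewrite /coef_sum /harm_sum; apply: eq_bigr => l _; apply: eq_bigr => k _.
by rewrite /harm_term sin_2pi_nat cos_2pi_nat !mulr0 cos0 sin0 !mulr0.
Qed.

Lemma l2err_cvg theta phi : 0 <= theta <= pi -> 0 <= phi <= 2 * pi ->
  l2err theta ^~ phi @ \oo --> (0 : R).
Proof.
move=> th /andP[p0]; rewrite le_eqVlt => /predU1P[->|p2].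
  under eq_fun do rewrite /l2err Y_2pi -/(l2err _ _ _).
  have := expP th (phi := 0); rewrite lexx mulr_gt0 ?pi_gt0// => /(_ isT).
  by under eq_fun do rewrite sq_errorE; move/fine_cvg.
have := expP th (phi := phi); rewrite p0 p2 => /(_ isT).
by under eq_fun do rewrite sq_errorE; move/fine_cvg.
Qed.

(* Along the circle of latitude [theta] the differences of partial sums have
   constant norm, so the pointwise L2 convergence is uniform in [phi]. *)
Lemma l2err_bound theta phi n : 0 <= theta <= pi -> 0 <= phi <= 2 * pi ->
  l2err theta n phi <= 4 * l2err theta n 0.
Proof.
move=> th ph.
(* T - S_n at phi is split through S_k, the increment is moved to angle 0 and split again; each
   splitting costs a factor 2. The terms in k vanish in the limit. *)
have H k : (n <= k)%N -> l2err theta n phi <=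
    2 * l2err theta k phi + 4 * l2err theta n 0 + 4 * l2err theta k 0.
  move=> nk; pose D x w := coef_sum a theta k x w - coef_sum a theta n x w.
  have sD x : sqint P (D x) by apply: sqintB; exact: sqint_coef_sum C0 coefP _ _ _.
  have h1 : l2err theta n phi <= 2 * l2err theta k phi + 2 * ip P (D phi) (D phi).
    have := ipD_le (sqint_Y theta k phi) (sD phi).
    congr (_ <= _); congr (ip P); apply/funext => w; rewrite /Y /D; ring.
  have h2 : ip P (D 0) (D 0) <= 2 * l2err theta n 0 + 2 * l2err theta k 0.
    have sN : sqint P (fun w => -1 * Y theta k 0 w) by apply: sqintZ; exact: sqint_Y.
    have := ipD_le (sqint_Y theta n 0) sN.
    rewrite (ipZl (-1) (sqint_Y theta k 0) sN) [ip P (Y theta k 0) _]ipC.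
    rewrite (ipZl (-1) (sqint_Y theta k 0) (sqint_Y theta k 0)) !mulN1r opprK.
    congr (_ <= _); congr (ip P); apply/funext => w; rewrite /Y /D; ring.
  have h3 : ip P (D phi) (D phi) = ip P (D 0) (D 0) := coef_sum_diff_norm C0 coefP _ _ nk.
  rewrite h3 in h1; lra.
have pi2 : 0 <= 2 * pi :> R by rewrite mulr_ge0 ?pi_ge0.
have c1 := l2err_cvg th ph.
have c2 : l2err theta ^~ 0 @ \oo --> (0 : R) by apply: l2err_cvg; rewrite ?lexx.
have lim : (fun k => 2 * l2err theta k phi + 4 * l2err theta n 0 + 4 * l2err theta k 0)
    @ \oo --> 4 * l2err theta n 0.
  apply: (@cvg_to_eq _ (2 * 0 + 4 * l2err theta n 0 + 4 * 0)).
    by rewrite !mulr0 add0r addr0.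
  apply: cvgD; last by apply: cvgM => //; exact: cvg_cst.
  apply: cvgD; last exact: cvg_cst.
  by apply: cvgM => //; exact: cvg_cst.
rewrite -(cvg_lim (@Rhausdorff R) lim).
apply: limr_ge; first by apply: cvgP lim.
by exists n => // k /= nk; exact: H.
Qed.

End Expansion.

(** * Convergence of integral and discrete Fourier coefficients *)

Section FourierLimit.
Context {R : realType} {d : measure_display} {Omega : measurableType d}.
Variables (P : probability Omega R) (T : R * R * R -> Omega -> R) (C : nat -> R).
Variable a : nat -> int -> Omega -> R[i].
Hypothesis T_gaussian : gaussian_field P (@sphere R) (fun x w => (T x w)%:C).
Hypothesis C0 : forall l, 0 <= C l.
Hypothesis coefP : harmonic_coefficients P C a.
Hypothesis expP : forall theta phi : R, 0 <= theta <= pi -> 0 <= phi < 2 * pi ->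
  sq_error P T a n theta phi @[n --> \oo] --> 0%E.
Local Notation mu := (@lebesgue_measure R).

Let pi2 : 0 <= 2 * pi :> R. Proof. by rewrite mulr_ge0 ?pi_ge0. Qed.

Let coef_cmeasurable l m : (m <= l)%N -> cmeasurable (a l (Posz m)).
Proof.
move=> ml; apply: cpair_cmeasurable; apply: (coef_measurable coefP).
by rewrite /= lez_nat.
Qed.

Let measurable_coef_sum theta n :
  measurable_fun setT (fun p : R * Omega => coef_sum a theta n p.1 p.2).
Proof.
have mcos k : measurable_fun setT (fun p : R * Omega => cos (k%:R * p.1)).
  have mk := continuous_measurable_fun (@continuous_cosM R k%:R).
  exact: (measurableT_comp mk measurable_fst).
have msin k : measurable_fun setT (fun p : R * Omega => sin (k%:R * p.1)).
  have mk := continuous_measurable_fun (@continuous_sinM R k%:R).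
  exact: (measurableT_comp mk measurable_fst).
rewrite /coef_sum /harm_sum; apply: measurable_sum => l; apply: measurable_sum => k.
rewrite /harm_term; apply: measurable_funM => //.
have [m1 m2] := @coef_cmeasurable l k (leq_ord k).
apply: measurable_funB; apply: measurable_funM => //.
  exact: (measurableT_comp m1 measurable_snd).
exact: (measurableT_comp m2 measurable_snd).
Qed.

(** To be used with c(x) = cos (m x) or sin (- m x). [h n] is the coefficient of the n-th partial
    sum, and both the integral and the mean over [N n] nodes must reproduce it. *)
Variables (theta : R) (c : R -> R) (h : nat -> Omega -> R) (N : nat -> nat).
Hypothesis th : 0 <= theta <= pi.
Hypothesis cc : continuous c.
Hypothesis c1 : forall x, `|c x| <= 1.
Hypothesis N0 : forall n, (0 < N n)%N.
Hypothesis sh : forall n, sqint P (h n).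
Hypothesis ih : forall n w, imean (fun x => coef_sum a theta n x w * c x) = h n w.
Hypothesis dh : forall n w, dmean (N n) (fun x => coef_sum a theta n x w * c x) = h n w.

Let t x w := T (spoint theta x) w.
Let Y n x w := t x w - coef_sum a theta n x w.

(** The empty partial sum is 0, so the bounds at n = 0 are statements on [T] itself: square
    integrability of its means and integrability of its paths. *)
Let Y0 : Y 0 = t.
Proof.
apply/funext => x; apply/funext => w.
by rewrite /Y /coef_sum /harm_sum big_ord0 subr0.
Qed.

Let sY n x : sqint P (Y n x).
Proof.
apply: sqintB; first by apply: (sqint_T T_gaussian); exact: sphere_spoint.
exact: sqint_coef_sum C0 coefP _ _ _.
Qed.

Let YK n x : 0 <= x <= 2 * pi -> ip P (Y n x) (Y n x) <= 4 * l2err P T a theta n 0.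
Proof. by move=> x02; exact: (l2err_bound T_gaussian C0 coefP expP). Qed.

Let mY n : measurable_fun setT (fun p : R * Omega => Y n p.1 p.2).
Proof.
apply: measurable_funB; last exact: measurable_coef_sum.
exact: (measurable_T_spoint T_gaussian).
Qed.

Let mc : measurable_fun setT c. Proof. exact: continuous_measurable_fun. Qed.

Let bnd_i n := imean_bound (fun x _ => sY n x) (@YK n) c1 (mY n) mc.
Let bnd_d n k := dmean_bound (N := k) (fun x _ => sY n x) (@YK n) c1.

Let err0 : (fun n => 4 * l2err P T a theta n 0) @ \oo --> (0 : R).
Proof.
apply: (cvg_to_eq (mulr0 4)); apply: cvgM; first exact: cvg_cst.
by apply: (l2err_cvg T_gaussian C0 coefP expP) => //; rewrite lexx.
Qed.

Lemma sqint_imean_T : sqint P (fun w => imean (fun x => t x w * c x)).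
Proof. by have [_] := bnd_i 0; rewrite Y0. Qed.

Lemma sqint_dmean_T k : (0 < k)%N -> sqint P (fun w => dmean k (fun x => t x w * c x)).
Proof. by move=> k0; have [] := bnd_d 0 k0; rewrite Y0. Qed.

Lemma l2cvg_imean : l2cvg P h (fun w => imean (fun x => t x w * c x)).
Proof.
apply: (@squeeze_cvgr _ _ _ _ (cst 0) (fun n => 4 * l2err P T a theta n 0)) => //.
  apply: nearW => n; rewrite ip_ge0/=.
  have [_ sZ ZK] := bnd_i n; apply: le_trans ZK; rewrite le_eqVlt; apply/orP; left.
  apply/eqP; apply: ae_eq_Rintegral.
  - have mD := sqint_measurable (sqintB (sh n) sqint_imean_T).
    exact: measurable_funM.
  - by apply: measurable_funM; exact: (sqint_measurable sZ).
  (* On almost every path [T] is integrable along the circle, which allows the partial sum to be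
     subtracted under the integral. *)
  have [ae _ _] := bnd_i 0; move: ae; rewrite Y0; apply: filterS => w iw.
  suff -> : imean (fun x => Y n x w * c x) =
      imean (fun x => t x w * c x) - h n w by ring.
  rewrite -ih /imean -mulrBr; congr (_ * _); rewrite -RintegralB//.
    by apply: eq_Rintegral => x _; rewrite /Y mulrBl.
  apply: continuous_compact_integrable; first exact: segment_compact.
  apply: continuous_subspaceT => x; apply: cvgM; last exact: cc.
  exact: continuous_harm_sum.
exact: cvg_cst.
Qed.

(** The discrete mean of T - S_n is small by [dmean_bound], so the discrete coefficients have the
    same limit as [h]. *)
Lemma l2cvg_dmean : l2cvg P (fun n w => dmean (N n) (fun x => t x w * c x))
  (fun w => imean (fun x => t x w * c x)).
Proof.
have sD n := sqint_dmean_T (N0 n).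
have sG := sqint_imean_T.
have cD : l2cvg P (fun n w => dmean (N n) (fun x => t x w * c x) - h n w) (cst 0).
  apply: (@squeeze_cvgr _ _ _ _ (cst 0) (fun n => 4 * l2err P T a theta n 0)) => //.
    apply: nearW => n; rewrite ip_ge0/=.
    have [sZ ZK] := bnd_d n (N0 n); apply: le_trans ZK; rewrite le_eqVlt; apply/orP; left.
    apply/eqP; congr (ip P); apply/funext => w; rewrite subr0 -dh.
      rewrite /dmean -mulrBr -sumrB; congr (_ * _); apply: eq_bigr => k _.
      by rewrite /Y mulrBl.
    rewrite /dmean -mulrBr -sumrB; congr (_ * _); apply: eq_bigr => k _.
    by rewrite /Y mulrBl.
  exact: cvg_cst.
have := l2cvgD (fun n => sqintB (sD n) (sh n)) sh (sqint_cst P 0) sG cD l2cvg_imean.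
congr l2cvg.
  by apply/funext => n; apply/funext => w; rewrite subrK.
by apply/funext => w; rewrite /= add0r.
Qed.

End FourierLimit.

(** Valid for every f, since [fine] sends both infinities to 0. This makes the conjugation relation
    for negative orders hold at each w. *)
Lemma RintegralN {R : realType} {d : measure_display} {S : measurableType d}
    (mu : {measure set S -> \bar R}) (D : set S) (f : S -> R) :
  \int[mu]_(x in D) (- f x) = - \int[mu]_(x in D) f x.
Proof.
rewrite /Rintegral [in RHS]integralE [in LHS]integralE.
have -> : (\int[mu]_(x in D) ((fun x => (- f x)%:E)^\+ x) =
    \int[mu]_(x in D) ((fun x => (f x)%:E)^\- x))%E.
  by apply: eq_integral => x _; rewrite funeposE funenegE EFinN.
have -> : (\int[mu]_(x in D) ((fun x => (- f x)%:E)^\- x) =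
    \int[mu]_(x in D) ((fun x => (f x)%:E)^\+ x))%E.
  by apply: eq_integral => x _; rewrite funeposE funenegE EFinN oppeK.
move: (integral _ _ _) (integral _ _ _) => p q.
by case: p q => [x| |] [y| |] //=; rewrite ?opprB ?oppr0.
Qed.

Lemma measurable_imean_param {R : realType} {d : measure_display}
    {S : measurableType d} (f : R * S -> R) : measurable_fun setT f ->
  measurable_fun setT (fun s => imean (fun x => f (x, s))).
Proof.
move=> mf; rewrite /imean; apply: measurable_funM => //.
pose I : set R := [set` `[0, 2 * pi]].
have mI : measurable I by exact: measurable_itv.
have E s : \int[lebesgue_measure]_(x in I) f (x, s) =
    \int[lebesgue_measure]_x (f (x, s) * \1_I x).
  rewrite Rintegral_mkcond; apply: eq_Rintegral => x _.
  by rewrite patchE indicE; case: ifP; rewrite ?mulr1 ?mulr0.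
under eq_fun do rewrite E.
apply: (@measurable_Rintegral_param _ _ _ (fun p => f p * \1_I p.1)).
apply: measurable_funM => //.
by apply: (measurableT_comp (measurable_indic _)) => //; exact: measurable_fst.
Qed.

Lemma ip_sum_orthogonal {R : realType} {d : measure_display}
    {Omega : measurableType d} (P : probability Omega R) (r : seq nat)
    (x y : nat -> R) (F G : nat -> Omega -> R) :
  uniq r -> (forall l, l \in r -> sqint P (F l)) ->
  (forall l, l \in r -> sqint P (G l)) ->
  (forall l k, l \in r -> k \in r -> l != k -> ip P (F l) (G k) = 0) ->
  ip P (fun w => \sum_(l <- r) x l * F l w) (fun w => \sum_(l <- r) y l * G l w) =
  \sum_(l <- r) x l * y l * ip P (F l) (G l).
Proof.
move=> ur sF sG o.
have sF' l : l \in r -> sqint P (fun w => x l * F l w) by move=> /sF; exact: sqintZ.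
have sG' l : l \in r -> sqint P (fun w => y l * G l w) by move=> /sG; exact: sqintZ.
have sS : sqint P (fun w => \sum_(l <- r) y l * G l w).
  by under eq_fun do rewrite big_seq; exact: sqint_sum.
under [X in ip P X _]eq_fun do rewrite big_seq.
rewrite (ip_suml _ sF' sS) [RHS]big_seq; apply: eq_bigr => l lr.
rewrite (ipZl _ (sF _ lr) sS) -mulrA; congr (_ * _).
rewrite ipC; under [X in ip P X _]eq_fun do rewrite big_seq.
rewrite (ip_suml _ sG' (sF _ lr)) -big_seq (bigD1_seq l)//= big_seq_cond big1.
  by rewrite addr0 (ipZl _ (sG _ lr) (sF _ lr)) ipC.
move=> k /andP[kr kl]; rewrite (ipZl _ (sG _ kr) (sF _ lr)) ipC o ?mulr0// eq_sym.
by [].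
Qed.

(** * Real and imaginary part of the Fourier coefficients *)

Section GField.
Context {R : realType} {d : measure_display} {Omega : measurableType d}.
Variable T : R * R * R -> Omega -> R.

Definition gre (m : nat) (z : R) (w : Omega) : R :=
  imean (fun x => T (spoint (acos z) x) w * cos (m%:R * x)).

Definition gim (m : nat) (z : R) (w : Omega) : R :=
  imean (fun x => T (spoint (acos z) x) w * sin (- (m%:R * x))).

Lemma gfieldE (m : nat) z w : gfield T (Posz m) z w = gre m z w +i* gim m z w.
Proof.
rewrite /gfield /gre /gim /imean; apply/eqP; rewrite eq_complex /=.
rewrite !mul0r subr0 addr0; apply/andP; split; apply/eqP; congr (_ * _).
  apply: eq_Rintegral => x _; rewrite mul0r subr0 cosN.
  by rewrite pmulrn.
apply: eq_Rintegral => x _; rewrite mul0r addr0.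
by rewrite pmulrn.
Qed.

Lemma gfield_conj (m : int) z w : m < 0 -> gfield T m z w = conjc (gfield T (- m) z w).
Proof.
case: m => // k _; rewrite /gfield; apply/eqP; rewrite eq_complex /=.
rewrite !mul0r !subr0 !addr0; apply/andP; split; apply/eqP.
  congr (_ * _); apply: eq_Rintegral => x _.
  by rewrite !mul0r !subr0 !cosN NegzE mulrNz mulNr cosN.
rewrite -mulrN -RintegralN; congr (_ * _); apply: eq_Rintegral => x _.
by rewrite !mul0r !addr0 NegzE mulrNz mulNr opprK sinN mulrN opprK.
Qed.

End GField.

(** * Law, independence and covariance of the Fourier coefficients *)

Section FourierModes.
Context {R : realType} {d : measure_display} {Omega : measurableType d}.
Variables (P : probability Omega R) (T : R * R * R -> Omega -> R) (C : nat -> R).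
Variable a : nat -> int -> Omega -> R[i].
Hypothesis T_gaussian : gaussian_field P (@sphere R) (fun x w => (T x w)%:C).
Hypothesis T_centred : centred_field P (@sphere R) (fun x w => (T x w)%:C).
Hypothesis C0 : forall l, 0 <= C l.
Hypothesis coefP : harmonic_coefficients P C a.
Hypothesis expP : forall theta phi : R, 0 <= theta <= pi -> 0 <= phi < 2 * pi ->
  sq_error P T a n theta phi @[n --> \oo] --> 0%E.

Let A (m l : nat) (w : Omega) : R := complex.Re (a l (Posz m) w).
(* The factor matters for m = 0, where the imaginary part vanishes only almost
   surely. *)
Let B (m l : nat) (w : Omega) : R := (m != 0%N)%:R * complex.Im (a l (Posz m) w).

Let hre m z n w := \sum_(m <= l < n) Llm l (Posz m) z * A m l w.
Let him m z n w := \sum_(m <= l < n) Llm l (Posz m) z * B m l w.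
(** With this number of nodes the order m is not confused with an order below n; the successor
    guarantees at least one node. *)
Let dre m z n w :=
  dmean (n + m).+1 (fun x => T (spoint (acos z) x) w * cos (m%:R * x)).
Let dim m z n w :=
  dmean (n + m).+1 (fun x => T (spoint (acos z) x) w * sin (- (m%:R * x))).

Let sA m l : (m <= l)%N -> sqint P (A m l).
Proof. by move=> ml; have [] := coef_re_moments C0 coefP ml. Qed.

Let sB m l : (m <= l)%N -> sqint P (B m l).
Proof. by move=> ml; apply: sqintZ; have [] := coef_im_moments C0 coefP ml. Qed.

Let s_sum (F : nat -> nat -> Omega -> R) m z n :
  (forall l, (m <= l)%N -> sqint P (F m l)) ->
  sqint P (fun w => \sum_(m <= l < n) Llm l (Posz m) z * F m l w).
Proof.
move=> sF; under eq_fun do rewrite big_seq.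
by apply: sqint_sum => l; rewrite mem_index_iota => /andP[ml _]; apply: sqintZ; exact: sF.
Qed.

Let shre m z n : sqint P (hre m z n). Proof. by apply: s_sum => l; exact: sA. Qed.
Let shim m z n : sqint P (him m z n). Proof. by apply: s_sum => l; exact: sB. Qed.

Let csinN (m : nat) : continuous (fun x : R => sin (- (m%:R * x))).
Proof. by under eq_fun do rewrite -mulNr; exact: continuous_sinM. Qed.

Let cos_le1 (m : nat) (x : R) : `|cos (m%:R * x)| <= 1.
Proof. by rewrite ler_norml cos_geN1 cos_le1. Qed.

Let sin_le1 (m : nat) (x : R) : `|sin (- (m%:R * x))| <= 1.
Proof. by rewrite ler_norml sin_geN1 sin_le1. Qed.

Section Point.
Variables (m : nat) (z : R).
Hypothesis z11 : segment11 z.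

Let th : 0 <= acos z <= pi. Proof. by rewrite acos_ge0// acos_lepi. Qed.

Let ire n w : imean (fun x => coef_sum a (acos z) n x w * cos (m%:R * x)) = hre m z n w.
Proof.
rewrite /coef_sum (Lam_harm_sum_cos (N := (n + m).+1) imeanD imeanZ
  (fun j _ => imean_cos j) (fun j _ => imean_sin j))//.
by rewrite acosK.
Qed.

Let iim n w :
  imean (fun x => coef_sum a (acos z) n x w * sin (- (m%:R * x))) = him m z n w.
Proof.
rewrite /coef_sum (Lam_harm_sum_sin (N := (n + m).+1) imeanD imeanZ
  (fun j _ => imean_cos j) (fun j _ => imean_sin j))//.
by rewrite acosK.
Qed.

Let ddre n w : dmean (n + m).+1 (fun x => coef_sum a (acos z) n x w * cos (m%:R * x)) =
  hre m z n w.
Proof.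
rewrite /coef_sum (Lam_harm_sum_cos (N := (n + m).+1) (fun f g _ _ => dmeanD _ f g)
  (fun c f _ => dmeanZ _ c f) (@dmean_cos R _) (@dmean_sin R _))//.
by rewrite acosK.
Qed.

Let ddim n w :
  dmean (n + m).+1 (fun x => coef_sum a (acos z) n x w * sin (- (m%:R * x))) =
  him m z n w.
Proof.
rewrite /coef_sum (Lam_harm_sum_sin (N := (n + m).+1) (fun f g _ _ => dmeanD _ f g)
  (fun c f _ => dmeanZ _ c f) (@dmean_cos R _) (@dmean_sin R _))//.
by rewrite acosK.
Qed.

Let N0 n : (0 < (n + m).+1)%N. Proof. by []. Qed.

Lemma sqint_gre : sqint P (gre T m z).
Proof.
exact: (sqint_imean_T T_gaussian C0 coefP expP th (@continuous_cosM R m%:R)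
  (cos_le1 m)).
Qed.

Lemma sqint_gim : sqint P (gim T m z).
Proof. exact: (sqint_imean_T T_gaussian C0 coefP expP th (@csinN m) (sin_le1 m)). Qed.

Lemma l2cvg_hre : l2cvg P (hre m z) (gre T m z).
Proof.
exact: (l2cvg_imean T_gaussian C0 coefP expP th (@continuous_cosM R m%:R)
  (cos_le1 m) (shre m z) ire).
Qed.

Lemma l2cvg_him : l2cvg P (him m z) (gim T m z).
Proof.
exact: (l2cvg_imean T_gaussian C0 coefP expP th (@csinN m)
  (sin_le1 m) (shim m z) iim).
Qed.

Lemma l2cvg_dre : l2cvg P (dre m z) (gre T m z).
Proof.
exact: (l2cvg_dmean T_gaussian C0 coefP expP th (@continuous_cosM R m%:R)
  (cos_le1 m) N0 (shre m z) ire ddre).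
Qed.

Lemma l2cvg_dim : l2cvg P (dim m z) (gim T m z).
Proof.
exact: (l2cvg_dmean T_gaussian C0 coefP expP th (@csinN m)
  (sin_le1 m) N0 (shim m z) iim ddim).
Qed.

End Point.

(** The span of the values of [T] on the sphere; all its elements are Gaussian of mean 0. *)
Let lincomb (X : Omega -> R) := exists2 s : seq (R * (R * R * R)),
  (forall p, p \in s -> sphere p.2) & X = fun w => \sum_(p <- s) p.1 * T p.2 w.

Let lincomb0 : lincomb (cst 0).
Proof. by exists [::] => //; apply/funext => w; rewrite big_nil. Qed.

Let lincombD X Y : lincomb X -> lincomb Y -> lincomb (fun w => X w + Y w).
Proof.
move=> [s ss ->] [t tt ->]; exists (s ++ t).
  by move=> p; rewrite mem_cat => /orP[/ss|/tt].
by apply/funext => w; rewrite big_cat.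
Qed.

Let lincombZ c X : lincomb X -> lincomb (fun w => c * X w).
Proof.
move=> [s ss ->]; exists [seq (c * p.1, p.2) | p <- s].
  by move=> p /mapP[q /ss qs ->].
by apply/funext => w; rewrite big_map mulr_sumr; apply: eq_bigr => p _; rewrite mulrA.
Qed.

Let lincomb_sum I (r : seq I) (F : I -> Omega -> R) :
  (forall i, lincomb (F i)) -> lincomb (fun w => \sum_(i <- r) F i w).
Proof.
move=> lF; elim: r => [|i r IH].
  by under eq_fun do rewrite big_nil; exact: lincomb0.
by under eq_fun do rewrite big_cons; exact: lincombD.
Qed.

Let lincomb_dmean N theta (c : R -> R) :
  lincomb (fun w => dmean N (fun x => T (spoint theta x) w * c x)).
Proof.
rewrite /dmean; apply: lincombZ; apply: lincomb_sum => k.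
exists [:: (c (dpoint N k), spoint theta (dpoint N k))].
  by move=> p; rewrite inE => /eqP -> /=; exact: sphere_spoint.
by apply/funext => w; rewrite big_seq1 mulrC.
Qed.

Let lincomb_gaussian X : lincomb X -> gaussian_rv P X.
Proof. by move=> [s ss ->]; exact: (gaussian_lincomb T_gaussian). Qed.

Let lincomb_mean X : lincomb X -> \int[P]_w X w = 0.
Proof.
move=> [s ss ->].
have sT p : p \in s -> sqint P (fun w => p.1 * T p.2 w).
  by move=> /ss ps; apply: sqintZ; exact: (sqint_T T_gaussian).
have s1 := sqint_cst P 1.
transitivity (ip P (fun w => \sum_(p <- s) p.1 * T p.2 w) (cst 1)).
  by apply: eq_Rintegral => w _; rewrite mulr1.
under [X in ip P X _]eq_fun do rewrite big_seq.
rewrite (ip_suml _ sT s1) big1// => p ps.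
rewrite (ipZl _ (sqint_T T_gaussian (ss _ ps)) s1).
have [+ _] := T_centred (ss _ ps); rewrite unlock => E.
rewrite /ip; under eq_Rintegral do rewrite /= mulr1.
by rewrite /Rintegral /= E mulr0.
Qed.

Let l2limit_mean (D : nat -> Omega -> R) (X : Omega -> R) :
  (forall n, lincomb (D n)) -> (forall n, sqint P (D n)) -> sqint P X ->
  l2cvg P D X -> ('E_P[X] = 0)%E.
Proof.
move=> lD sD sX cX; have := l2cvg_Rintegral sD sX cX.
under eq_fun do rewrite lincomb_mean//.
move=> c0; rewrite unlock -(fineK (integrable_fin_num measurableT (sqint_integrable sX))).
by have := cvg_unique (@Rhausdorff R) c0 (cvg_cst (0 : R)); rewrite /Rintegral => ->.
Qed.

Lemma gfield_random m : random_field (@segment11 R) (gfield T (Posz m)).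
Proof.
(* Extension by 0 makes the inclination measurable on the whole line without changing it on
   [-1, 1]. *)
pose Th := acos \_ (@segment11 R).
have mseg : measurable (@segment11 R).
  have -> : @segment11 R = [set` `[-1, 1]] by apply/seteqP; split=> x; rewrite /= in_itv.
  exact: measurable_itv.
have mTh : measurable_fun setT Th.
  exact: (iffLR (measurable_restrictT _ mseg) measurable_acos).
have mean c : measurable_fun setT c -> measurable_fun setT
    (fun p : R * Omega => imean (fun x => T (spoint (Th p.1) x) p.2 * c x)).
  move=> mc; apply: (@measurable_imean_param R _ _
    (fun q : R * (R * Omega) => T (spoint (Th q.2.1) q.1) q.2.2 * c q.1)).
  apply: measurable_funM; last exact: (measurableT_comp mc measurable_fst).
  apply: (measurable_T_spoint T_gaussian).
  - apply: (measurableT_comp mTh).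
    exact: (measurableT_comp measurable_fst measurable_snd).
  - exact: measurable_fst.
  - exact: (measurableT_comp measurable_snd measurable_snd).
have mre := mean _ (continuous_measurable_fun (@continuous_cosM R m%:R)).
have mim := mean _ (continuous_measurable_fun (@csinN m)).
apply: eq_measurable_fun (measurable_funTS (measurable_fun_pair mre mim)).
move=> p; rewrite inE => -[z11 _]; rewrite gfieldE /cpair /= /gre /gim.
by rewrite /Th patchE mem_set.
Qed.

Lemma gfield_gaussian m : gaussian_field P (@segment11 R) (gfield T (Posz m)).
Proof.
split; first exact: gfield_random.
move=> k x b c x11.
under eq_fun do under eq_bigr do rewrite gfieldE /=.
(* The same combination of the discrete coefficients: it lies in the span of the values of [T] and
   tends to the given one. *)
pose D n w := \sum_(j < k) (b j * dre m (x j) n w + c j * dim m (x j) n w).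
have lD n : lincomb (D n).
  apply: lincomb_sum => j; apply: lincombD; apply: lincombZ; exact: lincomb_dmean.
have sre j n : sqint P (dre m (x j) n).
  by apply: (sqint_dmean_T T_gaussian C0 coefP expP _ (cos_le1 m)) => //;
    rewrite acos_ge0 ?acos_lepi//; exact: x11.
have sim j n : sqint P (dim m (x j) n).
  by apply: (sqint_dmean_T T_gaussian C0 coefP expP _ (sin_le1 m)) => //;
    rewrite acos_ge0 ?acos_lepi//; exact: x11.
apply: (@gaussian_l2_limit _ _ _ P D).
- by move=> n; apply: sqint_sum => j _; apply: sqintD; exact: sqintZ.
- by move=> n; exact: lincomb_mean.
- by move=> n e; apply: lincomb_gaussian; exact: lincombZ.
- apply: sqint_sum => j _; apply: sqintD; apply: sqintZ.
    exact: sqint_gre.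
  exact: sqint_gim.
- apply: (@l2cvg_sum _ _ _ P _ _
    (fun j n w => b j * dre m (x j) n w + c j * dim m (x j) n w)
    (fun j w => b j * gre T m (x j) w + c j * gim T m (x j) w)).
  + by move=> j n; apply: sqintD; exact: sqintZ.
  + move=> j; apply: sqintD; apply: sqintZ; [exact: sqint_gre|exact: sqint_gim].
  + move=> j; apply: l2cvgD.
    * by move=> n; exact: sqintZ.
    * by move=> n; exact: sqintZ.
    * by apply: sqintZ; exact: sqint_gre.
    * by apply: sqintZ; exact: sqint_gim.
    * by apply: l2cvgZ => //; [exact: sqint_gre|exact: l2cvg_dre].
    * by apply: l2cvgZ => //; [exact: sqint_gim|exact: l2cvg_dim].
Qed.

Lemma gfield_centred m : centred_field P (@segment11 R) (gfield T (Posz m)).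
Proof.
move=> z z11; have th : 0 <= acos z <= pi by rewrite acos_ge0// acos_lepi.
split.
  under eq_fun do rewrite gfieldE /=.
  apply: (@l2limit_mean (dre m z)).
  - by move=> n; exact: lincomb_dmean.
  - by move=> n; exact: (sqint_dmean_T T_gaussian C0 coefP expP th (cos_le1 m)).
  - exact: sqint_gre.
  - exact: l2cvg_dre.
under eq_fun do rewrite gfieldE /=.
apply: (@l2limit_mean (dim m z)).
- by move=> n; exact: lincomb_dmean.
- by move=> n; exact: (sqint_dmean_T T_gaussian C0 coefP expP th (sin_le1 m)).
- exact: sqint_gim.
- exact: l2cvg_dim.
Qed.

Lemma gfield_independent m n : m != n ->
  independent_fields P (@segment11 R) (gfield T (Posz m)) (gfield T (Posz n)).
Proof.
move=> mn.
pose D := [set lm : nat * nat | (lm.2 <= lm.1)%N].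
pose X (lm : nat * nat) := a lm.1 (Posz lm.2).
(* The indices of order k; these sets are disjoint for distinct orders. *)
pose J k := [set lm : nat * nat | lm.2 = k /\ (k <= lm.1)%N].
have JD k : J k `<=` D by move=> [l i] [/= -> ].
have mX i : D i -> measurable_fun setT (fun w => cpair (X i w)).
  by move=> Di; apply: (coef_measurable coefP); rewrite /= lez_nat.
have JJ : J m `&` J n = set0.
  apply/seteqP; split=> // -[l i] [[/= im _] [/= i_n _]].
  by move: mn; rewrite -im -i_n eqxx.
have Gm k : family_events X (J k) `<=` measurable.
  move=> _ [i [U [Ji mU ->]]]; rewrite -[V in measurable V]setTI.
  by apply: mX => //; exact: JD Ji.
have meas k z : segment11 z -> measurable_fun setT (fun w => cpair (gfield T (Posz k) z w)).
  move=> z11; under eq_fun do rewrite gfieldE /cpair /=.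
  apply: measurable_fun_pair.
    exact: sqint_measurable (sqint_gre k z11).
  exact: sqint_measurable (sqint_gim k z11).
(* [hre] and [him] are measurable for the coefficients of order k, and [l2cvg_ae_limit] passes this
   on to their limits up to a null set. *)
have apx k z : segment11 z -> exists2 f : Omega -> R * R,
    @measurable_fun _ _ (g_sigma_algebraType (family_events X (J k))) _ setT f &
    {ae P, forall w, cpair (gfield T (Posz k) z w) = f w}.
  move=> z11.
  have mcoef l (p : R * R -> R) : (k <= l)%N -> measurable_fun setT p ->
      @measurable_fun _ _ (g_sigma_algebraType (family_events X (J k))) R setT
        (fun w => p (cpair (a l (Posz k) w))).
    move=> kl mp _ U mU; rewrite setTI; apply: sub_sigma_algebra.
    exists (l, k), (p @^-1` U); split=> //.
    by rewrite -[V in measurable V]setTI; exact: mp.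
  have msum F : (forall l, (k <= l)%N ->
      @measurable_fun _ _ (g_sigma_algebraType (family_events X (J k))) R setT (F l)) ->
      forall i, @measurable_fun _ _ (g_sigma_algebraType (family_events X (J k))) R setT
        (fun w => \sum_(k <= l < i) Llm l (Posz k) z * F l w).
    (* The guard makes each summand measurable for all l, also below k. *)
    move=> mF i; rewrite (_ : (fun w => _) = (fun w => \sum_(k <= l < i)
        (if (k <= l)%N then Llm l (Posz k) z * F l w else 0))); last first.
      apply/funext => w; apply: eq_big_nat => l /andP[kl _]; by rewrite kl.
    apply: measurable_sum => l; have [kl|kl] := leqP k l; last exact: measurable_cst.
    by apply: measurable_funM; [exact: measurable_cst|exact: mF].
  have mhre := msum (A k) (fun l kl => mcoef l _ kl measurable_fst).
  have mB l : (k <= l)%N ->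
      @measurable_fun _ _ (g_sigma_algebraType (family_events X (J k))) R setT (B k l).
    move=> kl; apply: measurable_funM; first exact: measurable_cst.
    exact: (mcoef l _ kl measurable_snd).
  have mhim := msum (B k) mB.
  have [f1 mf1 f1E] := l2cvg_ae_limit mhre (shre k z) (sqint_gre k z11) (l2cvg_hre k z11).
  have [f2 mf2 f2E] := l2cvg_ae_limit mhim (shim k z) (sqint_gim k z11) (l2cvg_him k z11).
  exists (fun w => (f1 w, f2 w)); first exact: measurable_fun_pair.
  by move: f2E; apply: filterS2 f1E => w h1 h2; rewrite gfieldE /cpair /= h1 h2.
apply: (@independent_fields_approx _ _ _ P _ _ _ _ _ _ _ (Gm m) (Gm n)) => //.
- exact: (independent_family_events mX (coef_independent coefP)).
- by move=> z; exact: meas.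
- by move=> z; exact: meas.
- by move=> z; exact: apx.
- by move=> z; exact: apx.
Qed.

Lemma gfield_covariance m z1 z2 : segment11 z1 -> segment11 z2 ->
  let X w := conjc (gfield T (Posz m) z1 w) * gfield T (Posz m) z2 w in
  let s (n : nat) := \sum_(m <= l < n) C l * Llm l (Posz m) z1 * Llm l (Posz m) z2 in
  [/\ cintegrable P X, cvgn s & cexpectation P X = (limn s)%:C].
Proof.
move=> h1 h2 X s.
have sr1 := sqint_gre m h1; have sr2 := sqint_gre m h2.
have si1 := sqint_gim m h1; have si2 := sqint_gim m h2.
have ReX w : complex.Re (X w) =
    gre T m z1 w * gre T m z2 w + gim T m z1 w * gim T m z2 w.
  by rewrite /X !gfieldE /= mulNr opprK.
have ImX w : complex.Im (X w) =
    gre T m z1 w * gim T m z2 w - gim T m z1 w * gre T m z2 w.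
  by rewrite /X !gfieldE /= mulNr.
(* Coefficients of distinct degrees are orthogonal, so only the diagonal survives; used for the four
   pairings of [A] and [B]. *)
have cross (F G : nat -> nat -> Omega -> R) (q : nat -> R) n :
    (forall l, (m <= l)%N -> sqint P (F m l)) ->
    (forall l, (m <= l)%N -> sqint P (G m l)) ->
    (forall l k, (m <= l)%N -> (m <= k)%N -> l != k -> ip P (F m l) (G m k) = 0) ->
    (forall l, (m <= l)%N -> ip P (F m l) (G m l) = q l) ->
    ip P (fun w => \sum_(m <= l < n) Llm l (Posz m) z1 * F m l w)
         (fun w => \sum_(m <= l < n) Llm l (Posz m) z2 * G m l w) =
    \sum_(m <= l < n) Llm l (Posz m) z1 * Llm l (Posz m) z2 * q l.
  move=> sF sG o qE; have mi l : l \in index_iota m n -> (m <= l)%N.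
    by rewrite mem_index_iota => /andP[].
  rewrite (@ip_sum_orthogonal _ _ _ P (index_iota m n) (fun l => Llm l (Posz m) z1)
    (fun l => Llm l (Posz m) z2) (F m) (G m) (iota_uniq _ _)).
  - by rewrite !big_seq; apply: eq_bigr => l /mi ml; rewrite qE.
  - by move=> l /mi; exact: sF.
  - by move=> l /mi; exact: sG.
  - by move=> l k /mi ml /mi mk; exact: o.
have off l k : (m <= l)%N -> (m <= k)%N -> l != k -> (l, m) != (k, m).
  by move=> _ _; apply: contraNneq => -[->].
have iBl (Z : Omega -> R) l : (m <= l)%N -> sqint P Z ->
    ip P (B m l) Z = (m != 0%N)%:R * ip P (fun w => complex.Im (a l (Posz m) w)) Z.
  move=> ml sZ; have [sI _ _] := coef_im_moments C0 coefP ml; exact: ipZl.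
have sI l : (m <= l)%N -> sqint P (fun w => complex.Im (a l (Posz m) w)).
  by move=> ml; have [] := coef_im_moments C0 coefP ml.
have oAA l k : (m <= l)%N -> (m <= k)%N -> l != k -> ip P (A m l) (A m k) = 0.
  by move=> ml mk lk; have [] := coef_cross C0 coefP ml mk (off _ _ ml mk lk).
have oBA l k : (m <= l)%N -> (m <= k)%N -> l != k -> ip P (B m l) (A m k) = 0.
  move=> ml mk lk; rewrite iBl//; last exact: sA.
  by have [_ _ -> _] := coef_cross C0 coefP ml mk (off _ _ ml mk lk); rewrite mulr0.
have oAB l k : (m <= l)%N -> (m <= k)%N -> l != k -> ip P (A m l) (B m k) = 0.
  by move=> ml mk lk; rewrite ipC oBA// eq_sym.
have oBB l k : (m <= l)%N -> (m <= k)%N -> l != k -> ip P (B m l) (B m k) = 0.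
  move=> ml mk lk; rewrite iBl//; last exact: sB.
  rewrite ipC iBl//; last exact: sI.
  rewrite eq_sym in lk.
  by have [_ _ _ ->] := coef_cross C0 coefP mk ml (off _ _ mk ml lk); rewrite !mulr0.
have dBA l : (m <= l)%N -> ip P (B m l) (A m l) = 0.
  move=> ml; rewrite iBl//; last exact: sA.
  by rewrite ipC (coef_re_im C0 coefP ml) mulr0.
have dAB l : (m <= l)%N -> ip P (A m l) (B m l) = 0 by move=> ml; rewrite ipC dBA.
have dAA l : (m <= l)%N -> ip P (A m l) (A m l) = C l / harm_weight m.
  by move=> ml; have [] := coef_re_moments C0 coefP ml.
have dBB l : (m <= l)%N -> ip P (B m l) (B m l) = (m != 0%N)%:R * (C l / harm_weight m).
  move=> ml; rewrite iBl//; last exact: sB.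
  rewrite ipC iBl//; last exact: sI.
  have [_ _ ->] := coef_im_moments C0 coefP ml.
  by case: (m != 0%N); rewrite ?mul1r ?mul0r.
have sE n : s n = ip P (hre m z1 n) (hre m z2 n) + ip P (him m z1 n) (him m z2 n).
  rewrite (cross A A _ n (@sA m) (@sA m) oAA dAA) (cross B B _ n (@sB m) (@sB m) oBB dBB).
  rewrite -big_split/=; apply: eq_bigr => l _; rewrite -mulrDr.
  (* For m > 0 the real and imaginary parts contribute C_l / 2 each, for m = 0 the real part
     contributes all of C_l. *)
  have -> : C l / harm_weight m + (m != 0%N)%:R * (C l / harm_weight m) = C l.
    by rewrite /harm_weight; case: eqP => _ /=; field.
  by ring.
have c_s : s @ \oo --> ip P (gre T m z1) (gre T m z2) + ip P (gim T m z1) (gim T m z2).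
  rewrite (_ : s = fun n => ip P (hre m z1 n) (hre m z2 n) +
    ip P (him m z1 n) (him m z2 n)); last by apply/funext => n; exact: sE.
  by apply: cvgD; apply: l2cvg_ip => //;
    [exact: l2cvg_hre|exact: l2cvg_hre|exact: l2cvg_him|exact: l2cvg_him].
have zsum n : \sum_(m <= l < n) Llm l (Posz m) z1 * Llm l (Posz m) z2 * 0 = 0.
  by rewrite big1// => l _; rewrite mulr0.
(* The mixed moments vanish for every partial sum, hence in the limit; they make up the imaginary
   part of the covariance. *)
have z_ri : ip P (gre T m z1) (gim T m z2) = 0.
  have := l2cvg_ip (shre m z1) (shim m z2) sr1 si2 (l2cvg_hre m h1) (l2cvg_him m h2).
  under eq_fun do rewrite (cross A B (fun=> 0) _ (@sA m) (@sB m) oAB dAB) zsum.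
  by move=> c0; exact: (cvg_unique (@Rhausdorff R) c0 (cvg_cst (0 : R))).
have z_ir : ip P (gim T m z1) (gre T m z2) = 0.
  have := l2cvg_ip (shim m z1) (shre m z2) si1 sr2 (l2cvg_him m h1) (l2cvg_hre m h2).
  under eq_fun do rewrite (cross B A (fun=> 0) _ (@sB m) (@sA m) oBA dBA) zsum.
  by move=> c0; exact: (cvg_unique (@Rhausdorff R) c0 (cvg_cst (0 : R))).
have irr := sqint_integrableM sr1 sr2; have iii := sqint_integrableM si1 si2.
have iri := sqint_integrableM sr1 si2; have iir := sqint_integrableM si1 sr2.
split.
- split.
    under eq_fun do rewrite ReX EFinD; exact: integrableD.
  under eq_fun do rewrite ImX EFinB; exact: integrableB.
- exact: cvgP c_s.
- rewrite (cvg_lim (@Rhausdorff R) c_s) /cexpectation; congr (_ +i* _).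
    rewrite unlock; under eq_integral do rewrite ReX.
    exact: (RintegralD measurableT irr iii).
  rewrite unlock; under eq_integral do rewrite ImX.
  transitivity (ip P (gre T m z1) (gim T m z2) - ip P (gim T m z1) (gre T m z2)).
    exact: (RintegralB measurableT iri iir).
  by rewrite z_ri z_ir subrr.
Qed.

End FourierModes.

Theorem lemma2p1 (R : realType) (d : measure_display)
    (Omega : measurableType d) (P : probability Omega R)
    (T : R * R * R -> Omega -> R) (C : nat -> R)
    (M : nat) (kappa : 'I_M -> R[i])
    (T_gaussian : gaussian_field P (@sphere R) (fun x w => (T x w)%:C))
    (T_centred : centred_field P (@sphere R) (fun x w => (T x w)%:C))
    (T_isotropic : weakly_isotropic P 2 T)
    (T_spectrum : angular_power_spectrum P T C)
    (M_gt0 : (0 < M)%N)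
    (kappa_neq0 : forall (i : 'I_M) (l : nat),
       kappa i + (l * (l + 1))%:R != 0)
    (C_form : forall l : nat,
       (C l)%:C = \prod_(i < M) (kappa i + (l * (l + 1))%:R)^-1) :
  [/\ forall m : nat,
        gaussian_field P (@segment11 R) (gfield T m%:Z) /\
        centred_field P (@segment11 R) (gfield T m%:Z),
      forall m n : nat, m != n ->
        independent_fields P (@segment11 R) (gfield T m%:Z) (gfield T n%:Z),
      forall (m : nat) (z1 z2 : R), segment11 z1 -> segment11 z2 ->
        let X w := conjc (gfield T m%:Z z1 w) * gfield T m%:Z z2 w in
        let s (n : nat) :=
          \sum_(m <= l < n) C l * Llm l m%:Z z1 * Llm l m%:Z z2 in
        [/\ cintegrable P X, cvgn s & cexpectation P X = (limn s)%:C] &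
      forall (m : int) (z : R) (w : Omega), m < 0 -> segment11 z ->
        gfield T m z w = conjc (gfield T (- m) z w)].
Proof.
have [C_ge0 _ [a [coefP [_ expP]]]] := T_spectrum.
split.
- move=> m; split.
    exact: (gfield_gaussian T_gaussian T_centred C_ge0 coefP expP).
  exact: (gfield_centred T_gaussian T_centred C_ge0 coefP expP).
- by move=> m n; exact: (gfield_independent T_gaussian C_ge0 coefP expP).
- by move=> m z1 z2; exact: (gfield_covariance T_gaussian C_ge0 coefP expP).
- by move=> m z w m0 _; exact: gfield_conj.
Qed.
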